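(* Let $m\ge 1$, let $d_1, d_2, \dots, d_m$ be any real numbers, let $\chi_1,\chi_2,\dots,\chi_m$ be any Dirichlet characters, and let $\mathcal K$ be a compact subset of the strip $\{s\in\mathbb C : 1/2<\operatorname{Re}s<1\}$. Then for every $\varepsilon>0$, except for an at most countable set of values of $\varepsilon$, the limit $$\lim_{T\to\infty}\frac1T\,\mathrm{meas}\left\{\tau\in[0,T] : \max_{1\le j,k\le m}\ \max_{s\in\mathcal K}\left|L(s+id_j\tau,\chi_j)-L(s+id_k\tau,\chi_k)\right|<\varepsilon\right\}$$ exists.
   Context: For a Dirichlet character $\chi$ modulo $q$ (any $q\ge1$), $L(s,\chi)$ denotes the Dirichlet $L$-function, given for $\operatorname{Re}s>1$ by $L(s,\chi)=\sum_{n=1}^\infty \chi(n)n^{-s}$ and extended by analytic continuation (for $q=1$ it is the Riemann zeta-function $\zeta(s)$). $\mathrm{meas}\,A$ denotes the Lebesgue measure of a measurable set $A\subset\mathbb R$. *)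

(* Defs.v *)
From HB Require Import structures.
From mathcomp Require Import all_boot all_order all_algebra.
From mathcomp Require Import all_classical all_reals all_analysis.
From mathcomp Require Import complex.

Set Implicit Arguments.
Unset Strict Implicit.
Unset Printing Implicit Defensive.

Import Order.TTheory GRing.Theory Num.Theory.
Import numFieldNormedType.Exports.

Local Open Scope classical_set_scope.
Local Open Scope complex_scope.
Local Open Scope ring_scope.

(* The complex plane, as a normed module over itself: [R[i]] alone carries no
   topology in the library. *)
Notation CC R := (R[i]^o).

Section Defs.
Context {R : realType}.
Local Notation C := (CC R).

Record is_dirichlet_character (q : nat) (chi : int -> R[i]) : Prop :=
  IsDirichletCharacter {
    dirichlet_modulus_gt0 : (0 < q)%N ;
    dirichletM : forall a b : int, chi (a * b) = chi a * chi b ;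
    dirichlet_periodic : forall a : int, chi (a + q%:Z) = chi a ;
    dirichlet_eq0 : forall a : int, (chi a == 0) = ~~ coprimez a q%:Z }.

(* A Dirichlet character vanishes exactly off the residues prime to its modulus,
   so this is the usual notion. *)
Definition principal (chi : int -> R[i]) : Prop :=
  forall a : int, chi a != 0 -> chi a = 1.

Definition cexp (z : R[i]) : R[i] :=
  (expR (complex.Re z))%:C * (cos (complex.Im z) +i* sin (complex.Im z)).

(* n ^ s = exp (s ln n), meaningful for n > 0. *)
Definition cpown (n : nat) (s : R[i]) : R[i] := cexp (s * (ln n%:R)%:C).

Definition analytic_at (f : C -> C) (s : C) : Prop :=
  exists a : nat -> C, \forall z \near s,
    [series a k * (z - s) ^+ k]_k @ \oo --> f z.

(* L is the Dirichlet series of chi on Re s > 1, and is analytic on the whole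
   plane, except at the pole s = 1 when chi is principal. The plane minus a point
   being connected, at most one function has these properties, up to its value at
   the pole. The nth term of the series is the one of index n.+1. *)
Definition is_dirichletL (chi : int -> R[i]) (L : C -> C) : Prop :=
  (forall s : C, 1 < complex.Re s ->
     [series (chi n.+1%:Z * cpown n.+1 (- s) : C)]_n @ \oo --> L s) /\
  (forall s : C, s != 1 \/ ~ principal chi -> analytic_at L s).

(* The analytic continuation is known to exist; the default value 0 of [xget] is
   only there to make the definition total. *)
Definition dirichletL (chi : int -> R[i]) : C -> C :=
  xget (fun=> 0) [set L | is_dirichletL chi L].

End Defs.

(* Main.v *)
(* Let D(tau) be the maximum in the statement and F_T(eps) the proportion of tau in
   [0, T] with D(tau) < eps. It suffices that limsup F_T(eps) <= liminf F_T(eps')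
   whenever eps < eps': the intervals between liminf and limsup are then disjoint for
   distinct eps, so only countably many of them are nondegenerate. This inequality
   holds for a function of uniformly almost periodic functions, by translating
   intervals, and it survives approximation outside sets of small upper density, so
   that one has to approximate L(s + i d tau, chi), uniformly for s in K and for most
   tau, by almost periodic functions of tau.

   For d = 0 there is nothing to do. Otherwise, (1 - 2^(1-s)) L(s, chi) is a Dirichlet
   series whose coefficients are periodic with mean zero over a period, and one
   approximates with its first N terms, N fixed. Repeated summation by parts, using
   that finite differences of order k of n^(-s) are O(|s|^k n^(-Re s - k)), shows that
   for |s| << T the remainder after Y = T^(1+rho/2) terms is o(1). The terms between N
   and Y are small in mean square on K + i d [0, T]: on the points of an arithmetic
   progression of step h ~ 1/log Y the sums over tau are geometric, hence the diagonal
   gives O(T N^(-2 rho)) and, as Re s > 1/2 + 2 rho, the rest gives O(T^(1-rho));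
   between these points, and for s in a small disc, one expands n^(-w) in powers of w.
   If the analytic continuation did not exist, dirichletL would be 0 by definition, so
   its existence is never needed. *)

Require Import Defs.
From mathcomp Require Import all_boot all_order all_algebra.
From mathcomp Require Import all_classical all_reals all_analysis.
From mathcomp Require Import complex.
From mathcomp Require Import zify ring lra.

Set Implicit Arguments.
Unset Strict Implicit.
Unset Printing Implicit Defensive.

Import Order.TTheory GRing.Theory Num.Theory.
Import numFieldNormedType.Exports.
Local Open Scope classical_set_scope.
Local Open Scope complex_scope.
Local Open Scope ring_scope.

Local Notation normc := Normc.normc.

(** All volumes are Lebesgue outer measures, and every estimate is a covering argument:
    monotonicity, finite subadditivity and translation are what it rests on. The slack between eps
    and eps' is spent on replacing the functions by almost periodic ones, on translating, on going
    back, and on passing between strict and weak inequalities.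

    The exponents: K lies in Re s >= 1/2 + 2 rho. One rho pays for the powers of ln n that the
    expansion of n^(-w) produces, which leaves alpha = 1/2 + rho. The off-diagonal part is then Y^(2
    (1 - alpha)) up to logarithms, which are bounded by Y^(rho/2). For Y about T^(1 + rho/2) this is
    T^((1 + rho/2) (1 - 3 rho/2)), below T^(1 - rho). Any exponent of Y above 1 makes the remainder
    small, since summation by parts can be repeated as often as desired; the off-diagonal part is
    what forces it to be close to 1. *)

Lemma eqW d (T : porderType d) (x y : T) : x = y -> (x <= y)%O.
Proof. by move=> ->. Qed.

(** * Complex numbers *)

Section ComplexNorm.
Context {R : rcfType}.
Implicit Types (x y z : R[i]) (a b : R).

Lemma normc_ge0 z : 0 <= normc z.
Proof. by case: z => a b; rewrite sqrtr_ge0. Qed.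

Lemma normcD_le x y : normc (x + y) <= normc x + normc y.
Proof. exact: le_normcD. Qed.

Lemma normc_opp z : normc (- z) = normc z.
Proof. exact: normcN. Qed.

Lemma normcB_le x y : normc (x - y) <= normc x + normc y.
Proof. by rewrite (le_trans (normcD_le _ _))// normc_opp. Qed.

Lemma normc_sub x y : normc (x - y) = normc (y - x).
Proof. by rewrite -normc_opp opprB. Qed.

Lemma normc_sub_trans y x z : normc (x - z) <= normc (x - y) + normc (y - z).
Proof. by rewrite -(subrKA y x (- z)); exact: normcD_le. Qed.

Lemma normc_eq0 z : (normc z == 0) = (z == 0).
Proof.
apply/eqP/eqP => [/Normc.eq0_normc //|->]; exact: Normc.normc0.
Qed.

Lemma normc_gt0 z : (0 < normc z) = (z != 0).
Proof. by rewrite lt_def normc_eq0 normc_ge0 andbT. Qed.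

Lemma normcX z n : normc (z ^+ n) = normc z ^+ n.
Proof.
by elim: n => [|n ih]; rewrite ?expr0 ?Normc.normc1// !exprS Normc.normcM ih.
Qed.

Lemma normc_sum I (r : seq I) (P : pred I) (F : I -> R[i]) :
  normc (\sum_(i <- r | P i) F i) <= \sum_(i <- r | P i) normc (F i).
Proof.
elim/big_ind2: _ => [|x1 x2 y1 y2 h1 h2|//]; first by rewrite Normc.normc0.
by rewrite (le_trans (normcD_le _ _))// lerD.
Qed.

Lemma normc_real a : normc a%:C = `|a|.
Proof. by rewrite /normc /= expr0n/= addr0 sqrtr_sqr. Qed.

Lemma normc_nat n : normc (n%:R : R[i]) = n%:R.
Proof. by rewrite -(rmorph_nat (real_complex R)) normc_real ger0_norm. Qed.

Lemma normc_Re_le z : `|complex.Re z| <= normc z.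
Proof.
case: z => a b /=; rewrite -sqrtr_sqr ler_wsqrtr//.
by rewrite lerDl sqr_ge0.
Qed.

Lemma normc_Im_le z : `|complex.Im z| <= normc z.
Proof.
case: z => a b /=; rewrite -sqrtr_sqr ler_wsqrtr//.
by rewrite lerDr sqr_ge0.
Qed.

Lemma normc_le_ReIm z : normc z <= `|complex.Re z| + `|complex.Im z|.
Proof.
rewrite [z in normc z]complexE (le_trans (normcD_le _ _))// Normc.normcM !normc_real.
by rewrite lerD2l /normc expr0n/= expr1n add0r sqrtr1 mul1r.
Qed.

Lemma Re_realM a z : complex.Re (a%:C * z) = a * complex.Re z.
Proof. by case: z => x y /=; rewrite mul0r subr0. Qed.

Lemma Im_realM a z : complex.Im (a%:C * z) = a * complex.Im z.
Proof. by case: z => x y /=; rewrite mul0r addr0. Qed.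

Lemma sqr_normcE z : (normc z ^+ 2)%:C = z * z^*%C.
Proof. by rewrite -sqr_normc normc_def rmorphXn; case: z. Qed.

Lemma normc_le_add x y : normc x <= normc (x - y) + normc y.
Proof. by rewrite -[x in leLHS](subrK y) normcD_le. Qed.

End ComplexNorm.

Section ComplexExponential.
Context {R : realType}.
Implicit Types (x y z s w : R[i]) (a b u : R).

Lemma cexpD x y : cexp (x + y) = cexp x * cexp y.
Proof.
case: x y => [a b] [c d]; rewrite /cexp /= expRD cosD sinD.
apply/eqP; rewrite eq_complex /=; apply/andP; split; apply/eqP; ring.
Qed.

Lemma cexp0 : cexp 0 = 1 :> R[i].
Proof. by rewrite /cexp /= expR0 cos0 sin0 mul1r. Qed.

Lemma normc_cexp z : normc (cexp z) = expR (complex.Re z).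
Proof.
rewrite /cexp Normc.normcM normc_real ger0_norm ?expR_ge0//.
by rewrite /normc cos2Dsin2 sqrtr1 mulr1.
Qed.

Lemma cexpMn z n : cexp (z *+ n) = cexp z ^+ n.
Proof. by elim: n => [|n ih]; rewrite ?cexp0// mulrS cexpD exprS ih. Qed.

Lemma cexp_real a : cexp a%:C = (expR a)%:C.
Proof. by rewrite /cexp/= cos0 sin0 mulr1. Qed.

Lemma conjc_cexp z : (cexp z)^* = cexp z^*%C.
Proof.
case: z => a b; rewrite /cexp /= cosN sinN.
by apply/eqP; rewrite eq_complex /= !mul0r ?oppr0 ?subr0 ?addr0 mulrN !eqxx.
Qed.

Lemma cpown1 s : cpown 1 s = 1.
Proof. by rewrite /cpown ln1 mulr0 cexp0. Qed.

Lemma cpownM m n s : (0 < m)%N -> (0 < n)%N ->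
  cpown (m * n) s = cpown m s * cpown n s.
Proof.
move=> m0 n0; rewrite /cpown -cexpD -mulrDr -rmorphD/= natrM lnM//;
by rewrite posrE ltr0n.
Qed.

Lemma normc_cpown n s : (0 < n)%N -> normc (cpown n s) = n%:R `^ complex.Re s.
Proof.
move=> n0; rewrite /cpown normc_cexp /powR pnatr_eq0 eqn0Ngt n0 /=.
by case: s => a b /=; rewrite mulr0 subr0.
Qed.

End ComplexExponential.

(** * Calculus for complex functions of a real variable *)

Section RealVariable.
Context {R : realType}.
Implicit Types (f g : R -> R[i]) (x y u : R) (a b : R[i]).

Definition is_cderive f u a :=
  is_derive u 1 (fun x => complex.Re (f x)) (complex.Re a) /\
  is_derive u 1 (fun x => complex.Im (f x)) (complex.Im a).

Lemma is_cderiveD f g u a b : is_cderive f u a -> is_cderive g u b ->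
  is_cderive (fun x => f x + g x) u (a + b).
Proof.
move=> [fr fi] [gr gi]; split; rewrite raddfD/=.
  rewrite (_ : (fun _ => _) = (fun x => complex.Re (f x)) + (fun x => complex.Re (g x))).
    exact: is_deriveD.
  by apply/funext => x /=; rewrite raddfD.
rewrite (_ : (fun _ => _) = (fun x => complex.Im (f x)) + (fun x => complex.Im (g x))).
  exact: is_deriveD.
by apply/funext => x /=; rewrite raddfD.
Qed.

Lemma is_cderiveN f u a : is_cderive f u a -> is_cderive (fun x => - f x) u (- a).
Proof.
move=> [fr fi]; split; rewrite raddfN/=.
  rewrite (_ : (fun _ => _) = - (fun x => complex.Re (f x))).
    exact: is_deriveN.
  by apply/funext => x /=; rewrite raddfN.
rewrite (_ : (fun _ => _) = - (fun x => complex.Im (f x))).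
  exact: is_deriveN.
by apply/funext => x /=; rewrite raddfN.
Qed.

Lemma is_cderiveB f g u a b : is_cderive f u a -> is_cderive g u b ->
  is_cderive (fun x => f x - g x) u (a - b).
Proof. by move=> fa gb; apply: is_cderiveD => //; exact: is_cderiveN. Qed.

Lemma is_cderive_cst a u : is_cderive (fun=> a) u 0.
Proof. by split; exact: is_derive_cst. Qed.

Lemma is_derive_mulr (c u : R) : is_derive u 1 (fun x : R => x * c) c.
Proof.
have := @is_deriveM R R id (cst c) u 1 1 0 (is_derive_id _ _) (is_derive_cst _ _ _).
by rewrite /GRing.scale/= mulr0 add0r mulr1.
Qed.

Lemma is_cderive_scale a u : is_cderive (fun x => x%:C * a) u a.
Proof.
split.
  rewrite (_ : (fun _ => _) = (fun x => x * complex.Re a)).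
    exact: is_derive_mulr.
  by apply/funext => x; case: a => a1 a2 /=; rewrite mul0r subr0.
rewrite (_ : (fun _ => _) = (fun x => x * complex.Im a)).
  exact: is_derive_mulr.
by apply/funext => x; case: a => a1 a2 /=; rewrite mul0r addr0.
Qed.

Lemma is_cderive_cexp f u a : is_cderive f u a ->
  is_cderive (fun x => cexp (f x)) u (a * cexp (f u)).
Proof.
move=> [fr fi].
have He : is_derive u 1 (fun x => expR (complex.Re (f x)))
    (expR (complex.Re (f u)) * complex.Re a) by exact: is_derive1_comp.
have Hc : is_derive u 1 (fun x => cos (complex.Im (f x)))
    (- sin (complex.Im (f u)) * complex.Im a) by exact: is_derive1_comp.
have Hs : is_derive u 1 (fun x => sin (complex.Im (f x)))
    (cos (complex.Im (f u)) * complex.Im a) by exact: is_derive1_comp.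
split.
  rewrite (_ : (fun _ => _) = (fun x => expR (complex.Re (f x))) *
     (fun x => cos (complex.Im (f x)))).
    apply: (is_derive_eq (is_deriveM _ _)).
    rewrite /cexp; case: (f u) => p q; case: a {fr fi He Hc Hs} => a1 a2 /=.
    rewrite /GRing.scale/=; ring.
  by apply/funext => x; rewrite /cexp /= mul0r subr0.
rewrite (_ : (fun _ => _) = (fun x => expR (complex.Re (f x))) *
   (fun x => sin (complex.Im (f x)))).
  apply: (is_derive_eq (is_deriveM _ _)).
  rewrite /cexp; case: (f u) => p q; case: a {fr fi He Hc Hs} => a1 a2 /=.
  rewrite /GRing.scale/=; ring.
by apply/funext => x; rewrite /cexp /= mul0r addr0.
Qed.

(** The mean value theorem applied to [p - f], whose derivative is nonnegative. *)
Lemma real_increment_le (f f' p p' : R -> R) x y : x <= y ->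
  (forall u, x <= u <= y -> is_derive u 1 f (f' u)) ->
  (forall u, x <= u <= y -> is_derive u 1 p (p' u)) ->
  (forall u, x <= u <= y -> f' u <= p' u) ->
  f y - f x <= p y - p x.
Proof.
move=> xy df dp le.
have dg u : x <= u <= y -> is_derive u 1 (p - f) (p' u - f' u).
  by move=> xuy; apply: is_deriveB; [exact: dp|exact: df].
have [||c /[1!in_itv]/= cxy] := @MVT_segment _ (p - f) (fun u => p' u - f' u) x y xy.
- move=> u /[1!in_itv]/= /andP[xu uy]; apply: dg; lra.
- apply: derivable_within_continuous => u uxy; have /dg : x <= u <= y by move: uxy; rewrite in_itv.
  by case.
rewrite !fctE => e.
have := le _ cxy; rewrite -subr_ge0 => h.
have : 0 <= (p' c - f' c) * (y - x) by rewrite mulr_ge0// subr_ge0.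
rewrite -e; lra.
Qed.

(* The factor 2 comes from bounding real and imaginary parts separately. *)
Lemma normc_increment_le f f' (p p' : R -> R) x y : x <= y ->
  (forall u, x <= u <= y -> is_cderive f u (f' u)) ->
  (forall u, x <= u <= y -> is_derive u 1 p (p' u)) ->
  (forall u, x <= u <= y -> normc (f' u) <= p' u) ->
  normc (f y - f x) <= 2 * (p y - p x).
Proof.
move=> xy df dp le.
have key (g g' : R -> R) : (forall u, x <= u <= y -> is_derive u 1 g (g' u)) ->
    (forall u, x <= u <= y -> `|g' u| <= p' u) -> `|g y - g x| <= p y - p x.
  move=> dg leg; rewrite ler_norml; apply/andP; split; last first.
    apply: (real_increment_le xy dg dp) => u /leg; exact: (le_trans (ler_norm _)).
  rewrite -lerN2 opprB opprK.
  rewrite (_ : g x - g y = (- g) y - (- g) x); last first.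
    by rewrite !fctE opprK addrC.
  apply: (@real_increment_le _ (- g')) => // u xuy.
    by apply: is_deriveN; exact: dg.
  by have := leg _ xuy; rewrite ler_norml !fctE; lra.
rewrite (le_trans (normc_le_ReIm _))// !raddfB/= mulr_natl mulr2n lerD//.
  apply: (key (fun u => complex.Re (f u)) (fun u => complex.Re (f' u))) => u xuy; first by case: (df _ xuy).
  exact: (le_trans (normc_Re_le _) (le _ xuy)).
apply: (key (fun u => complex.Im (f u)) (fun u => complex.Im (f' u))) => u xuy; first by case: (df _ xuy).
exact: (le_trans (normc_Im_le _) (le _ xuy)).
Qed.

End RealVariable.

(** * Taylor remainder of the exponential *)

Section Taylor.
Context {R : realType}.
Implicit Types (z : R[i]) (u : R).

Lemma is_derive_exprn (u : R) n :
  is_derive u 1 (fun x : R => x ^+ n.+1) (n.+1%:R * u ^+ n).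
Proof.
have := @is_deriveX R R id n.+1 u 1 1 (is_derive_id _ _).
by rewrite /GRing.scale/= mulr1 exprfctE.
Qed.

Definition cexp_sum z K : R[i] := \sum_(k < K) z ^+ k / k`!%:R.

Lemma is_cderive_cexp_sum z u K :
  is_cderive (fun x => cexp_sum (x%:C * z) K.+1) u (z * cexp_sum (u%:C * z) K).
Proof.
elim: K => [|K ih].
  rewrite /cexp_sum big_ord0 mulr0.
  rewrite (_ : (fun _ => _) = cst 1); first exact: is_cderive_cst.
  by apply/funext => x; rewrite big_ord_recl big_ord0 expr0 fact0 divr1 addr0.
rewrite /cexp_sum in ih *; rewrite big_ord_recr mulrDr/=.
under eq_fun do rewrite big_ord_recr /=.
apply: is_cderiveD => //.
set b : R[i] := z ^+ K.+1 / K.+1`!%:R.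
have -> : z * ((u%:C * z) ^+ K / K`!%:R) = (K.+1%:R * u ^+ K)%:C * b.
  have h1 : (K`!%:R : R[i]) != 0 by rewrite pnatr_eq0 -lt0n fact_gt0.
  have h2 : (K.+1%:R : R[i]) != 0 by rewrite pnatr_eq0.
  rewrite /b factS natrM rmorphM rmorphXn rmorph_nat exprMn exprS.
  by move: h1 h2; move: (K`!%:R) (K.+1%:R) => p q h1 h2; field; rewrite h1 h2.
have dX : is_derive u 1 (fun x => x ^+ K.+1) (K.+1%:R * u ^+ K).
  exact: is_derive_exprn.
have dXc (d : R) : is_derive u 1 (fun x => d * x ^+ K.+1) (K.+1%:R * u ^+ K * d).
  have := @is_deriveM R R (cst d) (fun x => x ^+ K.+1) u 1 _ _
    (is_derive_cst _ _ _) dX.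
  by rewrite /GRing.scale/= mulr0 addr0 [d * _]mulrC.
have e x : (x%:C * z) ^+ K.+1 / K.+1`!%:R = (x ^+ K.+1)%:C * b.
  by rewrite exprMn -mulrA -/b rmorphXn.
split.
  rewrite Re_realM (_ : (fun _ => _) = (fun x => complex.Re b * x ^+ K.+1))//.
  by apply/funext => x; rewrite e Re_realM mulrC.
rewrite Im_realM (_ : (fun _ => _) = (fun x => complex.Im b * x ^+ K.+1))//.
by apply/funext => x; rewrite e Im_realM mulrC.
Qed.

(** Along the segment from 0 to z, the remainder of order K + 1 has derivative z times the remainder
    of order K, so the bound follows by induction on K. The power of 2 accumulates the factor 2 of
    [normc_increment_le]; the factorial dominates it. *)
Lemma cexp_taylor z K :
  normc (cexp z - cexp_sum z K) <= (2 * normc z) ^+ K / K`!%:R * expR (normc z).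
Proof.
(* The induction needs the bound at every point u z of the segment, with its dependence on u, in
   order to integrate it. *)
suff H u : 0 <= u <= 1 -> normc (cexp (u%:C * z) - cexp_sum (u%:C * z) K) <=
    (2 * normc z * u) ^+ K / K`!%:R * expR (normc z).
  by have := H 1; rewrite mul1r mulr1; apply; rewrite ler01 lexx.
elim: K u => [|K ih] u /andP[u0 u1].
  rewrite /cexp_sum big_ord0 subr0 normc_cexp expr0 fact0 divr1 mul1r ler_expR.
  rewrite (le_trans (ler_norm _))// (le_trans (normc_Re_le _))//.
  by rewrite Normc.normcM normc_real ger0_norm// ler_piMl// normc_ge0.
pose f x := cexp (x%:C * z) - cexp_sum (x%:C * z) K.+1.
pose f' x := z * cexp (x%:C * z) - z * cexp_sum (x%:C * z) K.
pose M := 2 ^+ K * normc z ^+ K.+1 / K.+1`!%:R * expR (normc z).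
pose p x := x ^+ K.+1 * M.
pose p' x := (K.+1%:R * x ^+ K) * M.
have df x : 0 <= x <= u -> is_cderive f x (f' x).
  move=> _; exact: (is_cderiveB (is_cderive_cexp (is_cderive_scale z x))
    (is_cderive_cexp_sum z x K)).
have dp x : 0 <= x <= u -> is_derive x 1 p (p' x).
  move=> _; have dX : is_derive x 1 (fun x => x ^+ K.+1) (K.+1%:R * x ^+ K).
    exact: is_derive_exprn.
  have := @is_deriveM R R (fun x => x ^+ K.+1) (cst M) x 1 _ _ dX (is_derive_cst _ _ _).
  by rewrite /GRing.scale/= mulr0 add0r [M * _]mulrC.
have := @normc_increment_le _ f f' p p' 0 u u0 df dp.
have -> : f 0 = 0.
  rewrite /f mul0r cexp0 /cexp_sum big_ord_recl expr0 fact0 divr1 big1 ?addr0 ?subrr//.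
  by move=> i _; rewrite exprS !mul0r.
rewrite subr0 {2}/p expr0n mul0r subr0 => /(_ _)/le_trans; apply.
  move=> x /andP[x0 xu]; rewrite /f' -mulrBr Normc.normcM.
  have x01 : 0 <= x <= 1 by rewrite x0 (le_trans xu).
  rewrite (le_trans (ler_wpM2l (normc_ge0 z) (ih x x01)))// le_eqVlt; apply/orP; left.
  apply/eqP; rewrite /p' /M factS natrM !exprMn exprS.
  have h1 : (K`!%:R : R) != 0 by rewrite pnatr_eq0 -lt0n fact_gt0.
  have h2 : (K.+1%:R : R) != 0 by rewrite pnatr_eq0.
  by move: h1 h2; move: (K`!%:R) (K.+1%:R) => a b h1 h2; field; rewrite h1 h2.
rewrite /p /M le_eqVlt; apply/orP; left; apply/eqP.
by rewrite !exprMn [2 ^+ K.+1]exprS; ring.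
Qed.

End Taylor.

(** * Finite differences of powers *)

Section RealPower.
Context {R : realType}.
Implicit Types (s : R[i]) (u : R).

Definition rpow s u : R[i] := cexp (- s * (ln u)%:C).

Lemma normc_rpow s u : 0 < u -> normc (rpow s u) = u `^ (- complex.Re s).
Proof.
move=> u0; rewrite /rpow normc_cexp /powR gt_eqF//.
by case: s => a b /=; rewrite mulr0 subr0.
Qed.

Lemma is_cderive_rpow s u : 0 < u -> is_cderive (rpow s) u (- s * rpow (s + 1) u).
Proof.
move=> u0.
have dl : is_cderive (fun x => - s * (ln x)%:C) u (- s * (u^-1)%:C).
  have [d1 d2] := is_cderive_scale (- s) (ln u).
  have dln := is_derive1_ln u0.
  split.
    have := is_derive1_comp d1 dln; rewrite mulrC -Re_realM mulrC.
    by congr is_derive; apply/funext => x /=; rewrite mulrC.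
  have := is_derive1_comp d2 dln; rewrite mulrC -Im_realM mulrC.
  by congr is_derive; apply/funext => x /=; rewrite mulrC.
have -> : - s * rpow (s + 1) u = - s * (u^-1)%:C * rpow s u.
  rewrite /rpow opprD mulrDl cexpD -mulrA; congr (_ * _); rewrite mulrC; congr (_ * _).
  by rewrite mulN1r -rmorphN cexp_real expRN lnK.
exact: is_cderive_cexp.
Qed.

Definition fdiff (f : R -> R[i]) u := f (u + 1) - f u.

Lemma is_cderive_fdiff f f' :
  (forall u, 0 < u -> is_cderive f u (f' u)) ->
  forall u, 0 < u -> is_cderive (fdiff f) u (fdiff f' u).
Proof.
move=> df u u0; apply: is_cderiveB; last exact: df.
have [d1 d2] : is_cderive f (u + 1) (f' (u + 1)) by apply: df; rewrite addr_gt0.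
have dD : is_derive u 1 (fun x => x + 1) (1 : R).
  by rewrite -[X in is_derive _ _ _ X]addr0; exact: is_deriveD.
split.
  have := @is_derive1_comp R _ (fun x => x + 1) u _ _ d1 dD; by rewrite mulr1.
have := @is_derive1_comp R _ (fun x => x + 1) u _ _ d2 dD; by rewrite mulr1.
Qed.

Lemma is_cderive_iter_fdiff f f' k :
  (forall u, 0 < u -> is_cderive f u (f' u)) ->
  forall u, 0 < u -> is_cderive (iter k fdiff f) u (iter k fdiff f' u).
Proof. by move=> df; elim: k => // k ih; exact: is_cderive_fdiff. Qed.

Lemma iter_fdiff_scale (a : R[i]) f k :
  iter k fdiff (fun x => a * f x) = (fun x => a * iter k fdiff f x).
Proof.
by elim: k => // k /= ->; apply/funext => u; rewrite /fdiff mulrBr.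
Qed.

Lemma powRN_le (x y p : R) : 0 < x -> x <= y -> 0 <= p -> y `^ (- p) <= x `^ (- p).
Proof.
move=> x0 xy p0; rewrite !powRN lef_pV2 ?posrE ?powR_gt0//.
  by rewrite ge0_ler_powR// nnegrE ltW// (lt_le_trans x0).
exact: lt_le_trans xy.
Qed.

(** Differencing commutes with differentiation, and the derivative of u^(-s) is -s u^(-s-1). So one
    difference costs a factor 2 |s| and reduces the claim to the order k - 1 at s + 1. *)
Lemma normc_iter_fdiff_rpow k s u : 0 <= complex.Re s -> 0 < u ->
  normc (iter k fdiff (rpow s) u) <=
  (\prod_(j < k) (2 * normc (s + j%:R))) * u `^ (- (complex.Re s + k%:R)).
Proof.
elim: k s u => [|k ih] s u s0 u0.
  by rewrite big_ord0 mul1r addr0 normc_rpow.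
have uu1 : u <= u + 1 by rewrite lerDl.
(* A bound of the derivative on [u, u + 1], taken at the left end because the power decreases. *)
pose B := normc s * (\prod_(j < k) (2 * normc (s + 1 + j%:R))) *
  u `^ (- (complex.Re s + 1 + k%:R)).
rewrite iterS /fdiff.
rewrite (le_trans (@normc_increment_le _ _
  (iter k fdiff (fun v => - s * rpow (s + 1) v)) (fun x => x * B) (fun=> B)
  u (u + 1) uu1 _ _ _))//.
- move=> v /andP[uv _]; apply: is_cderive_iter_fdiff; last exact: lt_le_trans uv.
  by move=> x; exact: is_cderive_rpow.
- by move=> v _; exact: is_derive_mulr.
- move=> v /andP[uv _]; rewrite iter_fdiff_scale Normc.normcM normc_opp /B -mulrA.
  rewrite ler_wpM2l ?normc_ge0//.
  have v0 : 0 < v := lt_le_trans u0 uv.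
  have s1E : complex.Re (s + 1) = complex.Re s + 1 by rewrite raddfD.
  have s10 : 0 <= complex.Re (s + 1) by rewrite s1E addr_ge0.
  rewrite (le_trans (ih _ _ s10 v0))// s1E ler_wpM2l//.
    by rewrite prodr_ge0// => i _; rewrite mulr_ge0// normc_ge0.
  by rewrite powRN_le// !addr_ge0.
rewrite /B big_ord_recl /= addr0 -mulrBl [u + 1]addrC addrK mul1r.
rewrite -addrA [1 + k%:R]nat1r -!mulrA.
by under eq_bigr do rewrite -addrA nat1r.
Qed.

End RealPower.

Section PSeries.
Context {R : realType}.

Lemma powR1B (x p : R) : 0 < x -> x `^ (1 - p) = x * x `^ (- p).
Proof.
by move=> x0; rewrite powRD ?powRr1// ?ltW// (gt_eqF x0) implybT.
Qed.

(** A discrete integral test: the inequality [step], a form of Bernoulli's inequality obtained from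
    exp x >= 1 + x and ln (1 + x) <= x, makes the sum telescope. The first term is kept apart and
    gives the 1 in the constant. *)
Lemma pseries_le (p : R) N Y : 1 < p ->
  \sum_(N <= n < Y) n.+1%:R `^ (- p) <= (1 + (p - 1)^-1) * N.+1%:R `^ (1 - p).
Proof.
move=> p1; have p0 : 0 < p - 1 by rewrite subr_gt0.
have step n : (p - 1) * n.+2%:R `^ (- p) <= n.+1%:R `^ (1 - p) - n.+2%:R `^ (1 - p).
  have x0 : 0 < (n.+2%:R : R) by rewrite ltr0n.
  have y0 : 0 < (n.+1%:R : R) by rewrite ltr0n.
  have -> : n.+1%:R `^ (1 - p) = n.+2%:R * n.+2%:R `^ (- p) * (n.+1%:R / n.+2%:R) `^ (1 - p) :> R.
    by rewrite -powR1B// -powRM ?ltW ?divr_gt0// mulrC divfK ?gt_eqF.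
  rewrite (powR1B p x0).
  have h : 1 + (p - 1) / n.+2%:R <= (n.+1%:R / n.+2%:R) `^ (1 - p) :> R.
    rewrite /powR gt_eqF ?divr_gt0//.
    rewrite (le_trans _ (expR_ge1Dx _))// lerD2l.
    have lnle : ln (n.+1%:R / n.+2%:R) <= - n.+2%:R^-1 :> R.
      have -> : (n.+1%:R / n.+2%:R : R) = 1 + - n.+2%:R^-1.
        by move: x0; rewrite -[n.+2%:R]natr1; move: (n.+1%:R) => a a0; field; rewrite gt_eqF.
      by apply: le_ln1Dx; rewrite ltrN2 invf_lt1// ltr1n.
    have : 0 <= (p - 1) * (- n.+2%:R^-1 - ln (n.+1%:R / n.+2%:R)).
      by rewrite mulr_ge0 ?(ltW p0)// subr_ge0.
    by rewrite mulrBr subr_ge0 mulrN => h; rewrite -(opprB p) mulNr lerNr.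
  rewrite -subr_ge0.
  have -> : n.+2%:R * n.+2%:R `^ (- p) * (n.+1%:R / n.+2%:R) `^ (1 - p) -
     n.+2%:R * n.+2%:R `^ (- p) - (p - 1) * n.+2%:R `^ (- p) =
     n.+2%:R * n.+2%:R `^ (- p) * ((n.+1%:R / n.+2%:R) `^ (1 - p) - (1 + (p - 1) / n.+2%:R)) :> R.
    move: x0; move: (n.+2%:R) (_ `^ (- p)) (_ `^ (1 - p)) => a b c a0.
    by field; rewrite gt_eqF.
  by rewrite mulr_ge0 ?mulr_ge0 ?powR_ge0// subr_ge0.
have [YN|NY] := leqP Y N.
  by rewrite big_geq// mulr_ge0 ?powR_ge0// addr_ge0// invr_ge0 ltW.
rewrite big_ltn// mulrDl mul1r lerD//.
  by rewrite ler_powR ?ler1n//; lra.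
rewrite -(ler_pM2l p0) mulrA divff ?gt_eqF// mul1r mulr_sumr.
have : \sum_(N.+1 <= n < Y) (p - 1) * n.+1%:R `^ (- p) <=
    N.+1%:R `^ (1 - p) - Y%:R `^ (1 - p).
  have := @telescope_sumr R N.+1 Y (fun n => - n%:R `^ (1 - p)) NY.
  rewrite opprK [X in _ = X]addrC => <-; rewrite big_nat [leRHS]big_nat.
  apply: ler_sum => -[|n] // _; rewrite opprK [leRHS]addrC; exact: step.
move=> /le_trans; apply; by rewrite gerBl powR_ge0.
Qed.

End PSeries.

(** * Dirichlet series with periodic coefficients of mean zero *)

Section Abel.
Context {R : realType}.
Implicit Types (c b f : nat -> R[i]).

Definition ndiff f n := f n.+1 - f n.

Record periodic0 (Q : nat) c : Prop := Periodic0 {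
  periodic0_gt0 : (0 < Q)%N ;
  periodic0P : forall n, c (n + Q)%N = c n ;
  periodic0_sum : \sum_(i < Q) c i = 0 }.

Lemma periodic0_shift Q c : periodic0 Q c -> periodic0 Q (fun n => c n.+1).
Proof.
case=> Q0 cQ c0; split => // [n|]; first by rewrite -addSn cQ.
case: Q Q0 cQ c0 => // Q _ cQ; rewrite big_ord_recl big_ord_recr /=.
by rewrite -[Q.+1]add0n cQ addrC.
Qed.

Lemma periodic0_bounded Q c : periodic0 Q c ->
  exists2 B, 0 <= B & forall n, normc (c n) <= B.
Proof.
case=> Q0 cQ _; exists (\sum_(i < Q) normc (c i)).
  by rewrite sumr_ge0// => i _; rewrite normc_ge0.
move=> n; have cM m r : c (m * Q + r)%N = c r.
  by elim: m => // m ih; rewrite mulSn -addnA addnC cQ.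
rewrite (divn_eq n Q) cM (bigD1 (Ordinal (ltn_pmod n Q0)))//= lerDl.
by rewrite sumr_ge0// => i _; rewrite normc_ge0.
Qed.

(** Partial sums of c are periodic because c has mean zero. Subtracting their mean [mu] gives the
    primitive mean zero as well, so that summation by parts can be repeated. *)
Lemma periodic0_primitive Q c : periodic0 Q c ->
  exists2 b, periodic0 Q b & forall n, c n = ndiff b n.
Proof.
case=> Q0 cQ c0.
pose a n := \sum_(i < n) c i; pose mu := (\sum_(i < Q) a i) / Q%:R.
have Qn0 : (Q%:R : R[i]) != 0 by rewrite pnatr_eq0 -lt0n.
exists (fun n => a n - mu); last first.
  by move=> n; rewrite /ndiff /a big_ord_recr /= opprB addrA subrK addrC addKr.
split => // [n|]; last first.
  by rewrite sumrB sumr_const card_ord /mu -[_ *+ Q]mulr_natr divfK// subrr.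
congr (_ - _); elim: n => [|n ih]; first by rewrite add0n /a c0 big_ord0.
by rewrite addSn /a !big_ord_recr /= -/(a _) -/(a _) ih cQ.
Qed.

Lemma abel_summation b f N Y : (N <= Y)%N ->
  \sum_(N <= n < Y) ndiff b n * f n =
  b Y * f Y - b N * f N - \sum_(N <= n < Y) b n.+1 * ndiff f n.
Proof.
move=> NY; rewrite -(telescope_sumr (fun n => b n * f n) NY) -sumrB.
by apply: eq_bigr => n _; rewrite /ndiff; ring.
Qed.

(** Summation by parts, k times: each round moves one difference onto f and leaves a boundary term.
    The constant depends on c and k alone, which later allows f to depend on the height. *)
Lemma normc_sum_periodic0_le Q k c : periodic0 Q c ->
  exists2 C, 0 <= C & forall f N Y, (N <= Y)%N ->
    normc (\sum_(N <= n < Y) c n * f n) <=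
    C * (\sum_(j < k) (normc (iter j ndiff f N) + normc (iter j ndiff f Y)) +
         \sum_(N <= n < Y) normc (iter k ndiff f n)).
Proof.
elim: k c => [|k ih] c pc.
  have [B B0 cB] := periodic0_bounded pc; exists B => // f N Y _.
  rewrite big_ord0 add0r (le_trans (normc_sum _ _ _))// mulr_sumr.
  by apply: ler_sum => n _ /=; rewrite Normc.normcM ler_wpM2r ?normc_ge0.
have [b pb cb] := periodic0_primitive pc.
have [B B0 bB] := periodic0_bounded pb.
have [C C0 H] := ih _ (periodic0_shift pb).
exists (B + C) => [|f N Y NY]; first exact: addr_ge0.
have -> : \sum_(N <= n < Y) c n * f n = \sum_(N <= n < Y) ndiff b n * f n.
  by apply: eq_bigr => n _; rewrite cb.
rewrite abel_summation// (le_trans (normcB_le _ _))//.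
pose S := \sum_(j < k) (normc (iter j.+1 ndiff f N) + normc (iter j.+1 ndiff f Y)) +
  \sum_(N <= n < Y) normc (iter k.+1 ndiff f n).
have hS : normc (\sum_(N <= n < Y) b n.+1 * ndiff f n) <= C * S.
  rewrite (le_trans (H _ _ _ NY))// /S.
  rewrite ler_wpM2l// le_eqVlt; apply/orP; left; apply/eqP.
  by congr (_ + _); apply: eq_bigr => i _; rewrite !iterSr.
have S0 : 0 <= S.
  by rewrite addr_ge0 ?sumr_ge0// => i _; rewrite ?addr_ge0 ?normc_ge0.
rewrite big_ord_recl -addrA -/S [X in _ <= _ * X]/=.
have h1 : normc (b Y * f Y - b N * f N) <= B * (normc (f N) + normc (f Y)).
  rewrite (le_trans (normcB_le _ _))// !Normc.normcM addrC mulrDr.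
  by rewrite lerD// ler_wpM2r ?normc_ge0.
have h2 : 0 <= normc (f N) + normc (f Y) by rewrite addr_ge0 ?normc_ge0.
rewrite mulrDl mulrDr lerD//; last first.
  by rewrite (le_trans hS)// ler_wpM2l// lerDr.
by rewrite (le_trans h1)// lerDl mulr_ge0.
Qed.

Lemma iter_ndiff_rpow k (s : R[i]) n :
  iter k ndiff (fun n => cpown n.+1 (- s)) n = iter k fdiff (rpow s) n.+1%:R.
Proof.
elim: k n => [|k ih] n //=; by rewrite /ndiff /fdiff !ih natr1.
Qed.

(* With [q = A / (N + 1)], the remainder of the Dirichlet series after [N] terms is
   small as soon as [A q ^ k] is: the height may be as large as a power of [N] with
   exponent arbitrarily close to 1. *)
Lemma dirichlet_tail_le Q k c : periodic0 Q c ->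
  exists2 C, 0 <= C & forall (s : R[i]) A N Y, 2^-1 <= complex.Re s ->
    normc s + 1 <= A -> (N <= Y)%N ->
    normc (\sum_(N <= n < Y) c n * cpown n.+1 (- s)) <=
    C * N.+1%:R `^ (- 2^-1) *
      (\sum_(j < k.+1) (A / N.+1%:R) ^+ j + A * (A / N.+1%:R) ^+ k).
Proof.
move=> pc; have [C C0 H] := normc_sum_periodic0_le k.+1 pc.
(* Each factor 2 |s + i| with i <= k is at most 2 (k + 1) A; taking the largest power of 2 (k + 1)
   gives one constant for all orders j <= k + 1. *)
pose D : R := (2 * k.+1%:R) ^+ k.+1.
have D0 : 0 <= D by rewrite exprn_ge0// mulr_ge0.
exists (C * (D * 3)) => [|s A N Y s2 sA NY]; first by rewrite mulr_ge0// mulr_ge0.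
have A0 : 0 <= A by rewrite (le_trans _ sA)// addr_ge0 ?normc_ge0.
have s0 : 0 <= complex.Re s by rewrite (le_trans _ s2).
have prodle j : (j <= k.+1)%N -> \prod_(i < j) (2 * normc (s + i%:R)) <= D * A ^+ j.
  move=> jk; rewrite (@le_trans _ _ (\prod_(i < j) (2 * k.+1%:R * A)))//.
    apply: ler_prod => i _; rewrite mulr_ge0 ?normc_ge0//= -mulrA ler_wpM2l//.
    rewrite (le_trans (normcD_le _ _))// normc_nat.
    rewrite -nat1r mulrDl mul1r (le_trans _ (lerD sA (lexx _)))//.
    rewrite -addrA lerD2l (le_trans _ (_ : 1 + k%:R * 1 <= _))//.
      rewrite mulr1 nat1r ler_nat; have := ltn_ord i; lia.
    rewrite lerD2l ler_wpM2l// (le_trans _ sA)// lerDr normc_ge0//.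
  rewrite prodr_const card_ord exprMn ler_wpM2r ?exprn_ge0// /D.
  by rewrite ler_weXn2l// -natrM ler1n.
have fle j n : (j <= k.+1)%N ->
    normc (iter j ndiff (fun n => cpown n.+1 (- s)) n) <=
    D * A ^+ j * n.+1%:R `^ (- (2^-1 + j%:R)).
  move=> jk; rewrite iter_ndiff_rpow (le_trans (normc_iter_fdiff_rpow _ _ _))//.
  rewrite ler_pM ?powR_ge0 ?prodle//.
    by rewrite prodr_ge0// => i _; rewrite mulr_ge0 ?normc_ge0.
  by rewrite ler_powR ?ler1n// lerN2 lerD2r.
have k1 : (k.+1%:R : R) = k%:R + 1 by rewrite natr1.
have X0 : (0 : R) < N.+1%:R by rewrite ltr0n.
have Xp j : N.+1%:R `^ (- (2^-1 + j%:R)) = N.+1%:R `^ (- 2^-1) / N.+1%:R ^+ j :> R.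
  rewrite opprD powRD ?(gt_eqF X0) ?implybT//; congr (_ * _).
  by rewrite powRN powR_mulrn// ltW.
have fNY j : (j <= k.+1)%N ->
   normc (iter j ndiff (fun n => cpown n.+1 (- s)) N) +
   normc (iter j ndiff (fun n => cpown n.+1 (- s)) Y) <=
   D * (2 * (N.+1%:R `^ (- 2^-1) * (A / N.+1%:R) ^+ j)).
  move=> jk; have -> : D * (2 * (N.+1%:R `^ (- 2^-1) * (A / N.+1%:R) ^+ j)) =
     D * A ^+ j * N.+1%:R `^ (- (2^-1 + j%:R)) + D * A ^+ j * N.+1%:R `^ (- (2^-1 + j%:R)).
    by rewrite Xp expr_div_n; ring.
  rewrite lerD ?fle// (le_trans (fle _ _ jk))// ler_wpM2l//.
    by rewrite mulr_ge0 ?exprn_ge0.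
  by rewrite powRN_le ?ler_nat ?addr_ge0.
(* The exponent here is p = k + 3/2, so p - 1 >= 1/2 and the constant of [pseries_le] is at most 3.
   Summation loses one power of N, which leaves the isolated factor A. *)
have tail : \sum_(N <= n < Y) normc (iter k.+1 ndiff (fun n => cpown n.+1 (- s)) n) <=
   D * (3 * (N.+1%:R `^ (- 2^-1) * (A * (A / N.+1%:R) ^+ k))).
  rewrite (@le_trans _ _ (D * A ^+ k.+1 * \sum_(N <= n < Y) n.+1%:R `^ (- (2^-1 + k.+1%:R))))//.
    by rewrite mulr_sumr; apply: ler_sum => n _; exact: fle.
  rewrite (@le_trans _ _ (D * A ^+ k.+1 * (3 * N.+1%:R `^ (- (2^-1 + k%:R)))))//.
    rewrite ler_wpM2l ?mulr_ge0 ?exprn_ge0//.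
    rewrite (le_trans (pseries_le _ _ _))//.
      by rewrite k1; have : (0 : R) <= k%:R by []; lra.
    have -> : (1 - (2^-1 + k.+1%:R) : R) = - (2^-1 + k%:R) by rewrite k1; ring.
    rewrite ler_wpM2r ?powR_ge0// k1.
    have -> : (3 : R) = 1 + 2^-1^-1 by rewrite invrK.
    rewrite lerD2l lef_pV2 ?posrE//; have : (0 : R) <= k%:R by []; lra.
  by rewrite Xp expr_div_n exprS; apply/eqW; ring.
rewrite (le_trans (H _ _ _ NY))// -!mulrA ler_wpM2l//.
rewrite [N.+1%:R `^ _ * (_ + _)]mulrDr [3 * _]mulrDr [D * _]mulrDr lerD//.
rewrite !mulr_sumr; apply: ler_sum => j _; rewrite (le_trans (fNY _ _))//.
  by rewrite ltnW.
rewrite ler_wpM2l// ler_wpM2r// ?ler_nat// mulr_ge0 ?powR_ge0//.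
by rewrite exprn_ge0// divr_ge0.
Qed.

End Abel.

(** * Convergence of complex sequences *)

Section ComplexSequences.
Context {R : realType}.
Implicit Types (u v : nat -> R[i]) (l a : R[i]).

(** The norm of [CC R] takes complex values, hence complex tolerances; here the tolerance is real.
    [ccvgP] translates. *)
Definition ccvg u l := forall e : R, 0 < e ->
  exists N, forall n, (N <= n)%N -> normc (u n - l) <= e.

Lemma ccvgP u l : (u : nat -> CC R) @ \oo --> (l : CC R) <-> ccvg u l.
Proof.
have normE (z : CC R) : `|z| = (normc z)%:C by rewrite normc_def; case: z.
split.
  move=> /cvgrPdist_le h e e0.
  have /h[N _ HN] : (0 : R[i]) < e%:C by rewrite ltcR.
  by exists N => n /HN /=; rewrite normE lecR normc_sub.
move=> h; apply/cvgrPdist_le => e.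
rewrite ltcE => /andP[/eqP e0 e1].
have [N HN] := h _ e1; exists N => // n /= /HN.
by rewrite normc_sub normE -lecR; case: e e0 {e1 HN} => e1 e2 /= ->.
Qed.

Lemma ccvg_cst l : ccvg (fun=> l) l.
Proof. by move=> e e0; exists 0%N => n _; rewrite subrr Normc.normc0 ltW. Qed.

Lemma ccvgD u v l a : ccvg u l -> ccvg v a -> ccvg (fun n => u n + v n) (l + a).
Proof.
move=> ul va e e0; have e20 : 0 < e / 2 by rewrite divr_gt0.
have [N HN] := ul _ e20; have [M HM] := va _ e20.
exists (maxn N M) => n; rewrite geq_max => /andP[/HN h1 /HM h2].
by rewrite opprD addrACA (le_trans (normcD_le _ _))// [e]splitr lerD.
Qed.

Lemma ccvgMl a u l : ccvg u l -> ccvg (fun n => a * u n) (a * l).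
Proof.
move=> ul e e0; have c0 : 0 < normc a + 1 by rewrite ltr_wpDl ?normc_ge0.
have [|N HN] := ul (e / (normc a + 1)); first by rewrite divr_gt0.
exists N => n /HN h; rewrite -mulrBr Normc.normcM.
rewrite (@le_trans _ _ ((normc a + 1) * normc (u n - l)))//.
  by rewrite ler_wpM2r ?normc_ge0// lerDl.
by rewrite mulrC -ler_pdivlMr.
Qed.

Lemma ccvgN u l : ccvg u l -> ccvg (fun n => - u n) (- l).
Proof.
by move=> ul e /ul[N HN]; exists N => n /HN; rewrite -opprD normc_opp.
Qed.

Lemma ccvgB u v l a : ccvg u l -> ccvg v a -> ccvg (fun n => u n - v n) (l - a).
Proof. by move=> ul va; apply: ccvgD => //; exact: ccvgN. Qed.

Lemma ccvg_sum K (u : nat -> nat -> R[i]) (l : nat -> R[i]) :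
  (forall k, (k < K)%N -> ccvg (u k) (l k)) ->
  ccvg (fun n => \sum_(k < K) u k n) (\sum_(k < K) l k).
Proof.
elim: K => [|K ih] h.
  by rewrite big_ord0; under eq_fun do rewrite big_ord0; exact: ccvg_cst.
rewrite big_ord_recr /=; under eq_fun do rewrite big_ord_recr /=.
by apply: ccvgD; [apply: ih => k kK; apply: h; exact: ltnW|exact: h].
Qed.

Lemma ccvg_eq u v l : (exists N, forall n, (N <= n)%N -> u n = v n) ->
  ccvg u l -> ccvg v l.
Proof.
move=> [M HM] ul e /ul[N HN]; exists (maxn N M) => n.
by rewrite geq_max => /andP[/HN h /HM <-].
Qed.

Lemma ccvg_comp u l (p : nat -> nat) : (forall n, (n <= p n)%N) ->
  ccvg u l -> ccvg (u \o p) l.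
Proof.
by move=> np ul e /ul[N HN]; exists N => n Nn; apply: HN; exact: leq_trans (np n).
Qed.

Lemma ccvg_normc_le u l (B : R) :
  (exists N, forall n, (N <= n)%N -> normc (u n) <= B) -> ccvg u l -> normc l <= B.
Proof.
move=> [M HM] ul; apply/ler_addgt0Pl => e e0; have [N HN] := ul _ e0.
have := HN _ (leq_maxl N M); have := HM _ (leq_maxr N M).
set n := maxn N M => h1 h2.
have := normc_le_add l (u n); rewrite normc_sub => /le_trans; apply.
exact: lerD.
Qed.

Lemma ccvg_normc u l : ccvg u l -> ccvg (fun n => (normc (u n))%:C) (normc l)%:C.
Proof.
move=> ul e /ul[N HN]; exists N => n /HN h.
rewrite -rmorphB normc_real (le_trans _ h)// ler_norml.
have := normc_le_add (u n) l; have := normc_le_add l (u n).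
by rewrite (normc_sub l); lra.
Qed.

Lemma ccvg_unique u l a : ccvg u l -> ccvg u a -> l = a.
Proof.
move=> ul ua; apply/eqP; rewrite -subr_eq0 -normc_eq0 eq_le normc_ge0 andbT.
apply/ler_addgt0Pl => e e0; rewrite addr0.
apply: (@ccvg_normc_le (fun n => u n - u n)); last exact: ccvgB.
by exists 0%N => n _; rewrite subrr Normc.normc0 ltW.
Qed.

Lemma real_cauchy_cvg (x : nat -> R) : (forall e, 0 < e ->
    exists N, forall n, (N <= n)%N -> `|x n - x N| <= e) ->
  exists y, forall e, 0 < e -> exists N, forall n, (N <= n)%N -> `|x n - y| <= e.
Proof.
move=> h; have cx : cvgn x.
  apply/cauchy_cvgP/cauchy_ballP => e e0.
  have [|N HN] := h (e / 3); first by rewrite divr_gt0.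
  exists ([set y | `|y - x N| <= e / 3], [set y | `|y - x N| <= e / 3]).
    by split; exists N.
  move=> [y z] [/= h1 h2]; rewrite /ball /=.
  rewrite -(subrKA (x N)) (le_lt_trans (ler_normD _ _))// [`|x N - _|]distrC.
  by rewrite (le_lt_trans (lerD h1 h2))//; lra.
exists (limn x) => e e0.
have /cvgrPdist_le/(_ e e0)[N _ HN] := cx.
by exists N => n /HN; rewrite distrC.
Qed.

Lemma ccvg_cauchy u : (forall e : R, 0 < e ->
    exists N, forall n, (N <= n)%N -> normc (u n - u N) <= e) ->
  exists l, ccvg u l.
Proof.
move=> h.
have [|x hx] := @real_cauchy_cvg (fun n => complex.Re (u n)).
  move=> e /h[N HN]; exists N => n /HN; apply: le_trans.
  by rewrite -raddfB normc_Re_le.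
have [|y hy] := @real_cauchy_cvg (fun n => complex.Im (u n)).
  move=> e /h[N HN]; exists N => n /HN; apply: le_trans.
  by rewrite -raddfB normc_Im_le.
exists (x +i* y) => e e0; have e20 : 0 < e / 2 by rewrite divr_gt0.
have [N HN] := hx _ e20; have [M HM] := hy _ e20.
exists (maxn N M) => n; rewrite geq_max => /andP[/HN h1 /HM h2].
rewrite (le_trans (normc_le_ReIm _))// [e]splitr lerD//.
  by move: h1; case: (u n).
by move: h2; case: (u n).
Qed.

Lemma bounded_series_tail (b : nat -> R) (T : R) :
  (forall n, 0 <= b n) -> (forall N, \sum_(n < N) b n <= T) ->
  forall e, 0 < e -> exists N, forall M, (N <= M)%N -> \sum_(N <= n < M) b n <= e.
Proof.
move=> b0 bT e e0; pose A := range (fun N => \sum_(n < N) b n).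
have supA : has_sup A.
  by split; [exists (\sum_(n < 0) b n), 0%N|exists T => _ [N _ <-]].
have [_ [N _ <-] hN] := sup_adherent e0 supA.
exists N => M NM; have : \sum_(n < M) b n <= sup A by apply: sup_upper_bound => //; exists M.
rewrite -!(big_mkord xpredT b) (big_cat_nat _ NM)//= in hN *.
lra.
Qed.

Lemma ccvg_series_bounded u (b : nat -> R) (T : R) :
  (forall n, normc (u n) <= b n) -> (forall N, \sum_(n < N) b n <= T) ->
  exists l, ccvg (fun N => \sum_(n < N) u n) l.
Proof.
move=> ub bT; apply: ccvg_cauchy => e e0.
have b0 n : 0 <= b n by rewrite (le_trans _ (ub n))// normc_ge0.
have [N HN] := bounded_series_tail b0 bT e0; exists N => n Nn.
rewrite -!(big_mkord xpredT u) (big_cat_nat _ Nn)//= addrAC subrr add0r.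
rewrite (le_trans (normc_sum _ _ _))// (le_trans _ (HN _ Nn))//.
exact: ler_sum.
Qed.

End ComplexSequences.

(** * Power series and the identity theorem *)

Section PowerSeries.
Context {R : realType}.
Implicit Types (f g : R[i] -> R[i]) (a c : nat -> R[i]) (s w z : R[i]) (r B : R).

Lemma sum_half_le K : \sum_(k < K) 2^-1 ^+ k <= 2 :> R.
Proof.
have -> : \sum_(k < K) 2^-1 ^+ k = 2 - 2 * 2^-1 ^+ K :> R.
  elim: K => [|K ih]; first by rewrite big_ord0 expr0 mulr1 subrr.
  by rewrite big_ord_recr /= ih exprS; field.
by rewrite gerBl mulr_ge0// exprn_ge0.
Qed.

Lemma sum_nat_shift (V : zmodType) (F : nat -> V) n K :
  \sum_(n <= k < n + K) F k = \sum_(k < K) F (k + n)%N.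
Proof. by rewrite -{1}[n]add0n big_addn addKn big_mkord. Qed.

Definition psum a w K : R[i] := \sum_(k < K) a k * w ^+ k.

(** The bound B of the absolute series on the closed disc is kept with the expansion: it serves as a
    majorant when infinitely many expansions are added. *)
Record has_pseries f s r a B : Prop := HasPseries {
  pseries_radius_gt0 : 0 < r ;
  pseries_abs_le : forall K, \sum_(k < K) normc (a k) * r ^+ k <= B ;
  pseries_cvg : forall w, normc w <= r -> ccvg (psum a w) (f (s + w)) }.

Definition pow_near f s := exists r a B, has_pseries f s r a B.

Lemma has_pseries_shrink f s r r' a B : 0 < r' -> r' <= r ->
  has_pseries f s r a B -> has_pseries f s r' a B.
Proof.
move=> r'0 r'r [r0 aB fa]; split => // [K|w wr].
  rewrite (le_trans _ (aB K))//; apply: ler_sum => k _.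
  by rewrite ler_wpM2l ?normc_ge0// lerXn2r ?nnegrE ?(ltW r0) ?(ltW r'0).
by apply: fa; exact: le_trans r'r.
Qed.

(** Convergence at a point of modulus x bounds the terms by some M, since late terms are differences
    of partial sums that lie within 1 of the limit. At radius x/2 they are then dominated by M
    2^(-k), which sums to 2 M. *)
Lemma analytic_at_pow_near f s : analytic_at (f : CC R -> CC R) s -> pow_near f s.
Proof.
move=> [a /nbhs_normP[e /=]]; rewrite ltcE => /andP[/eqP e0 e1] h.
set d := complex.Re e in e1.
have cv w : normc w < d -> ccvg (psum a w) (f (s + w)).
  move=> wd; have /h/ccvgP H : ball_ Num.norm (s : CC R) e (s + w).
    rewrite /ball_ /= opprD addrA subrr sub0r normrN normc_def.
    have -> : e = d%:C by rewrite /d; case: e e0 {h d e1 wd} => e1 e2 /= ->.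
    by rewrite ltcR; case: w wd.
  apply: (ccvg_eq _ H); exists 0%N => n _ /=.
  by rewrite seriesEord /psum; apply: eq_bigr => k _; rewrite addrC addKr.
pose x : R := d / 2; have x0 : 0 < x by rewrite divr_gt0.
have [M HM] : exists M, forall k, normc (a k) * x ^+ k <= M.
  have xd : normc x%:C < d.
    by rewrite normc_real ger0_norm ?ltW// /x ltr_pdivrMr// ltr_pMr// ltr1n.
  have [N HN] := cv _ xd 1 ltr01.
  exists (2 + \sum_(k < N) normc (a k) * x ^+ k) => k.
  have sum0 (P : pred 'I_N) : 0 <= \sum_(k < N | P k) normc (a k) * x ^+ k.
    by rewrite sumr_ge0// => i _; rewrite mulr_ge0 ?normc_ge0// exprn_ge0// ltW.
  have [kN|Nk] := ltnP k N.
    rewrite (bigD1 (Ordinal kN))//= addrCA lerDl addr_ge0//.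
  rewrite (@le_trans _ _ 2)//; last by rewrite lerDl sum0.
  have -> : normc (a k) * x ^+ k = normc (psum a x%:C k.+1 - psum a x%:C k).
    rewrite /psum big_ord_recr /= addrAC subrr add0r Normc.normcM normcX normc_real.
    by rewrite ger0_norm// ltW.
  rewrite (le_trans (normc_sub_trans (f (s + x%:C)) _ _))//.
  rewrite [X in _ + X]normc_sub [leRHS](_ : _ = 1 + 1)// lerD// HN//.
  exact: leq_trans (leqnSn k).
have M0 : 0 <= M.
  by rewrite (le_trans _ (HM 0%N))// mulr_ge0 ?normc_ge0// exprn_ge0// ltW.
exists (x / 2), a, (2 * M); split; first by rewrite divr_gt0.
- move=> K; rewrite (@le_trans _ _ (\sum_(k < K) M * 2^-1 ^+ k))//.
    apply: ler_sum => k _; rewrite exprMn mulrA ler_wpM2r// exprn_ge0//.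
  rewrite -mulr_sumr mulrC ler_wpM2r//.
  exact: sum_half_le.
- move=> w wx; apply: cv; rewrite (le_lt_trans wx)// /x; lra.
Qed.

Lemma has_pseriesB f g s r a c B B' : has_pseries f s r a B ->
  has_pseries g s r c B' ->
  has_pseries (fun z => f z - g z) s r (fun k => a k - c k) (B + B').
Proof.
move=> [r0 aB fa] [_ cB gc]; split => // [K|w wr].
  rewrite (le_trans _ (lerD (aB K) (cB K)))// -big_split /=.
  apply: ler_sum => k _; rewrite -mulrDl ler_wpM2r ?exprn_ge0 ?(ltW r0)//.
  exact: normcB_le.
have H := ccvgB (fa _ wr) (gc _ wr); apply: (ccvg_eq _ H); exists 0%N => n _.
by rewrite /psum -sumrB; apply: eq_bigr => k _; rewrite mulrBl.
Qed.

Lemma has_pseriesZ f s r a B b : has_pseries f s r a B ->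
  has_pseries (fun z => b * f z) s r (fun k => b * a k) (normc b * B).
Proof.
move=> [r0 aB fa]; split => // [K|w wr].
  rewrite (eq_bigr (fun k : 'I_K => normc b * (normc (a k) * r ^+ k))).
    by rewrite -mulr_sumr ler_wpM2l ?normc_ge0 ?aB.
  by move=> k _; rewrite Normc.normcM mulrA.
have H := ccvgMl b (fa _ wr); apply: (ccvg_eq _ H); exists 0%N => n _.
by rewrite /psum mulr_sumr; apply: eq_bigr => k _; rewrite mulrA.
Qed.

Lemma pow_nearB f g s : pow_near f s -> pow_near g s ->
  pow_near (fun z => f z - g z) s.
Proof.
move=> [r [a [B fa]]] [r' [c [B' gc]]].
have r0 := pseries_radius_gt0 fa; have r'0 := pseries_radius_gt0 gc.
have m0 : 0 < Num.min r r' by rewrite lt_min r0.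
exists (Num.min r r'), (fun k => a k - c k), (B + B').
apply: has_pseriesB; [apply: has_pseries_shrink fa|apply: has_pseries_shrink gc] => //.
  by rewrite ge_min lexx.
by rewrite ge_min lexx orbT.
Qed.

Lemma has_pseries_limit_le f s r a B w :
  has_pseries f s r a B -> normc w <= r -> normc (f (s + w)) <= B.
Proof.
move=> [r0 aB fa] wr; apply: ccvg_normc_le (fa _ wr); exists 0%N => n _.
rewrite (le_trans (normc_sum _ _ _))// (le_trans _ (aB n))//.
apply: ler_sum => k _; rewrite Normc.normcM normcX ler_wpM2l ?normc_ge0//.
by rewrite lerXn2r ?nnegrE ?normc_ge0 ?(ltW r0).
Qed.

(** A Weierstrass theorem: summable majorants [b n] of the absolute expansions permit summing the
    coefficients over n, since |a n k| <= b n / r^k, and interchanging the two summations. *)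
Lemma has_pseries_series f (fn : nat -> R[i] -> R[i]) (a : nat -> nat -> R[i])
    (b : nat -> R) s r T : 0 < r ->
  (forall n, has_pseries (fn n) s r (a n) (b n)) ->
  (forall N, \sum_(n < N) b n <= T) ->
  (forall w, normc w <= r -> ccvg (fun N => \sum_(n < N) fn n (s + w)) (f (s + w))) ->
  exists A, has_pseries f s r A T.
Proof.
move=> r0 ha bT ff.
have b0 n : 0 <= b n by have := pseries_abs_le (ha n) 0; rewrite big_ord0.
have akle n k : normc (a n k) * r ^+ k <= b n.
  rewrite (le_trans _ (pseries_abs_le (ha n) k.+1))// big_ord_recr /= lerDr.
  by rewrite sumr_ge0// => i _; rewrite mulr_ge0 ?normc_ge0// exprn_ge0// ltW.
have rk0 k : 0 < r ^+ k by rewrite exprn_gt0.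
have ex k : exists A, ccvg (fun N => \sum_(n < N) a n k) A.
  apply: (@ccvg_series_bounded _ (fun n => a n k) (fun n => b n / r ^+ k) (T / r ^+ k)) => [n|N].
    by rewrite ler_pdivlMr.
  by rewrite -mulr_suml ler_pM2r ?invr_gt0 ?bT.
have [A hA] := choice ex.
have partial N M K w : (N <= M)%N -> normc w <= r ->
    normc (\sum_(k < K) (\sum_(n < M) a n k - \sum_(n < N) a n k) * w ^+ k) <=
    \sum_(N <= n < M) b n.
  move=> NM wr; rewrite (le_trans (normc_sum _ _ _))//.
  rewrite (@le_trans _ _ (\sum_(k < K) \sum_(N <= n < M) normc (a n k) * r ^+ k))//.
    apply: ler_sum => k _; rewrite Normc.normcM normcX -mulr_suml.
    apply: ler_pM; rewrite ?normc_ge0 ?exprn_ge0 ?normc_ge0//.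
      rewrite -!(big_mkord xpredT (fun n => a n k)) (big_cat_nat _ NM)//=.
      by rewrite addrAC subrr add0r normc_sum.
    by rewrite lerXn2r ?nnegrE ?normc_ge0 ?(ltW r0).
  rewrite exchange_big /=; apply: ler_sum => n _.
  exact: (pseries_abs_le (ha n) K).
(* The limit M to infinity in [partial]. The bound does not depend on K, which is what makes the
   interchange possible. *)
have tail N K w e : (forall M, (N <= M)%N -> \sum_(N <= n < M) b n <= e) ->
    normc w <= r -> normc (\sum_(k < K) (A k - \sum_(n < N) a n k) * w ^+ k) <= e.
  move=> be wr; apply: (@ccvg_normc_le _ (fun M => \sum_(k < K)
    (\sum_(n < M) a n k - \sum_(n < N) a n k) * w ^+ k)).
    by exists N => M NM; rewrite (le_trans (partial _ _ _ _ NM wr))// be.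
  apply: (@ccvg_sum _ K (fun k M => (\sum_(n < M) a n k - \sum_(n < N) a n k) * w ^+ k)
    (fun k => (A k - \sum_(n < N) a n k) * w ^+ k)) => k _.
  rewrite mulrC; under eq_fun do rewrite mulrC.
  by apply: ccvgMl; apply: ccvgB; [exact: hA|exact: ccvg_cst].
exists A; split => // [K|w wr].
  have normcS0 (x : nat -> R[i]) : 0 <= \sum_(k < K) normc (x k) * r ^+ k.
    by rewrite sumr_ge0// => k _; rewrite mulr_ge0 ?normc_ge0 ?ltW.
  rewrite -[leLHS]ger0_norm// -normc_real rmorph_sum /=.
  apply: (@ccvg_normc_le _ (fun N => \sum_(k < K) (normc (\sum_(n < N) a n k) * r ^+ k)%:C)).
    exists 0%N => N _; rewrite -rmorph_sum normc_real ger0_norm ?(normcS0 (fun k => \sum_(n < N) a n k))//.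
    rewrite (le_trans _ (bT N))//.
    rewrite (@le_trans _ _ (\sum_(k < K) \sum_(n < N) normc (a n k) * r ^+ k))//.
      by apply: ler_sum => k _; rewrite -mulr_suml ler_wpM2r ?normc_sum// ltW.
    rewrite exchange_big /=; apply: ler_sum => n _; exact: (pseries_abs_le (ha n) K).
  apply: (@ccvg_sum _ K (fun k N => (normc (\sum_(n < N) a n k) * r ^+ k)%:C)
    (fun k => (normc (A k) * r ^+ k)%:C)) => k _.
  rewrite mulrC rmorphM; under eq_fun do rewrite mulrC rmorphM.
  by apply: ccvgMl; apply: ccvg_normc; exact: hA.
(* One third for the coefficients beyond N, one for the N remaining expansions truncated at K, one
   for the functions beyond N. *)
move=> e e0; have e30 : 0 < e / 3 by rewrite divr_gt0.
have [N HN] := bounded_series_tail b0 bT e30.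
have fN : ccvg (fun K => \sum_(n < N) psum (a n) w K) (\sum_(n < N) fn n (s + w)).
  apply: (@ccvg_sum _ N (fun n K => psum (a n) w K) (fun n => fn n (s + w))) => n _.
  exact: pseries_cvg (ha n) _ wr.
have ftail : normc (\sum_(n < N) fn n (s + w) - f (s + w)) <= e / 3.
  apply: (@ccvg_normc_le _ (fun M => \sum_(n < N) fn n (s + w) - \sum_(n < M) fn n (s + w))).
    exists N => M NM; rewrite (le_trans _ (HN _ NM))// normc_sub.
    rewrite -!(big_mkord xpredT (fun n => fn n (s + w))) (big_cat_nat _ NM)//=.
    rewrite addrAC subrr add0r (le_trans (normc_sum _ _ _))//.
    by apply: ler_sum => n _; exact: has_pseries_limit_le (ha n) wr.
  by apply: ccvgB; [exact: ccvg_cst|exact: ff].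
have [K0 HK0] := fN _ e30; exists K0 => K /HK0 h.
rewrite (le_trans (normc_sub_trans (\sum_(n < N) psum (a n) w K) _ _))//.
rewrite (_ : e = e / 3 + (e / 3 + e / 3)); last by field.
apply: lerD.
  rewrite (_ : _ - _ = \sum_(k < K) (A k - \sum_(n < N) a n k) * w ^+ k) ?tail//.
  rewrite /psum exchange_big -sumrB /=; apply: eq_bigr => k _.
  by rewrite -mulr_suml mulrBl.
rewrite (le_trans (normc_sub_trans (\sum_(n < N) fn n (s + w)) _ _))//.
exact: lerD.
Qed.

(** The product is the sum over n of a n (z - s)^n g z. Each term is a shifted and scaled copy of
    the expansion of g, with majorant |a n| r^n B', so [has_pseries_series] applies. *)
Lemma pow_nearM f g s : pow_near f s -> pow_near g s ->
  pow_near (fun z => f z * g z) s.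
Proof.
move=> [r1 [a [B fa]]] [r2 [c [B' gc]]].
have r10 := pseries_radius_gt0 fa; have r20 := pseries_radius_gt0 gc.
set r := Num.min r1 r2.
have r0 : 0 < r by rewrite lt_min r10.
have {}fa : has_pseries f s r a B.
  by apply: has_pseries_shrink fa => //; rewrite ge_min lexx.
have {}gc : has_pseries g s r c B'.
  by apply: has_pseries_shrink gc => //; rewrite ge_min lexx orbT.
have B'0 : 0 <= B' by have := pseries_abs_le gc 0; rewrite big_ord0.
pose fn n z := a n * (z - s) ^+ n * g z.
pose an n k := if (n <= k)%N then a n * c (k - n)%N else 0.
exists r; suff [A hA] : exists A, has_pseries (fun z => f z * g z) s r A (B * B').
  by exists A, (B * B').
apply: (@has_pseries_series _ fn an (fun n => normc (a n) * r ^+ n * B')) => // [n|N|w wr].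
- have anE w K : (n <= K)%N ->
    \sum_(k < K) an n k * w ^+ k = a n * w ^+ n * psum c w (K - n).
    move=> nK; rewrite -(big_mkord xpredT (fun k => an n k * w ^+ k)) (big_cat_nat (leq0n n) nK)/=.
    rewrite big_nat big1 ?add0r; last first.
      by move=> k /andP[_ kn]; rewrite /an leqNgt kn mul0r.
    rewrite -{1}(subnKC nK) sum_nat_shift mulr_sumr; apply: eq_bigr => k _.
    by rewrite /an leq_addl addnK exprD; ring.
  split => // [K|w wr].
    rewrite (@le_trans _ _ (\sum_(k < n + K) normc (an n k) * r ^+ k))//.
      rewrite -!(big_mkord xpredT (fun k => normc (an n k) * r ^+ k)).
      rewrite [leRHS](big_cat_nat (leq0n K) (leq_addl n K))/= lerDl sumr_ge0// => k _.
      by rewrite mulr_ge0 ?normc_ge0// exprn_ge0// ltW.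
    rewrite -!(big_mkord xpredT (fun k => normc (an n k) * r ^+ k)).
    rewrite (big_cat_nat (leq0n n) (leq_addr K n))/=.
    rewrite big_nat big1 ?add0r; last first.
      by move=> k /andP[_ kn]; rewrite /an leqNgt kn Normc.normc0 mul0r.
    rewrite sum_nat_shift.
    rewrite (eq_bigr (fun k : 'I_K => normc (a n) * r ^+ n * (normc (c k) * r ^+ k))).
      rewrite -mulr_sumr ler_wpM2l ?(pseries_abs_le gc)//.
      by rewrite mulr_ge0 ?normc_ge0// exprn_ge0// ltW.
    by move=> k _; rewrite /an leq_addl addnK Normc.normcM exprD; ring.
  rewrite /fn [s + w]addrC addrK [w + s]addrC.
  have H := ccvgMl (a n * w ^+ n) (pseries_cvg gc wr).
  move=> e /H[K0 HK0]; exists (K0 + n)%N => K hK.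
  rewrite /psum anE ?HK0//; lia.
- by rewrite -mulr_suml ler_wpM2r ?(pseries_abs_le fa).
- have H := ccvgMl (g (s + w)) (pseries_cvg fa wr); rewrite mulrC.
  apply: (ccvg_eq _ H); exists 0%N => K _; rewrite /psum mulr_sumr.
  by apply: eq_bigr => k _; rewrite /fn [s + w - s]addrC addKr mulrC.
Qed.

(** If the coefficients before a m vanish, then at distance x on the segment |a m| x^m <= B (x /
    r)^(m + 1); dividing by x^m and letting x tend to 0 gives a m = 0. *)
Lemma has_pseries_eq0 f s r a B u rho : has_pseries f s r a B ->
  normc u = 1 -> 0 < rho -> (forall x : R, 0 < x -> x <= rho -> f (s + x%:C * u) = 0) ->
  forall w, normc w <= r -> f (s + w) = 0.
Proof.
move=> [r0 aB fa] u1 rho0 f0.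
have B0 : 0 <= B by have := aB 0; rewrite big_ord0.
suff a0 k : a k = 0.
  move=> w wr; apply: (ccvg_unique (fa _ wr)).
  have H := ccvg_cst (0 : R[i]); apply: (ccvg_eq _ H); exists 0%N => n _.
  by rewrite /psum big1// => k _; rewrite a0 mul0r.
elim/ltn_ind: k => m ih.
have key x : 0 < x -> x <= Num.min r rho -> normc (a m) <= x * (B / r ^+ m.+1).
  rewrite le_min => x0 /andP[xr xrho].
  have wr : normc (x%:C * u) <= r by rewrite Normc.normcM u1 mulr1 normc_real gtr0_norm.
  have xm0 : 0 < x ^+ m by rewrite exprn_gt0.
  rewrite -(ler_pM2r xm0).
  have -> : normc (a m) * x ^+ m = normc (a m * (x%:C * u) ^+ m).
    by rewrite Normc.normcM normcX Normc.normcM u1 mulr1 normc_real gtr0_norm.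
  have -> : x * (B / r ^+ m.+1) * x ^+ m = B * (x / r) ^+ m.+1.
    by rewrite expr_div_n [x ^+ m.+1]exprS; ring.
  have H := fa _ wr; rewrite (f0 _ x0 xrho) in H.
  have := ccvgB (ccvg_cst (a m * (x%:C * u) ^+ m)) H; rewrite subr0.
  apply: ccvg_normc_le; exists m.+1 => K mK.
  rewrite /psum -(big_mkord xpredT (fun k => a k * (x%:C * u) ^+ k)).
  rewrite (big_cat_nat (leq0n m.+1) mK) /= big_nat_recr //= big_nat big1; last first.
    by move=> k /andP[_ /ih ->]; rewrite mul0r.
  rewrite add0r opprD addrA subrr sub0r normc_opp (le_trans (normc_sum _ _ _))//.
  rewrite (@le_trans _ _ (\sum_(m.+1 <= k < K) normc (a k) * r ^+ k * (x / r) ^+ m.+1))//.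
    rewrite big_nat [leRHS]big_nat; apply: ler_sum => k /andP[mk _].
    rewrite Normc.normcM normcX Normc.normcM u1 mulr1 normc_real gtr0_norm// -mulrA.
    rewrite ler_wpM2l ?normc_ge0//.
    have -> : x ^+ k = r ^+ k * (x / r) ^+ k.
      by rewrite -exprMn mulrC divfK// gt_eqF.
    rewrite ler_wpM2l ?exprn_ge0 ?(ltW r0)// ler_wiXn2l//; first by rewrite divr_ge0 ?(ltW x0) ?(ltW r0).
    by rewrite ler_pdivrMr// mul1r.
  rewrite -mulr_suml ler_wpM2r ?exprn_ge0 ?divr_ge0 ?(ltW r0) ?(ltW x0)//.
  rewrite (le_trans _ (aB K))// -(big_mkord xpredT (fun k => normc (a k) * r ^+ k)).
  rewrite [leRHS](big_cat_nat (leq0n m.+1) mK) /= lerDr sumr_ge0// => k _.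
  by rewrite mulr_ge0 ?normc_ge0// exprn_ge0// ltW.
apply/eqP; rewrite -normc_eq0 eq_le normc_ge0 andbT.
apply/ler_addgt0Pl => e e0; rewrite addr0.
have C0 : 0 < B / r ^+ m.+1 + 1.
  by rewrite ltr_wpDl// divr_ge0// exprn_ge0// ltW.
have x0 : 0 < Num.min (Num.min r rho) (e / (B / r ^+ m.+1 + 1)).
  by rewrite !lt_min r0 rho0 divr_gt0.
rewrite (le_trans (key _ x0 _))//; first by rewrite ge_min lexx.
rewrite (@le_trans _ _ (e / (B / r ^+ m.+1 + 1) * (B / r ^+ m.+1 + 1)))//.
  rewrite ler_pM ?(ltW x0) ?divr_ge0 ?exprn_ge0 ?(ltW r0)//.
    by rewrite ge_min lexx orbT.
  by rewrite lerDl.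
by rewrite divfK// gt_eqF.
Qed.

(** Off the real axis, the horizontal ray to the right avoids the point 1 and ends where f vanishes.
    At the supremum of its points where f does not vanish, f is zero to the right, hence in a disc,
    which contradicts the supremum. A real point is then reached along the vertical segment above
    it. *)
Lemma pow_near_identity f (c0 c1 : R) :
  (forall s, c0 < complex.Re s -> s != 1 -> pow_near f s) ->
  (forall s, c1 < complex.Re s -> f s = 0) ->
  forall s, c0 < complex.Re s -> s != 1 -> f s = 0.
Proof.
move=> fp f0; have horizontal s : c0 < complex.Re s -> complex.Im s != 0 -> f s = 0.
  case: s => x1 t /= c0x1 t0; apply/eqP/negP => /negP fn0.
  pose A := [set x | x1 <= x /\ f (x +i* t) != 0].
  have supA : has_sup A.
    split; first by exists x1; split.
    exists c1 => x [_ fx]; rewrite leNgt; apply/negP => c1x.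
    by move: fx; rewrite f0// eqxx.
  have x1A : x1 <= sup A by apply: sup_upper_bound => //; split.
  have [||r [a [B fa]]] := fp (sup A +i* t); first exact: lt_le_trans x1A.
    by rewrite eq_complex /= negb_and t0 orbT.
  have r0 := pseries_radius_gt0 fa.
  have [x [xx1 fx0] supx] := sup_adherent r0 supA.
  have xsup : x <= sup A by apply: sup_upper_bound.
  move: fx0; have -> : x +i* t = (sup A +i* t) + (x - sup A)%:C.
    by apply/eqP; rewrite eq_complex /= addr0 addrC subrK !eqxx.
  rewrite (has_pseries_eq0 fa (u := 1) (rho := 1)) ?eqxx//.
  - exact: Normc.normc1.
  - move=> y y0 _; rewrite mulr1; apply/eqP/negP => /negP fy.
    have : sup A + y <= sup A.
      apply: sup_upper_bound => //; split; first by rewrite (le_trans x1A)// lerDl ltW.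
      by move: fy; congr (f _ != 0); apply/eqP; rewrite eq_complex /= addr0 !eqxx.
    lra.
  - by rewrite normc_real distrC ger0_norm ?subr_ge0//; lra.
move=> s c0s s1; have [t0|] := eqVneq (complex.Im s) 0; last exact: horizontal.
have [r [a [B fa]]] := fp _ c0s s1.
have r0 := pseries_radius_gt0 fa.
rewrite -[s]addr0 (has_pseries_eq0 fa (u := 0 +i* 1) (rho := 1))//.
- by rewrite /normc expr0n expr1n add0r sqrtr1.
- move=> x x0 _; apply: horizontal; case: s t0 c0s {s1 fa} => s1 s2 /= t0 c0s; last rewrite t0.
    by rewrite mulr0 mul0r subr0 addr0.
  by rewrite mulr1 mulr0 !add0r addr0 gt_eqF.
- by rewrite Normc.normc0 ltW.
Qed.

End PowerSeries.

(** * Power series of exponentials *)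

Section ExpSeries.
Context {R : realType}.
Implicit Types (s w z l x y : R[i]).

Lemma powRN_small (p e : R) : 0 < p -> 0 < e ->
  exists2 T0, 0 < T0 & forall T, T0 <= T -> T `^ (- p) <= e.
Proof.
move=> p0 e0; exists (e `^ (- p^-1)) => [|T hT]; first exact: powR_gt0.
rewrite (le_trans (powRN_le (powR_gt0 _ e0) hT (ltW p0)))// -powRrM mulrNN.
by rewrite mulVf ?gt_eqF// powRr1 ?(ltW e0).
Qed.

Lemma exp_partial_le (t : R) K : 0 <= t -> \sum_(k < K) t ^+ k / k`!%:R <= expR t.
Proof.
move=> t0; have cv : cvgn (series (exp_coeff t)) by exact: is_cvg_series_exp_coeff.
have nd : nondecreasing_seq (series (exp_coeff t)).
  by apply: nondecreasing_series => n _ _; exact: exp_coeff_ge0.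
have := nondecreasing_cvgn_le nd cv K.
by rewrite -/(expR t) seriesEord.
Qed.

Lemma exp_term_small (t e : R) : 0 < e ->
  exists N, forall K, (N <= K)%N -> t ^+ K / K`!%:R <= e.
Proof.
move=> e0; have := cvg_series_cvg_0 (is_cvg_series_exp_coeff t).
move=> /cvgrPdist_le/(_ e e0)[N _ HN]; exists N => K /HN.
by rewrite sub0r normrN; apply: le_trans; exact: ler_norm.
Qed.

Lemma ccvg_cexp_sum z : ccvg (cexp_sum z) (cexp z).
Proof.
move=> e e0; have E0 := expR_gt0 (normc z).
have [|N HN] := @exp_term_small (2 * normc z) (e / expR (normc z)).
  by rewrite divr_gt0.
exists N => K /HN h; rewrite normc_sub (le_trans (cexp_taylor _ _))//.
by rewrite -ler_pdivlMr.
Qed.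

Lemma normc_fact k : normc (k`!%:R^-1 : R[i]) = k`!%:R^-1.
Proof. by rewrite Normc.normcV normc_nat. Qed.

Lemma psum_cexp l w : psum (fun k => l ^+ k / k`!%:R) w = cexp_sum (l * w).
Proof.
apply/funext => K; apply: eq_bigr => k _; rewrite exprMn; ring.
Qed.

Lemma has_pseries_cexp l s r : 0 < r ->
  has_pseries (fun z => cexp (l * (z - s))) s r (fun k => l ^+ k / k`!%:R)
    (expR (normc l * r)).
Proof.
move=> r0; split => // [K|w wr].
  rewrite (eq_bigr (fun k : 'I_K => (normc l * r) ^+ k / k`!%:R)).
    by rewrite exp_partial_le// mulr_ge0 ?normc_ge0 ?ltW.
  by move=> k _; rewrite Normc.normcM normcX normc_fact exprMn; ring.
by rewrite psum_cexp [s + w]addrC addrK; exact: ccvg_cexp_sum.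
Qed.

Lemma normc_subX_le x y (m : R) k : normc x <= m -> normc y <= m ->
  normc (x ^+ k.+1 - y ^+ k.+1) <= k.+1%:R * m ^+ k * normc (x - y).
Proof.
move=> xm ym; rewrite subrXX Normc.normcM mulrC ler_wpM2r ?normc_ge0//.
rewrite (le_trans (normc_sum _ _ _))// (@le_trans _ _ (\sum_(i < k.+1) m ^+ k))//.
  apply: ler_sum => i _; rewrite Normc.normcM !normcX.
  have -> : m ^+ k = m ^+ (k.+1 - i.+1) * m ^+ i.
    by rewrite -exprD; congr (_ ^+ _); have := ltn_ord i; lia.
  have m0 : 0 <= m := le_trans (normc_ge0 _) xm.
  by rewrite ler_pM ?exprn_ge0 ?normc_ge0// lerXn2r ?nnegrE ?normc_ge0.
by rewrite sumr_const card_ord mulr_natl.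
Qed.

(** The constant terms cancel, and x^(k+1) - y^(k+1) yields the factor |x - y|. With x and y
    logarithms of consecutive integers, this is the gain 1/n that makes the differences in
    [dseries_pow_near] summable. *)
Lemma has_pseries_cexpB x y s r (m : R) : 0 < r -> normc x <= m -> normc y <= m ->
  has_pseries (fun z => cexp (x * (z - s)) - cexp (y * (z - s))) s r
    (fun k => x ^+ k / k`!%:R - y ^+ k / k`!%:R) (normc (x - y) * r * expR (m * r)).
Proof.
move=> r0 xm ym; have [_ _ cv] := has_pseriesB (has_pseries_cexp x s r0) (has_pseries_cexp y s r0).
split => // [[|K]]; first by rewrite big_ord0 !mulr_ge0 ?normc_ge0 ?expR_ge0// ltW.
have m0 : 0 <= m := le_trans (normc_ge0 _) xm.
rewrite big_ord_recl !expr0 subrr Normc.normc0 mul0r add0r.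
rewrite (@le_trans _ _ (normc (x - y) * r * \sum_(k < K) (m * r) ^+ k / k`!%:R))//.
  rewrite mulr_sumr; apply: ler_sum => k _; rewrite lift0.
  rewrite -mulrBl Normc.normcM normc_fact.
  rewrite (@le_trans _ _ (k.+1%:R * m ^+ k * normc (x - y) / k.+1`!%:R * r ^+ k.+1))//.
    by rewrite !ler_wpM2r ?exprn_ge0 ?invr_ge0 ?(ltW r0) ?normc_subX_le.
  have h1 : (k`!%:R : R) != 0 by rewrite pnatr_eq0 -lt0n fact_gt0.
  have h2 : (k.+1%:R : R) != 0 by rewrite pnatr_eq0.
  rewrite factS natrM exprMn exprS le_eqVlt; apply/orP; left; apply/eqP.
  by move: h1 h2; move: (k`!%:R) (k.+1%:R) => p q h1 h2; field; rewrite h1 h2.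
by rewrite ler_wpM2l ?mulr_ge0 ?normc_ge0 ?exp_partial_le ?mulr_ge0 ?(ltW r0).
Qed.

Lemma pow_near_cexp l x s : pow_near (fun z => x * cexp (l * (z - s))) s.
Proof.
exists 1; do 2 eexists; apply: has_pseriesZ; exact: has_pseries_cexp.
Qed.

Lemma pow_near_cst x s : pow_near (fun=> x) s.
Proof.
have [r [a [B h]]] := pow_near_cexp 0 x s; exists r, a, B.
by have := h; under eq_fun do rewrite mul0r cexp0 mulr1.
Qed.

End ExpSeries.

(** * Convergence and analyticity to the right of 1/2 *)

Section DirichletSeries.
Context {R : realType}.
Implicit Types (c : nat -> R[i]) (s : R[i]).

Definition dpoly c N Y s : R[i] := \sum_(N <= n < Y) c n * cpown n.+1 (- s).

Definition dseries c s : R[i] := xget 0 [set l | ccvg (fun N => dpoly c 0 N s) l].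

Lemma dpoly_cat c N M Y s : (N <= M)%N -> (M <= Y)%N ->
  dpoly c N Y s = dpoly c N M s + dpoly c M Y s.
Proof. by move=> NM MY; rewrite /dpoly -big_cat_nat. Qed.

Variables (Q : nat) (c : nat -> R[i]).
Hypothesis pc : periodic0 Q c.

Lemma dseries_cvg s : 2^-1 <= complex.Re s -> ccvg (fun N => dpoly c 0 N s) (dseries c s).
Proof.
move=> s2; have [l hl] : exists l, ccvg (fun N => dpoly c 0 N s) l; last first.
  by rewrite /dseries; case: xgetP => [x -> //|/(_ l)]; case.
(* At a fixed point A is fixed, so the order k = 0 suffices: the tail is O((1 + A) N^(-1/2)). *)
have [C C0 H] := dirichlet_tail_le 0 pc; set A := normc s + 1.
have A0 : 0 <= A by rewrite addr_ge0 ?normc_ge0.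
apply: ccvg_cauchy => e e0.
have D0 : 0 < C * (1 + A) + 1 by rewrite ltr_wpDl// mulr_ge0// addr_ge0.
have p20 : (0 : R) < 2^-1 by rewrite invr_gt0.
have [|T0 T00 hT] := powRN_small p20 (e := e / (C * (1 + A) + 1)); first by rewrite divr_gt0.
exists (Num.truncn T0) => n Nn; set N := Num.truncn T0 in Nn *.
rewrite (dpoly_cat c s (leq0n N) Nn) addrAC subrr add0r /dpoly.
rewrite (le_trans (H s A _ _ s2 (lexx _) Nn))//.
have hN : N.+1%:R `^ (- 2^-1) <= e / (C * (1 + A) + 1).
  by apply: hT; rewrite ltW// truncnS_gt.
rewrite big_ord_recl big_ord0 !expr0 addr0 mulr1 mulrAC.
rewrite (@le_trans _ _ ((C * (1 + A) + 1) * N.+1%:R `^ (- 2^-1)))//.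
  by rewrite ler_wpM2r ?powR_ge0// lerDl.
by rewrite mulrC -ler_pdivlMr.
Qed.

Lemma dseries_tail_le k : exists2 C, 0 <= C & forall s A N, 2^-1 <= complex.Re s ->
    normc s + 1 <= A ->
    normc (dseries c s - dpoly c 0 N s) <=
    C * N.+1%:R `^ (- 2^-1) *
      (\sum_(j < k.+1) (A / N.+1%:R) ^+ j + A * (A / N.+1%:R) ^+ k).
Proof.
have [C C0 H] := dirichlet_tail_le k pc; exists C => // s A N s2 sA.
apply: (@ccvg_normc_le _ (fun Y => dpoly c 0 Y s - dpoly c 0 N s)).
  exists N => Y NY; rewrite (dpoly_cat c s (leq0n N) NY) addrAC subrr add0r.
  exact: H.
by apply: ccvgB; [exact: dseries_cvg|exact: ccvg_cst].
Qed.

Lemma cpown_near n s z : cpown n (- z) = cpown n (- s) * cexp (- (ln n%:R)%:C * (z - s)).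
Proof.
by rewrite /cpown -cexpD; congr cexp; ring.
Qed.

(** The series converges only conditionally in part of the half-plane. One summation by parts
    against a periodic primitive b replaces its terms by b n.+1 times differences of n^(-z), which
    have summable majorants on a small disc. *)
Lemma dseries_pow_near s : 2^-1 < complex.Re s -> pow_near (dseries c) s.
Proof.
move=> s2; have [b pb cb] := periodic0_primitive pc.
have [B B0 bB] := periodic0_bounded pb.
(* The boundary term of the summation at n = 0 is -b 0; the one at N tends to 0. *)
pose g (z : R[i]) := dseries c z + b 0.
suff [r [a [T hg]]] : pow_near g s.
  have := pow_nearB (ex_intro _ r (ex_intro _ a (ex_intro _ T hg))) (pow_near_cst (b 0) s).
  by rewrite /g; under eq_fun do rewrite addrK.
(* The bound Re s - 1/2 keeps the disc where the series converges; the bound 1/4 makes the exponent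
   p below larger than 1. *)
pose r : R := Num.min 4^-1 (complex.Re s - 2^-1).
have r0 : 0 < r by rewrite lt_min invr_gt0 subr_gt0 s2 ltr0n.
have r4 : r <= 4^-1 by rewrite ge_min lexx.
have rs : r <= complex.Re s - 2^-1 by rewrite ge_min lexx orbT.
pose f (z : R[i]) n := cpown n.+1 (- z).
pose fn n (z : R[i]) := - b n.+1 * ndiff (f z) n.
pose x n : R[i] := - (ln n.+2%:R)%:C; pose y n : R[i] := - (ln n.+1%:R)%:C.
pose P n : R[i] := cpown n.+2 (- s); pose Q' n : R[i] := cpown n.+1 (- s).
(* From the splitting P e^x - Q' e^y = (P - Q') e^x + Q' (e^x - e^y): each part contains one small
   difference. *)
pose bd n : R := B * (normc (P n - Q' n) * expR (normc (x n) * r) +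
   normc (Q' n) * (normc (x n - y n) * r * expR (normc (x n) * r))).
pose a n k := - b n.+1 * ((P n - Q' n) * (x n ^+ k / k`!%:R) -
  (- Q' n) * (x n ^+ k / k`!%:R - y n ^+ k / k`!%:R)).
have yx n : normc (y n) <= normc (x n).
  rewrite !normc_opp !normc_real !ger0_norm ?ln_ge0 ?ler1n//.
  by rewrite ler_ln ?posrE ?ltr0n// ler_nat.
have hfn n : has_pseries (fn n) s r (a n) (bd n).
  have h := has_pseriesZ (- b n.+1) (has_pseriesB
    (has_pseriesZ (P n - Q' n) (has_pseries_cexp (x n) s r0))
    (has_pseriesZ (- Q' n) (has_pseries_cexpB s r0 (lexx (normc (x n))) (yx n)))).
  case: h => _ h1 h2; split => // [K|w wr].
    rewrite (le_trans (h1 K))// (normc_opp (b n.+1)) (normc_opp (Q' n)) /bd ler_wpM2r ?bB//.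
    by rewrite addr_ge0 ?mulr_ge0 ?normc_ge0 ?expR_ge0 ?(ltW r0).
  have := h2 _ wr; congr (ccvg _ _); rewrite /fn /ndiff /f.
  rewrite (cpown_near n.+2 s) (cpown_near n.+1 s) -/(x n) -/(y n) -/(P n) -/(Q' n).
  by ring.
(* A difference contributes n^(-(Re s + 1)), and the exponentials on the disc cost (n + 2)^r, at
   most 2^r (n + 1)^r. *)
pose p : R := complex.Re s + 1 - r.
have p1 : 1 < p by rewrite /p; move: s2 r4; lra.
pose C := B * (2 * normc s + r) * 2 `^ r.
have C0 : 0 <= C by rewrite !mulr_ge0 ?powR_ge0// addr_ge0 ?mulr_ge0 ?normc_ge0 ?ltW.
have s0 : 0 <= complex.Re s by move: s2; lra.
have bdle n : bd n <= C * n.+1%:R `^ (- p).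
  have n10 : (0 : R) < n.+1%:R by [].
  have xE : normc (x n) = ln n.+2%:R.
    by rewrite normc_opp normc_real ger0_norm// ln_ge0// ler1n.
  have eE : expR (normc (x n) * r) <= 2 `^ r * n.+1%:R `^ r.
    rewrite xE expRM lnK ?posrE// -powRM// ge0_ler_powR ?nnegrE ?mulr_ge0 ?(ltW r0)//.
    by rewrite -natrM ler_nat; lia.
  have PQ : normc (P n - Q' n) <= 2 * normc s * n.+1%:R `^ (- (complex.Re s + 1)).
    have := normc_iter_fdiff_rpow 1 s0 n10.
    by rewrite big_ord_recl big_ord0 /= addr0 mulr1 /fdiff natr1.
  have Q'E : normc (Q' n) = n.+1%:R `^ (- complex.Re s).
    by rewrite normc_cpown// raddfN.
  have xy : normc (x n - y n) <= n.+1%:R^-1.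
    have -> : x n - y n = (ln n.+1%:R - ln n.+2%:R)%:C.
      by rewrite /x /y opprK rmorphB addrC.
    rewrite normc_real distrC ger0_norm; last first.
      by rewrite subr_ge0 ler_ln ?posrE// ler_nat.
    rewrite -ln_div ?posrE//.
    have -> : n.+2%:R / n.+1%:R = 1 + n.+1%:R^-1 :> R.
      by rewrite -[n.+2%:R]natr1 mulrDl mul1r divff ?gt_eqF.
    by apply: le_ln1Dx; rewrite (lt_trans _ (_ : 0 < _)) ?invr_gt0// ltrN10.
  rewrite /bd /C -!mulrA ler_wpM2l//.
  have -> : n.+1%:R `^ (- p) = n.+1%:R `^ (- (complex.Re s + 1)) * n.+1%:R `^ r :> R.
    rewrite -powRD ?(gt_eqF n10) ?implybT//; congr (_ `^ _); rewrite /p; ring.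
  rewrite (@le_trans _ _ ((2 * normc s * n.+1%:R `^ (- (complex.Re s + 1)) +
      n.+1%:R `^ (- (complex.Re s + 1)) * r) * (2 `^ r * n.+1%:R `^ r)))//; last first.
    by apply/eqW; ring.
  rewrite [leRHS]mulrDl lerD//.
    by rewrite ler_pM ?normc_ge0 ?expR_ge0.
  have -> : n.+1%:R `^ (- (complex.Re s + 1)) = n.+1%:R `^ (- complex.Re s) / n.+1%:R :> R.
    rewrite opprD powRD ?(gt_eqF n10) ?implybT//; congr (_ * _).
    by rewrite powRN powRr1 ?ltW.
  rewrite Q'E -!mulrA ler_wpM2l ?powR_ge0//.
  rewrite ler_pM ?normc_ge0 ?mulr_ge0 ?expR_ge0 ?(ltW r0)//.
  by rewrite ler_wpM2l ?(ltW r0).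
exists r; suff [A hA] : exists A, has_pseries g s r A (C * (1 + (p - 1)^-1)).
  by exists A, (C * (1 + (p - 1)^-1)).
apply: (has_pseries_series r0 hfn) => [N|w wr].
  rewrite (@le_trans _ _ (C * \sum_(0 <= n < N) n.+1%:R `^ (- p)))//.
    by rewrite mulr_sumr big_mkord; apply: ler_sum => n _.
  by rewrite ler_wpM2l// (le_trans (pseries_le _ _ p1))// powR1 mulr1.
have w2 : 2^-1 <= complex.Re (s + w).
  have := normc_Re_le w; rewrite raddfD /= ler_norml => /andP[h _].
  by move: wr rs h; lra.
have H := ccvgD (dseries_cvg w2) (ccvg_cst (b 0)).
have bf0 : ccvg (fun N => b N * f (s + w) N) 0.
  move=> e e0; have p20 : (0 : R) < 2^-1 by rewrite invr_gt0.
  have B10 : 0 < B + 1 by rewrite ltr_wpDl.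
  have [|T0 T00 hT] := powRN_small p20 (e := e / (B + 1)); first by rewrite divr_gt0.
  exists (Num.truncn T0) => n Nn; rewrite subr0 Normc.normcM.
  rewrite (@le_trans _ _ ((B + 1) * (e / (B + 1))))//; last first.
    by rewrite mulrC divfK// gt_eqF.
  rewrite ler_pM ?normc_ge0 ?(le_trans (bB n))// ?lerDl//.
  rewrite normc_cpown// raddfN /= (le_trans _ (hT n.+1%:R _))//.
    by rewrite ler_powR ?ler1n// lerN2.
  by rewrite (le_trans (ltW (truncnS_gt T0)))// ler_nat.
have := ccvgB H bf0; rewrite subr0; apply: ccvg_eq; exists 0%N => N _.
rewrite -(big_mkord xpredT (fun n => fn n (s + w))) /fn.
rewrite (eq_bigr (fun n => - (b n.+1 * ndiff (f (s + w)) n))); last first.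
  by move=> n _; rewrite mulNr.
rewrite sumrN /dpoly.
rewrite (eq_bigr (fun n => ndiff b n * f (s + w) n)); last first.
  by move=> n _; rewrite cb.
rewrite abel_summation// /f cpown1; ring.
Qed.

End DirichletSeries.

(** * The factor removing the pole *)

Section Twist.
Context {R : realType}.
Implicit Types (chi : int -> R[i]) (s : R[i]) (q : nat).

(* The coefficients of the Dirichlet series of [(1 - 2 ^ (1 - s)) * L s chi], whose
   index is shifted by one. *)
Definition twist chi (n : nat) : R[i] :=
  chi n.+1%:Z - (if odd n then 2 * chi (n.+1)./2%:Z else 0).

Lemma sum_odd_half (V : zmodType) (F : nat -> V) Z :
  \sum_(n < Z.*2) (if odd n then F (n.+1)./2 else 0) = \sum_(n < Z) F n.+1.
Proof.
elim: Z => [|Z ih]; first by rewrite !big_ord0.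
rewrite doubleS !big_ord_recr /= ih odd_double /= addr0 ?doubleK.
by [].
Qed.

(** Over 2q indices, chi contributes twice its sum over a period; the subtracted terms are 2 chi at
    q consecutive integers and contribute the same. This covers principal characters. *)
Lemma twist_periodic0 q chi : is_dirichlet_character q chi ->
  periodic0 q.*2 (twist chi).
Proof.
move=> [q0 _ chiq _].
have per (n k : nat) : chi (n + q * k)%N%:Z = chi n%:Z.
  elim: k => [|k ih]; first by rewrite muln0 addn0.
  by rewrite mulnS addnCA addnC PoszD chiq.
split => [|n|]; first by rewrite double_gt0.
  rewrite /twist oddD odd_double addbF -addSn -muln2 per; congr (_ - _).
  case: ifP => // _; congr (2 * _).
  have -> : ((n.+1 + q * 2)./2 = (n.+1)./2 + q * 1)%N.
    by rewrite muln1 muln2 halfD odd_double andbF add0n doubleK.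
  exact: per.
rewrite /twist sumrB (sum_odd_half (fun m => 2 * chi m%:Z)) -mulr_sumr.
have -> : \sum_(i < q.*2) chi i.+1%:Z = \sum_(i < q) chi i.+1%:Z + \sum_(i < q) chi i.+1%:Z.
  rewrite -addnn big_split_ord /=; congr (_ + _); apply: eq_bigr => i _ /=.
  by have := per i.+1 1%N; rewrite muln1 => <-; rewrite -addnS addnC.
by rewrite mulr_natl mulr2n subrr.
Qed.

(** Cutting at an even index makes the truncations match: the even integers up to 2 Z are the
    doubles of those up to Z. *)
Lemma dpoly_twist chi Z s :
  dpoly (twist chi) 0 Z.*2 s =
  \sum_(n < Z.*2) chi n.+1%:Z * cpown n.+1 (- s) -
  2 * cpown 2 (- s) * \sum_(n < Z) chi n.+1%:Z * cpown n.+1 (- s).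
Proof.
rewrite /dpoly big_mkord mulr_sumr.
rewrite -(sum_odd_half (fun m => 2 * cpown 2 (- s) * (chi m%:Z * cpown m (- s)))).
rewrite -sumrB; apply: eq_bigr => -[n _] _ /=; rewrite /twist mulrBl; congr (_ - _).
case: ifP => on; last by rewrite mul0r.
have e : n.+1 = (2 * (n.+1)./2)%N.
  by rewrite mul2n -[LHS]odd_double_half /= on.
rewrite {2}e cpownM//; last by case: n on {e} => // -[|n].
by ring.
Qed.

(** For Re s > 1 both sides are limits of the same even partial sums. The identity theorem extends
    the equality to Re s > 1/2, apart from s = 1. *)
Lemma dirichletL_twist q chi (L : CC R -> CC R) : is_dirichlet_character q chi ->
  is_dirichletL chi L -> forall s, 2^-1 < complex.Re s -> s != 1 ->
  (1 - 2 * cpown 2 (- s)) * (L s : R[i]) = dseries (twist chi) s.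
Proof.
move=> hchi [Lser Lan] s s2 s1; have pc := twist_periodic0 hchi.
apply/eqP; rewrite -subr_eq0; apply/eqP.
pose E s : R[i] := (1 - 2 * cpown 2 (- s)) * (L s : R[i]) - dseries (twist chi) s.
apply: (@pow_near_identity _ E 2^-1 1) => // {s s2 s1} s.
  move=> s2 s1; apply: pow_nearB; last exact: dseries_pow_near pc _ s2.
  apply: pow_nearM; last by apply: analytic_at_pow_near; apply: Lan; left.
  apply: pow_nearB; first exact: pow_near_cst.
  rewrite (_ : (fun _ => _) = fun z => 2 * cpown 2 (- s) * cexp (- (ln 2%:R)%:C * (z - s))).
    exact: pow_near_cexp.
  by apply/funext => z; rewrite (cpown_near _ s) mulrA.
move=> s1; have /ccvgP := Lser _ s1; rewrite seriesEord => H.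
have s2 : 2^-1 <= complex.Re s by move: s1; lra.
have H2 := ccvg_comp (p := double) (fun n => leq_trans (leq_addr n n) (eq_leq (addnn n))) H.
have H1 := ccvg_comp (p := double) (fun n => leq_trans (leq_addr n n) (eq_leq (addnn n)))
  (dseries_cvg pc s2).
have H3 := ccvgB H2 (ccvgMl (2 * cpown 2 (- s)) H).
apply/eqP; rewrite subr_eq0; apply/eqP.
rewrite mulrBl mul1r; apply: (ccvg_unique _ H1).
apply: (ccvg_eq _ H3); exists 0%N => Z _ /=; by rewrite dpoly_twist.
Qed.

(** The modulus of 2^(1 - s) depends only on Re s and exceeds 1 to the left of Re s = 1, so the
    factor stays away from 0 on all vertical translates of K. *)
Lemma normc_twist_factor_ge (s : R[i]) (sigma : R) : complex.Re s <= sigma ->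
  2 `^ (1 - sigma) - 1 <= normc (1 - 2 * cpown 2 (- s)).
Proof.
move=> ssigma; have h : normc (2 * cpown 2 (- s)) = 2 `^ (1 - complex.Re s).
  by rewrite Normc.normcM normc_nat normc_cpown// raddfN/= -powR1B.
have := normc_le_add (2 * cpown 2 (- s)) 1.
rewrite h Normc.normc1 normc_sub.
have : 2 `^ (1 - sigma) <= 2 `^ (1 - complex.Re s) :> R.
  by rewrite ler_powR ?ler1n// lerB.
lra.
Qed.

End Twist.

(** * Discrete mean squares of Dirichlet polynomials *)

Section MeanSquare.
Context {R : realType}.
Implicit Types (a : nat -> R[i]) (s z : R[i]) (theta : R).

Lemma normc_conj z : normc z^* = normc z.
Proof. by case: z => x y; rewrite /normc /= sqrrN. Qed.

(** This is (n + 1)^(-i theta); its j-th power is the oscillation of the n-th term at height theta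
    j. *)
Definition phase theta n : R[i] := cexp (- (0 +i* theta) * (ln n.+1%:R)%:C).

Lemma phaseE theta n : phase theta n = cexp (0 +i* (- (theta * ln n.+1%:R))).
Proof. by rewrite /phase; congr cexp; apply/eqP; rewrite eq_complex /=; apply/andP; split; apply/eqP; ring. Qed.

Lemma geometric_sum_le z J : normc z = 1 -> z != 1 ->
  normc (\sum_(j < J) z ^+ j) <= 2 / normc (z - 1).
Proof.
move=> z1 zn1; have z0 : 0 < normc (z - 1) by rewrite normc_gt0 subr_eq0.
rewrite ler_pdivlMr// mulrC -Normc.normcM -subrX1 (le_trans (normcB_le _ _))//.
by rewrite normcX z1 expr1n Normc.normc1.
Qed.

Lemma sin_ge (x : R) : 0 <= x <= 1 -> cos 1 * x <= sin x.
Proof.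
move=> /andP[x0 x1].
have [|c /[1!in_itv]/= /andP[c0 cx]] := @MVT_segment R sin cos 0 x x0 (fun y _ => is_derive_sin y).
  exact/continuous_subspaceT/continuous_sin.
rewrite sin0 !subr0 => ->; rewrite ler_wpM2r//.
have [->//|c1] := eqVneq c 1.
have pi1 : 1 <= pi :> R by rewrite (le_trans _ (pi_ge2 R))// ler1n.
have c1' : c <= 1 := le_trans cx x1.
rewrite ltW// ltr_cos ?in_itv/= ?c0 ?ler01 ?pi1 ?(le_trans c1')//.
by rewrite lt_neqAle c1.
Qed.

Lemma cexp_i_sub1_ge (x : R) : `|x| <= 1 -> cos 1 * `|x| <= normc (cexp (0 +i* x) - 1).
Proof.
move=> x1; rewrite (le_trans _ (normc_Im_le _))//.
have -> : complex.Im (cexp (0 +i* x) - 1) = sin x.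
  by rewrite /cexp /= expR0 mul1r mul0r addr0 subr0.
have [x0|x0] := leP 0 x.
  rewrite [`|x|]ger0_norm// in x1 *.
  by rewrite (le_trans (sin_ge _)) ?x0// ler_norm.
rewrite [`|x|]ltr0_norm// in x1 *.
by rewrite -normrN -sinN (le_trans (sin_ge _)) ?ler_norm// x1 oppr_ge0 ltW.
Qed.

Lemma ln_ratio_ge (n m : nat) : (n < m)%N ->
  (m - n)%:R / m.+1%:R <= ln m.+1%:R - ln n.+1%:R :> R.
Proof.
move=> nm; rewrite -ln_div ?posrE// -lerN2 -lnV ?posrE ?divr_gt0// invf_div.
have -> : (n.+1%:R / m.+1%:R : R) = 1 + - ((m - n)%:R / m.+1%:R).
  have m0 : (m.+1%:R : R) != 0 by rewrite pnatr_eq0.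
  rewrite natrB ?(ltnW nm)// (_ : m%:R = m.+1%:R - 1 :> R); last by rewrite -natr1 addrK.
  rewrite -[n.+1%:R]natr1; move: m0; move: (m.+1%:R) => x x0.
  by field; rewrite x0.
apply: le_ln1Dx; rewrite ltrN2 ltr_pdivrMr// mul1r ltr_nat; lia.
Qed.

Definition harmonic_sum (Y : nat) : R := \sum_(k < Y) k.+1%:R^-1.

(** What is left of an off-diagonal pair: the coefficients give 1 / ((n + 1) (m + 1)) and the
    geometric sum (m + 1) / (m - n). *)
Definition pair_weight (n m : nat) : R :=
  if (n < m)%N then (n.+1%:R * (m - n)%:R)^-1 else 0.

Lemma pair_weight_ge0 n m : 0 <= pair_weight n m.
Proof. by rewrite /pair_weight; case: ifP => // _; rewrite invr_ge0 mulr_ge0. Qed.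

Lemma pair_weight_sum_le Y :
  \sum_(n < Y) \sum_(m < Y) pair_weight n m <= harmonic_sum Y ^+ 2.
Proof.
rewrite expr2 /harmonic_sum mulr_suml; apply: ler_sum => n _.
rewrite (eq_bigr (fun m : 'I_Y => n.+1%:R^-1 * if (n < m)%N then (m - n)%:R^-1 else 0)); last first.
  by move=> m _; rewrite /pair_weight; case: ifP => _; rewrite ?invfM ?mulr0.
rewrite -mulr_sumr ler_wpM2l ?invr_ge0//.
rewrite -(big_mkord xpredT (fun m => if (n < m)%N then (m - n)%:R^-1 else 0 : R)).
rewrite (big_cat_nat (leq0n n.+1) (ltn_ord n))/= big_nat big1 ?add0r; last first.
  by move=> m /andP[_ mn]; rewrite ltnNge -ltnS mn.
rewrite -{2}(subnKC (ltn_ord n)) sum_nat_shift.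
rewrite (eq_bigr (fun k : 'I_(Y - n.+1) => k.+1%:R^-1)); last first.
  move=> k _; rewrite (_ : (n < k + n.+1)%N); last lia.
  by congr (_%:R^-1); lia.
rewrite -!(big_mkord xpredT (fun k => k.+1%:R^-1)).
rewrite [leRHS](big_cat_nat (leq0n (Y - n.+1)) (leq_subr _ _))/= lerDl.
by rewrite sumr_ge0// => k _; rewrite invr_ge0.
Qed.

(** The hypothesis on theta keeps theta ln ((m + 1) / (n + 1)) within [-1, 1], so the ratio of the
    geometric sum does not wind around the circle: its distance to 1 is at least cos 1 |theta| (m -
    n) / (m + 1). *)
Lemma phase_sum_le theta Y J n m : theta != 0 -> `|theta| * ln Y%:R <= 1 ->
  (n < m < Y)%N ->
  normc (\sum_(j < J) (phase theta n * (phase theta m)^*) ^+ j) <=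
  2 / (cos 1 * `|theta|) * (m.+1%:R / (m - n)%:R) /\
  normc (\sum_(j < J) (phase theta m * (phase theta n)^*) ^+ j) <=
  2 / (cos 1 * `|theta|) * (m.+1%:R / (m - n)%:R).
Proof.
move=> th0 thY /andP[nm mY].
set l : R := ln m.+1%:R - ln n.+1%:R.
have lge := ln_ratio_ge nm; rewrite -/l in lge.
have q0 : (0 : R) < (m - n)%:R / m.+1%:R by rewrite divr_gt0// ltr0n subn_gt0.
have l0 : 0 < l by exact: lt_le_trans lge.
have lY : `|theta| * l <= 1.
  rewrite (le_trans _ thY)// ler_wpM2l// /l.
  have h1 : ln m.+1%:R <= ln Y%:R :> R.
    by rewrite ler_ln ?posrE ?ltr0n ?ler_nat//; lia.
  have h2 : 0 <= ln n.+1%:R :> R by rewrite ln_ge0// ler1n.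
  by move: h1 h2; lra.
have th0' : 0 < `|theta| by rewrite normr_gt0.
have c0 := @cos1_gt0 R.
have key x : `|x| = `|theta| * l ->
    normc (\sum_(j < J) (cexp (0 +i* x)) ^+ j) <=
    2 / (cos 1 * `|theta|) * (m.+1%:R / (m - n)%:R).
  move=> xl; have ge := @cexp_i_sub1_ge x; rewrite xl in ge; have {}ge := ge lY.
  have gt0 : 0 < cos 1 * (`|theta| * l) by rewrite !mulr_gt0.
  have n0 : 0 < normc (cexp (0 +i* x) - 1) := lt_le_trans gt0 ge.
  rewrite (le_trans (geometric_sum_le _ _ _))//.
  - by rewrite normc_cexp /= expR0.
  - by rewrite -subr_eq0 -normc_gt0.
  rewrite -mulrA ler_wpM2l//.
  rewrite (@le_trans _ _ (cos 1 * (`|theta| * ((m - n)%:R / m.+1%:R)))^-1)//; last first.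
    by rewrite !invfM invrK; apply/eqW; ring.
  rewrite lef_pV2 ?posrE//; last by rewrite mulr_gt0// mulr_gt0.
  by rewrite (le_trans _ ge)// ler_wpM2l ?(ltW c0)// ler_wpM2l.
have e1 : phase theta n * (phase theta m)^* = cexp (0 +i* (theta * l)).
  rewrite !phaseE conjc_cexp -cexpD; congr cexp; apply/eqP; rewrite eq_complex /= /l.
  by apply/andP; split; apply/eqP; ring.
have e2 : phase theta m * (phase theta n)^* = cexp (0 +i* (- (theta * l))).
  rewrite !phaseE conjc_cexp -cexpD; congr cexp; apply/eqP; rewrite eq_complex /= /l.
  by apply/andP; split; apply/eqP; ring.
rewrite e1 e2; split; apply: key; rewrite ?normrN normrM [`|l|]ger0_norm//; exact: ltW.
Qed.

Lemma mean_square_expand a theta Y J :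
  \sum_(j < J) normc (\sum_(n < Y) a n * phase theta n ^+ j) ^+ 2 <=
  \sum_(n < Y) \sum_(m < Y) normc (a n) * normc (a m) *
    normc (\sum_(j < J) (phase theta n * (phase theta m)^*) ^+ j).
Proof.
set S := \sum_(j < J) _.
have S0 : 0 <= S by rewrite sumr_ge0// => j _; rewrite sqr_ge0.
rewrite -[S]ger0_norm// -normc_real.
have -> : S%:C = \sum_(n < Y) \sum_(m < Y) a n * (a m)^* *
    \sum_(j < J) (phase theta n * (phase theta m)^*) ^+ j.
  rewrite /S rmorph_sum /=.
  rewrite (eq_bigr (fun j : 'I_J => \sum_(n < Y) \sum_(m < Y) a n * (a m)^* *
     (phase theta n * (phase theta m)^*) ^+ j)); last first.
    move=> j _; rewrite sqr_normcE rmorph_sum mulr_suml; apply: eq_bigr => n _.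
    rewrite mulr_sumr; apply: eq_bigr => m _.
    by rewrite rmorphM rmorphXn [in RHS]exprMn mulrACA.
  rewrite exchange_big; apply: eq_bigr => n _ /=.
  by rewrite exchange_big; apply: eq_bigr => m _ /=; rewrite mulr_sumr.
rewrite (le_trans (normc_sum _ _ _))//; apply: ler_sum => n _.
rewrite (le_trans (normc_sum _ _ _))//; apply: ler_sum => m _.
by rewrite !Normc.normcM normc_conj.
Qed.

(** As alpha <= 1, every coefficient is at most A Y^(1 - alpha) / (n + 1), which turns the
    off-diagonal part into harmonic sums. The 4 is the 2 of the geometric sum, once for each order
    of n and m. *)
Lemma mean_square_le a theta Y J (A alpha : R) : 0 <= A -> alpha <= 1 ->
  theta != 0 -> `|theta| * ln Y%:R <= 1 ->
  (forall n, (n < Y)%N -> normc (a n) <= A * n.+1%:R `^ (- alpha)) ->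
  \sum_(j < J) normc (\sum_(n < Y) a n * phase theta n ^+ j) ^+ 2 <=
  J%:R * \sum_(n < Y) normc (a n) ^+ 2 +
  4 / (cos 1 * `|theta|) * (A * Y%:R `^ (1 - alpha) * harmonic_sum Y) ^+ 2.
Proof.
move=> A0 al1 th0 thY aA; rewrite (le_trans (mean_square_expand _ _ _ _))//.
pose D : R := 2 / (cos 1 * `|theta|); have c0 := @cos1_gt0 R.
have D0 : 0 <= D by rewrite divr_ge0// mulr_ge0// ltW.
pose W := (A * Y%:R `^ (1 - alpha)) ^+ 2.
pose F n m := D * W * (pair_weight n m + pair_weight m n).
pose G n m := normc (a n) * normc (a m) *
    normc (\sum_(j < J) (phase theta n * (phase theta m)^*) ^+ j).
have F0 n m : 0 <= F n m.
  by rewrite /F mulr_ge0 ?addr_ge0 ?pair_weight_ge0// mulr_ge0// sqr_ge0.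
have aY n : (n < Y)%N -> normc (a n) <= A * Y%:R `^ (1 - alpha) * n.+1%:R^-1.
  move=> nY; rewrite (le_trans (aA _ nY))// -mulrA ler_wpM2l//.
  have -> : n.+1%:R `^ (- alpha) = n.+1%:R `^ (1 - alpha) * n.+1%:R^-1 :> R.
    by rewrite powR1B// mulrAC divff// mul1r.
  rewrite ler_wpM2r ?invr_ge0// ge0_ler_powR ?subr_ge0 ?nnegrE//.
  by rewrite ler_nat.
have off n m : (n < m < Y)%N -> normc (a n) * normc (a m) *
    (D * (m.+1%:R / (m - n)%:R)) <= D * W * pair_weight n m.
  move=> /andP[nm mY]; rewrite /pair_weight nm.
  have h1 := aY _ (ltn_trans nm mY); have h2 := aY _ mY.
  have mn0 : (0 : R) < (m - n)%:R by rewrite ltr0n subn_gt0.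
  rewrite (@le_trans _ _ ((A * Y%:R `^ (1 - alpha) / n.+1%:R) *
    (A * Y%:R `^ (1 - alpha) / m.+1%:R) * (D * (m.+1%:R / (m - n)%:R))))//.
    have q0 : 0 <= D * (m.+1%:R / (m - n)%:R) by rewrite mulr_ge0// divr_ge0.
    by rewrite (ler_wpM2r q0)// ler_pM ?normc_ge0.
  rewrite /W le_eqVlt; apply/orP; left; apply/eqP.
  have m10 : (m.+1%:R : R) != 0 by rewrite pnatr_eq0.
  have n10 : (n.+1%:R : R) != 0 by rewrite pnatr_eq0.
  have {}mn0 := gt_eqF mn0.
  move: m10 n10 mn0; move: (m.+1%:R) (n.+1%:R) ((m - n)%:R) => x y z x0 y0 z0.
  by field; rewrite x0 y0 z0.
have GF n m : (n < Y)%N -> (m < Y)%N -> n != m -> G n m <= F n m.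
  move=> nY mY; rewrite neq_ltn => /orP[nm|mn].
    rewrite /G /F mulrDr -[leLHS]addr0 lerD//; last first.
      by rewrite mulr_ge0 ?pair_weight_ge0// mulr_ge0// sqr_ge0.
    rewrite (le_trans _ (off _ _ _)) ?nm//.
    rewrite ler_wpM2l ?mulr_ge0 ?normc_ge0//.
    by have [] := phase_sum_le J th0 thY (introT andP (conj nm mY)).
  rewrite /G /F mulrDr -[leLHS]add0r lerD//.
    by rewrite mulr_ge0 ?pair_weight_ge0// mulr_ge0// sqr_ge0.
  rewrite (le_trans _ (off _ _ _)) ?mn// [normc (a n) * _]mulrC.
  rewrite ler_wpM2l ?mulr_ge0 ?normc_ge0//.
  by have [] := phase_sum_le J th0 thY (introT andP (conj mn nY)).
rewrite (@le_trans _ _ (\sum_(n < Y) (J%:R * normc (a n) ^+ 2 + \sum_(m < Y) F n m)))//.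
  apply: ler_sum => n _; rewrite -/(G _ _) (bigD1 n)//= [X in _ + X <= _]big_mkcond /=.
  apply: lerD.
    have -> : phase theta n * (phase theta n)^* = 1.
      by rewrite -sqr_normcE phaseE normc_cexp /= expR0 expr1n.
    under eq_bigr do rewrite expr1n.
    by rewrite sumr_const card_ord normc_nat mulrC expr2.
  apply: ler_sum => m _; case: ifPn => [mn|_].
    by apply: GF => //; rewrite eq_sym.
  exact: F0.
rewrite big_split /= -mulr_sumr lerD2l.
have -> : \sum_(n < Y) \sum_(m < Y) F n m =
    D * W * (2 * \sum_(n < Y) \sum_(m < Y) pair_weight n m).
  rewrite mulr_natl mulr2n [X in _ + X]exchange_big /= -big_split /= mulr_sumr.
  apply: eq_bigr => n _; rewrite -big_split mulr_sumr; exact: eq_bigr.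
rewrite (@le_trans _ _ (D * W * (2 * harmonic_sum Y ^+ 2)))//.
  have DW0 : 0 <= D * W by rewrite mulr_ge0// sqr_ge0.
  by rewrite (ler_wpM2l DW0)// ler_wpM2l// pair_weight_sum_le.
rewrite /D /W !exprMn; apply/eqW; ring.
Qed.

End MeanSquare.

(** * Mean squares at perturbed points *)

Section MeanSquareDisc.
Context {R : realType}.
Implicit Types (a c : nat -> R[i]) (s z : R[i]) (theta : R).

Lemma ccvg_sqr_normc (u : nat -> R[i]) l :
  ccvg u l -> ccvg (fun n => (normc (u n) ^+ 2)%:C) (normc l ^+ 2)%:C.
Proof.
move=> ul e e0; have D0 : 0 < normc l *+ 2 + 1 by rewrite ltr_wpDl// mulrn_wge0 ?normc_ge0.
have [|N HN] := ul (Num.min 1 (e / (normc l *+ 2 + 1))).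
  by rewrite lt_min ltr01 divr_gt0.
exists N => n /HN; rewrite le_min => /andP[h1 h2].
rewrite -rmorphB normc_real subr_sqr normrM.
rewrite (@le_trans _ _ (e / (normc l *+ 2 + 1) * (normc l *+ 2 + 1)))//; last first.
  by rewrite divfK// gt_eqF.
have := normc_le_add (u n) l; have := normc_le_add l (u n).
rewrite (normc_sub l) => h3 h4; rewrite ler_pM//.
  by rewrite (le_trans _ h2)// ler_norml; lra.
rewrite ger0_norm ?addr_ge0 ?normc_ge0// mulr2n; lra.
Qed.

(** Cauchy's inequality with weights 2^k, so that the constant does not depend on K and the bound
    survives the limit. *)
Lemma sqr_sum_le (x : nat -> R) K :
  (\sum_(k < K) x k) ^+ 2 <= 2 * \sum_(k < K) 2 ^+ k * x k ^+ 2.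
Proof.
elim: K x => [|K ih] x; first by rewrite !big_ord0 expr0n mulr0.
rewrite !big_ord_recl; set y := \sum_(i < K) _.
have hy : y ^+ 2 <= \sum_(i < K) 2 ^+ (lift ord0 i) * x (lift ord0 i) ^+ 2.
  rewrite (le_trans (ih (fun i => x i.+1)))// mulr_sumr; apply/eqW.
  by apply: eq_bigr => i _; rewrite lift0 [2 ^+ i.+1]exprS mulrA.
rewrite expr0 mul1r (le_trans (_ : _ <= 2 * (x 0%N ^+ 2 + y ^+ 2)))//.
  have := sqr_ge0 (x 0%N - y); rewrite sqrrB sqrrD; lra.
by rewrite ler_wpM2l// lerD2l.
Qed.

(** The k-th term of the exponential series of rho ln (n + 1) is at most its sum. *)
Lemma ln_pow_le (rho : R) k n : 0 < rho ->
  ln n.+1%:R ^+ k <= k`!%:R / rho ^+ k * n.+1%:R `^ rho.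
Proof.
move=> rho0; have l0 : 0 <= ln n.+1%:R :> R by rewrite ln_ge0// ler1n.
have h : (rho * ln n.+1%:R) ^+ k / k`!%:R <= n.+1%:R `^ rho.
  have -> : n.+1%:R `^ rho = expR (rho * ln n.+1%:R) by rewrite /powR gt_eqF.
  have rl0 : 0 <= rho * ln n.+1%:R by rewrite mulr_ge0// ltW.
  rewrite (le_trans _ (exp_partial_le k.+1 rl0))//.
  rewrite big_ord_recr /= lerDr sumr_ge0// => i _.
  by rewrite divr_ge0// exprn_ge0.
have k0 : (0 : R) < k`!%:R by rewrite ltr0n fact_gt0.
rewrite exprMn ler_pdivrMr// in h.
rewrite mulrAC ler_pdivlMr ?exprn_gt0//.
by rewrite mulrC [leRHS]mulrC.
Qed.

Lemma cpown_shift n s theta j w :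
  cpown n.+1 (- (s + (0 +i* (theta * j%:R)) + w)) =
  cpown n.+1 (- s) * phase theta n ^+ j * cexp (- w * (ln n.+1%:R)%:C).
Proof.
rewrite /cpown /phase -cexpMn -!cexpD; congr cexp; rewrite -[_ * _ *+ j]mulr_natr.
have -> : (0 +i* (theta * j%:R)) = (0 +i* theta) * j%:R :> R[i].
  by rewrite -(rmorph_nat (real_complex R)); apply/eqP; rewrite eq_complex /=; apply/andP; split; apply/eqP; ring.
ring.
Qed.

(** The points [w j] may vary arbitrarily with j, so this bounds the maxima over the discs. In the
    expansion of n^(-w), the factor w^k / k! is at most (rho/2)^k / k!, while (ln n)^k costs k! /
    rho^k n^rho. The square of the k-th part thus gains 4^(-k); the weights of [sqr_sum_le] leave
    2^(-k), with sum at most 2, and the constant is 4. *)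
Lemma mean_square_disc c N Y s theta (w : nat -> R[i]) J (B rho : R) :
  (forall n, normc (c n) <= B) -> (N <= Y)%N ->
  0 < rho -> complex.Re s - rho <= 1 ->
  theta != 0 -> `|theta| * ln Y%:R <= 1 -> (forall j, normc (w j) <= rho / 2) ->
  \sum_(j < J) normc (dpoly c N Y (s + (0 +i* (theta * j%:R)) + w j)) ^+ 2 <=
  4 * B ^+ 2 * (J%:R * (\sum_(N <= n < Y) n.+1%:R `^ (- (2 * (complex.Re s - rho)))) +
    4 / (cos 1 * `|theta|) *
    (Y%:R `^ (1 - (complex.Re s - rho)) * harmonic_sum Y) ^+ 2).
Proof.
move=> cB NY rho0 al1 th0 thY wr; set alpha := complex.Re s - rho.
have B0 : 0 <= B := le_trans (normc_ge0 _) (cB 0%N).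
set S := \sum_(N <= n < Y) _; set H := (_ * harmonic_sum Y) ^+ 2.
have S0 : 0 <= S by rewrite sumr_ge0// => n _; rewrite powR_ge0.
have H0 : 0 <= H by rewrite sqr_ge0.
have c0 := @cos1_gt0 R.
pose D : R := 4 / (cos 1 * `|theta|).
have D0 : 0 <= D by rewrite divr_ge0// mulr_ge0// ltW.
pose L n : R[i] := (ln n.+1%:R)%:C.
pose a k n : R[i] := if (N <= n)%N then c n * cpown n.+1 (- s) * L n ^+ k else 0.
(* The polynomials [q k] are free of [w], so [mean_square_le] applies to each of them. *)
pose q k j := \sum_(n < Y) a k n * phase theta n ^+ j.
pose p K j := \sum_(k < K) (- w j) ^+ k / k`!%:R * q k j.
have pE K j : p K j = \sum_(n < Y) (if (N <= n)%N then
    c n * cpown n.+1 (- s) * phase theta n ^+ j * cexp_sum (- w j * L n) K else 0).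
  rewrite /p (eq_bigr (fun k : 'I_K => \sum_(n < Y) (- w j) ^+ k / k`!%:R *
    (a k n * phase theta n ^+ j))); last by move=> k _; rewrite mulr_sumr.
  rewrite exchange_big; apply: eq_bigr => n _ /=; rewrite /a; case: ifP => _; last first.
    by rewrite big1// => k _; rewrite mul0r mulr0.
  rewrite /cexp_sum mulr_sumr; apply: eq_bigr => k _; rewrite [(_ * L n) ^+ k]exprMn.
  by move: (phase _ _ ^+ j) => ph; ring.
have pcv j : ccvg (fun K => p K j) (dpoly c N Y (s + (0 +i* (theta * j%:R)) + w j)).
  have -> : dpoly c N Y (s + (0 +i* (theta * j%:R)) + w j) =
    \sum_(n < Y) (if (N <= n)%N then
      c n * cpown n.+1 (- s) * phase theta n ^+ j * cexp (- w j * L n) else 0).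
    rewrite /dpoly -(big_mkord xpredT (fun n => if (N <= n)%N then
      c n * cpown n.+1 (- s) * phase theta n ^+ j * cexp (- w j * L n) else 0)).
    rewrite [RHS](big_cat_nat (leq0n N) NY)/= [X in _ = X + _]big_nat.
    rewrite [X in _ = X + _]big1 ?add0r; last first.
      by move=> n /andP[_ nN]; rewrite leqNgt nN.
    rewrite big_nat [RHS]big_nat; apply: eq_bigr => n /andP[Nn _].
    by rewrite Nn cpown_shift !mulrA.
  under eq_fun do rewrite pE.
  apply: (@ccvg_sum _ Y (fun n K => if (N <= n)%N then
    c n * cpown n.+1 (- s) * phase theta n ^+ j * cexp_sum (- w j * L n) K else 0)
    (fun n => if (N <= n)%N then
    c n * cpown n.+1 (- s) * phase theta n ^+ j * cexp (- w j * L n) else 0)) => n _.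
  case: ifP => _; last exact: ccvg_cst.
  by apply: ccvgMl; exact: ccvg_cexp_sum.
pose A k := B * (k`!%:R / rho ^+ k).
have A0 k : 0 <= A k by rewrite mulr_ge0// divr_ge0// exprn_ge0// ltW.
have aA k n : (n < Y)%N -> normc (a k n) <= A k * n.+1%:R `^ (- alpha).
  move=> _; rewrite /a; case: ifP => _; last first.
    by rewrite Normc.normc0 mulr_ge0 ?powR_ge0.
  rewrite (Normc.normcM _ (L n ^+ k)) (Normc.normcM (c n)) normcX normc_real ger0_norm ?ln_ge0 ?ler1n//.
  have -> : n.+1%:R `^ (- alpha) = n.+1%:R `^ (- complex.Re s) * n.+1%:R `^ rho :> R.
    by rewrite -powRD ?pnatr_eq0 ?implybT// /alpha opprB addrC.
  rewrite normc_cpown// raddfN /= /A.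
  have -> : B * (k`!%:R / rho ^+ k) * (n.+1%:R `^ (- complex.Re s) * n.+1%:R `^ rho) =
     B * n.+1%:R `^ (- complex.Re s) * (k`!%:R / rho ^+ k * n.+1%:R `^ rho) by ring.
  rewrite ler_pM ?mulr_ge0 ?normc_ge0 ?powR_ge0 ?exprn_ge0 ?ln_ge0 ?ler1n//.
    by rewrite ler_wpM2r ?powR_ge0.
  exact: ln_pow_le.
have qle k : \sum_(j < J) normc (q k j) ^+ 2 <= A k ^+ 2 * (J%:R * S + D * H).
  rewrite (le_trans (mean_square_le J (A0 k) al1 th0 thY (aA k)))// mulrDr lerD//; last first.
    by apply/eqW; rewrite -[A k * _ * _]mulrA exprMn -/H /D; ring.
  rewrite mulrCA ler_wpM2l//.
  rewrite -(big_mkord xpredT (fun n => normc (a k n) ^+ 2)) (big_cat_nat (leq0n N) NY)/=.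
  rewrite [X in X + _]big_nat [X in X + _]big1 ?add0r; last first.
    by move=> n /andP[_ nN]; rewrite /a leqNgt nN Normc.normc0 expr0n.
  rewrite mulr_sumr big_nat [leRHS]big_nat; apply: ler_sum => n /andP[_ nY].
  have -> : n.+1%:R `^ (- (2 * alpha)) = (n.+1%:R `^ (- alpha)) ^+ 2 :> R.
    by rewrite expr2 -powRD ?pnatr_eq0 ?implybT//; congr (_ `^ _); ring.
  by rewrite -exprMn lerXn2r ?nnegrE ?normc_ge0 ?aA// mulr_ge0 ?powR_ge0.
have ple K : \sum_(j < J) normc (p K j) ^+ 2 <= 4 * B ^+ 2 * (J%:R * S + D * H).
  rewrite (@le_trans _ _ (\sum_(j < J) 2 * \sum_(k < K) 2 ^+ k *
      ((rho / 2) ^+ k / k`!%:R) ^+ 2 * normc (q k j) ^+ 2))//.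
    apply: ler_sum => j _.
    rewrite (@le_trans _ _ ((\sum_(k < K) (rho / 2) ^+ k / k`!%:R * normc (q k j)) ^+ 2))//.
      rewrite lerXn2r ?nnegrE ?normc_ge0//.
        by rewrite sumr_ge0// => k _; rewrite mulr_ge0 ?normc_ge0// divr_ge0// exprn_ge0// divr_ge0// ltW.
      rewrite (le_trans (normc_sum _ _ _))//; apply: ler_sum => k _.
      rewrite !Normc.normcM normcX normc_opp normc_fact ler_wpM2r ?normc_ge0//.
      by rewrite ler_wpM2r ?invr_ge0// lerXn2r ?nnegrE ?normc_ge0// divr_ge0// ltW.
    rewrite (le_trans (@sqr_sum_le (fun k => (rho / 2) ^+ k / k`!%:R * normc (q k j)) K))//.
    by rewrite ler_wpM2l//; apply: ler_sum => k _; rewrite exprMn mulrA.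
  rewrite -mulr_sumr exchange_big /=.
  rewrite (@le_trans _ _ (2 * \sum_(k < K) (B ^+ 2 * (J%:R * S + D * H)) * 2^-1 ^+ k))//.
    rewrite ler_wpM2l//; apply: ler_sum => k _; rewrite -mulr_sumr.
    have w0 : 0 <= 2 ^+ k * ((rho / 2) ^+ k / k`!%:R) ^+ 2 by rewrite mulr_ge0 ?sqr_ge0// exprn_ge0.
    rewrite (le_trans (ler_wpM2l w0 (qle k)))//; apply/eqW.
    have h1 : (k`!%:R : R) != 0 by rewrite pnatr_eq0 -lt0n fact_gt0.
    have h2 : rho ^+ k != 0 by rewrite expf_neq0// gt_eqF.
    have h3 : (2 ^+ k : R) != 0 by rewrite expf_neq0.
    rewrite /A [(rho / 2) ^+ k]expr_div_n exprVn; move: h1 h2 h3.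
    move: (k`!%:R) (rho ^+ k) (2 ^+ k) => x y z x0 y0 z0.
    by field; rewrite x0 y0 z0.
  rewrite -mulr_sumr.
  have X0 : 0 <= B ^+ 2 * (J%:R * S + D * H).
    by rewrite mulr_ge0 ?sqr_ge0// addr_ge0// mulr_ge0.
  have := ler_wpM2l X0 (@sum_half_le R K); move: (\sum_(k < K) _) => t; lra.
rewrite -[leLHS]ger0_norm; last by rewrite sumr_ge0// => j _; rewrite sqr_ge0.
rewrite -normc_real rmorph_sum.
apply: (@ccvg_normc_le _ (fun K => \sum_(j < J) (normc (p K j) ^+ 2)%:C)).
  exists 0%N => K _; rewrite -rmorph_sum normc_real ger0_norm ?ple//.
  by rewrite sumr_ge0// => j _; rewrite sqr_ge0.
apply: (@ccvg_sum _ J (fun j K => (normc (p K j) ^+ 2)%:C)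
  (fun j => (normc (dpoly c N Y (s + (0 +i* (theta * j%:R)) + w j)) ^+ 2)%:C)) => j _.
exact: ccvg_sqr_normc.
Qed.

End MeanSquareDisc.

(** * Lebesgue outer measure *)

Section OuterLebesgue.
Context {R : realType}.
Implicit Types (A B : set R) (a b c h : R).

Local Notation mu := (@lebesgue_measure R).
(** On bounded sets the measure is finite and [fine] loses nothing. *)
Definition vol A : R := fine (mu A).

(** As a function on all sets, [lebesgue_measure] is the outer measure generated by interval length;
    hence it is monotone and subadditive on arbitrary sets. *)
Let outer : {outer_measure set (ocitv_type R) -> \bar R} := (wlength idfun)^*%mu.

Lemma le_lebesgue A B : A `<=` B -> (mu A <= mu B)%E.
Proof. exact: (le_outer_measure outer). Qed.

Lemma lebesgueU_le A B : (mu (A `|` B) <= mu A + mu B)%E.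
Proof. exact: (outer_measureU2 outer). Qed.

(** A cover by half-open intervals translates into one with the same lengths. *)
Lemma lebesgue_shift_le c A : (mu [set x : R | A (x + c)%R] <= mu A)%E.
Proof.
apply: le_ereal_inf_tmp => _ [F [mF AF] <-].
apply: ereal_inf_lbound; exists (fun k => [set x : R | F k (x + c)]).
  split => [k|x /= /AF[k _ Fk]]; last by exists k.
  have [[x1 x2] _ <-] := mF k; exists (x1 - c, x2 - c) => //.
  by apply/seteqP; split => x /=; rewrite !in_itv /= ltrBlDr lerBrDr.
apply: eq_eseriesr => k _; have [[x1 x2] _ <-] := mF k.
have -> : [set x : R | `]x1, x2]%classic (x + c)] = `]x1 - c, x2 - c]%classic.
  by apply/seteqP; split => x /=; rewrite !in_itv /= ltrBlDr lerBrDr.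
have wl (y1 y2 : R) : wlength idfun `]y1, y2]%classic =
    (if (y1%:E < y2%:E)%E then (y2%:E - y1%:E)%E else 0%E) by exact: wlength_itv.
apply: (etrans (wl _ _)); apply: (etrans _ (esym (wl _ _))) => /=.
rewrite !lte_fin ltrBlDr subrK.
by case: ifP => // _; rewrite -!EFinB; congr (_%:E); ring.
Qed.

Lemma lebesgue_fin A a b : A `<=` `[a, b] -> mu A = (vol A)%:E.
Proof.
move=> Aab; rewrite /vol fineK// ge0_fin_numE ?(outer_measure_ge0 outer)//.
rewrite (le_lt_trans (le_lebesgue Aab))// lebesgue_measure_itv /=.
by case: ifP => // _; rewrite -EFinB ltry.
Qed.

Lemma vol0 : vol set0 = 0.
Proof. by rewrite /vol [mu set0](outer_measure0 outer). Qed.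

Lemma vol_ge0 A : 0 <= vol A.
Proof. by rewrite fine_ge0// (outer_measure_ge0 outer). Qed.

Lemma vol_le A B a b : A `<=` B -> B `<=` `[a, b] -> vol A <= vol B.
Proof.
move=> AB Bab; rewrite -lee_fin -(lebesgue_fin Bab) -(lebesgue_fin (subset_trans AB Bab)).
exact: le_lebesgue.
Qed.

Lemma volU_le A B D a b : A `<=` B `|` D -> B `<=` `[a, b] -> D `<=` `[a, b] ->
  vol A <= vol B + vol D.
Proof.
move=> ABD Bab Dab; have Aab : A `<=` `[a, b] by move=> x /ABD[/Bab|/Dab].
rewrite -lee_fin EFinD -(lebesgue_fin Bab) -(lebesgue_fin Dab) -(lebesgue_fin Aab).
by rewrite (le_trans (le_lebesgue ABD))// lebesgueU_le.
Qed.

Lemma vol_itv a b : a <= b -> vol `[a, b] = b - a.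
Proof.
rewrite /vol lebesgue_measure_itv /= lte_fin le_eqVlt => /predU1P[->|->//].
by rewrite ltxx subrr.
Qed.

Lemma vol_shift_le A B a b c : A `<=` [set x : R | B (x + c)] -> B `<=` `[a, b] ->
  vol A <= vol B.
Proof.
move=> AB Bab; have Bc : [set x : R | B (x + c)] `<=` `[a - c, b - c].
  by move=> x /Bab /=; rewrite !in_itv /= lerBlDr lerBrDr.
rewrite -lee_fin -(lebesgue_fin Bab) -(lebesgue_fin (subset_trans AB Bc)).
by rewrite (le_trans (le_lebesgue AB))// lebesgue_shift_le.
Qed.

Lemma vol_cover_sum_le A (F : nat -> set R) n a b (v : nat -> R) :
  A `<=` [set x | exists2 j, (j < n)%N & F j x] ->
  (forall j, (j < n)%N -> F j `<=` `[a, b]) ->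
  (forall j, (j < n)%N -> vol (F j) <= v j) -> vol A <= \sum_(j < n) v j.
Proof.
elim: n A => [|n ih] A AF Fab Fv.
  have -> : A = set0 by apply/seteqP; split => // x /AF[].
  by rewrite vol0 big_ord0.
pose G := [set x | exists2 j, (j < n)%N & F j x].
have AG : A `<=` G `|` F n.
  by move=> x /AF[j]; rewrite ltnS leq_eqVlt => /predU1P[->|jn] Fj; [right|left; exists j].
have Gab : G `<=` `[a, b] by move=> x [j jn]; apply: Fab; exact: ltnW.
rewrite (le_trans (volU_le AG Gab (Fab _ _)))// big_ord_recr /= lerD ?Fv//.
by apply: ih => // j jn; [apply: Fab; exact: ltnW|apply: Fv; exact: ltnW].
Qed.

Lemma vol_cover_le A (F : nat -> set R) n a b h :
  A `<=` [set x | exists2 j, (j < n)%N & F j x] ->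
  (forall j, (j < n)%N -> F j `<=` `[a, b]) ->
  (forall j, (j < n)%N -> vol (F j) <= h) -> vol A <= n%:R * h.
Proof.
move=> AF Fab Fh; rewrite (le_trans (vol_cover_sum_le (v := fun=> h) AF Fab Fh))//.
by rewrite sumr_const card_ord mulr_natl.
Qed.

End OuterLebesgue.

(** * Asymptotic distributions *)

Section ExceptionalSet.
Context {R : realType}.
Implicit Types (F : R -> R -> R) (T e : R).

Definition frequently (P : R -> Prop) := forall M : R, exists2 T, M < T & P T.

(** With l the lower limit, f frequently exceeds some l + e, and a rational strictly between l and l
    + e separates. The bound b records a positive gap above it. *)
Lemma not_cvg_oscillates (f : R -> R) : (forall T, 0 < T -> 0 <= f T <= 1) ->
  ~ cvg (f @ +oo) -> exists r : rat, frequently (fun T => f T < ratr r) /\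
    exists2 b : R, ratr r < b & frequently (fun T => b < f T).
Proof.
move=> f01 ncv.
(* The eventual lower bounds of f; their supremum is the lower limit. *)
pose A := [set x | exists M, forall T, M < T -> x <= f T].
have supA : has_sup A.
  split; first by exists 0, 0 => T /f01/andP[].
  exists 1 => x [M hM]; set T := Num.max M 0 + 1.
  have MT : M < T by rewrite ltr_pwDr// le_max lexx.
  have /f01/andP[_] : 0 < T by rewrite ltr_pwDr// le_max lexx orbT.
  by apply: le_trans; exact: hM.
set l := sup A.
have [e e0 fe] : exists2 e, 0 < e & frequently (fun T => e < `|l - f T|).
  apply: contrapT => h; apply: ncv; apply/cvg_ex; exists l; apply/cvgrPdist_le => e e0.
  have : ~ frequently (fun T => e < `|l - f T|) by move=> fr; apply: h; exists e.
  move=> /existsNP[M hM]; exists M; split; first exact: num_real.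
  by move=> T MT; rewrite leNgt; apply/negP => eT; apply: hM; exists T.
have [x [M hM] xl] := sup_adherent e0 supA; rewrite -/l in xl.
have [|r /[1!in_itv]/= /andP[lr re]] := @rat_in_itvoo R l (l + e); first by rewrite ltrDl.
exists r; split => [M'|].
  apply: contrapT => h; have : ratr r <= l; last by rewrite leNgt lr.
  apply: sup_upper_bound => //; exists M' => T MT; rewrite leNgt; apply/negP => fr.
  by apply: h; exists T.
exists (l + e) => // M'; have [T] := fe (Num.max M M'); rewrite gt_max => /andP[MT MT'].
have := hM _ MT; rewrite ltr_normr => xf eT; exists T => //.
by move: eT => /orP[|]; lra.
Qed.

(** A separating rational r determines e: if e < e' shared it, one could choose T with F e' T < r,
    then T' with F e T' > b, against the hypothesis for eta = b - r. *)
Lemma countable_not_cvg F : (forall e T, 0 < T -> 0 <= F e T <= 1) ->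
  (forall e e' eta, 0 < e -> e < e' -> 0 < eta ->
    exists T0, forall T, T0 <= T -> exists T1, forall T', T1 <= T' ->
      F e T' <= F e' T + eta) ->
  countable [set e | 0 < e /\ ~ cvg (F e @ +oo)].
Proof.
move=> F01 H.
pose P (r : rat) e := 0 < e /\ frequently (fun T => F e T < ratr r) /\
    exists2 b : R, ratr r < b & frequently (fun T => b < F e T).
have uniq r e e' : P r e -> P r e' -> ~~ (e < e').
  move=> [e0 [_ [b rb fb]]] [_ [fr _]]; apply/negP => ee'.
  have br : 0 < b - ratr r by rewrite subr_gt0.
  have [T0 h0] := H _ _ _ e0 ee' br; have [T T0T fT] := fr T0.
  have [T1 h1] := h0 _ (ltW T0T); have [T' T1T' bT'] := fb T1.
  by have := h1 _ (ltW T1T'); lra.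
pose g (r : rat) := xget 0 [set e | P r e].
apply: (@sub_countable _ _ _ (range g)).
  apply: subset_card_le => e [e0 ncv].
  have [r hr] := not_cvg_oscillates (F01 e) ncv; exists r => //.
  have Pe : P r e by [].
  rewrite /g; case: xgetP => [x -> Px|/(_ e)//].
  by apply/eqP; rewrite eq_le !leNgt !(uniq r).
apply: (card_le_trans (card_image_le _ _)); exact: countableP.
Qed.

End ExceptionalSet.

(** * Uniformly almost periodic functions *)

Section AlmostPeriodic.
Context {R : realType}.
Variable K : set R[i].
Implicit Types (f g : R -> R[i] -> R[i]) (s z : R[i]) (t e : R).

(* Bochner's criterion, uniformly on [K]: up to [e], a function has only finitely
   many translates. *)
Definition almost_periodic f := forall e, 0 < e ->
  exists (I : finType) (kap : R -> I), forall a b, kap a = kap b ->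
    forall t s, K s -> normc (f (a + t) s - f (b + t) s) <= e.

Lemma almost_periodic_cst (g : R[i] -> R[i]) : almost_periodic (fun=> g).
Proof.
move=> e e0; exists unit, (fun=> tt) => a b _ t s _.
by rewrite subrr Normc.normc0 ltW.
Qed.

(** The colour of x is the index of its cell of length e, counted from -B. *)
Lemma bounded_coloring (B e : R) : 0 < e -> exists (I : finType) (kap : R -> I),
  forall x y, `|x| <= B -> `|y| <= B -> kap x = kap y -> `|x - y| <= e.
Proof.
move=> e0; pose n := (Num.truncn (2 * B / e)).+1.
exists 'I_n.+1, (fun x => inord (Num.truncn ((x + B) / e))) => x y xB yB.
have cell u : `|u| <= B -> (Num.truncn ((u + B) / e) < n.+1)%N /\
    (Num.truncn ((u + B) / e))%:R * e <= u + B < ((Num.truncn ((u + B) / e)).+1)%:R * e.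
  rewrite ler_norml => /andP[uB1 uB2].
  have uBe : 0 <= (u + B) / e by rewrite divr_ge0 ?(ltW e0)//; lra.
  split; last by rewrite -ler_pdivlMr// -ltr_pdivrMr// truncn_le uBe truncnS_gt.
  rewrite ltnS /n ltnW// ltnS le_truncn// ler_pM2r ?invr_gt0//; lra.
have [xn /andP[x1 x2]] := cell _ xB; have [yn /andP[y1 y2]] := cell _ yB.
move=> /(congr1 val); rewrite /= !inordK// => exy.
move: x1 x2 y1 y2; rewrite exy; set k := Num.truncn _.
by rewrite -[k.+1%:R]natr1 mulrDl mul1r ler_norml; lra.
Qed.

(** A translation by a multiplies the function by the unit number exp (i lam a), so the cells of its
    cosine and sine serve as colour. *)
Lemma almost_periodic_exp (g : R[i] -> R[i]) (lam : R) :
  (exists2 B : R, 0 < B & forall s, K s -> normc (g s) <= B) ->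
  almost_periodic (fun t s => g s * cexp (0 +i* (lam * t))).
Proof.
move=> [B B0 gB] e e0.
have e'0 : 0 < e / B / 2 by rewrite !divr_gt0.
have [I [kap hkap]] := @bounded_coloring 1 _ e'0.
exists (I * I)%type, (fun t => (kap (cos (lam * t)), kap (sin (lam * t)))) => a b.
move=> [hc hs] t s Ks.
have c1 (x : R) : `|cos x| <= 1 by rewrite cos_max.
have s1 (x : R) : `|sin x| <= 1 by rewrite sin_max.
have -> : g s * cexp (0 +i* (lam * (a + t))) - g s * cexp (0 +i* (lam * (b + t))) =
  g s * cexp (0 +i* (lam * t)) * (cexp (0 +i* (lam * a)) - cexp (0 +i* (lam * b))).
  have sp x : cexp (0 +i* (lam * (x + t))) = cexp (0 +i* (lam * t)) * cexp (0 +i* (lam * x)).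
    rewrite -cexpD; congr cexp; apply/eqP; rewrite eq_complex /=.
    by apply/andP; split; apply/eqP; ring.
  by rewrite !sp; ring.
rewrite (Normc.normcM (_ * _)) (Normc.normcM (g s)) normc_cexp [complex.Re _]/= expR0 mulr1.
rewrite (@le_trans _ _ (B * (e / B)))//; last by rewrite mulrC divfK// gt_eqF.
rewrite ler_pM ?normc_ge0 ?gB// (le_trans (normc_le_ReIm _))//.
rewrite [e / B]splitr lerD//.
  have -> : complex.Re (cexp (0 +i* (lam * a)) - cexp (0 +i* (lam * b))) =
    cos (lam * a) - cos (lam * b) by rewrite /cexp /= expR0; ring.
  exact: (hkap _ _ (c1 _) (c1 _) hc).
have -> : complex.Im (cexp (0 +i* (lam * a)) - cexp (0 +i* (lam * b))) =
  sin (lam * a) - sin (lam * b) by rewrite /cexp /= expR0; ring.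
exact: (hkap _ _ (s1 _) (s1 _) hs).
Qed.

Lemma almost_periodicD f g : almost_periodic f -> almost_periodic g ->
  almost_periodic (fun t s => f t s + g t s).
Proof.
move=> hf hg e e0; have e20 : 0 < e / 2 by rewrite divr_gt0.
have [I [kf Hf]] := hf _ e20; have [J [kg Hg]] := hg _ e20.
exists (I * J)%type, (fun t => (kf t, kg t)) => a b [ef eg] t s Ks.
rewrite opprD addrACA (le_trans (normcD_le _ _))// [e]splitr lerD//.
  exact: Hf.
exact: Hg.
Qed.

Lemma almost_periodic_sum (F : nat -> R -> R[i] -> R[i]) N :
  (forall n, almost_periodic (F n)) ->
  almost_periodic (fun t s => \sum_(n < N) F n t s).
Proof.
move=> hF; elim: N => [|N ih].
  rewrite (_ : (fun _ _ => _) = (fun=> fun=> 0)); first exact: almost_periodic_cst.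
  by apply/funext => t; apply/funext => s; rewrite big_ord0.
rewrite (_ : (fun _ _ => _) = (fun t s => \sum_(n < N) F n t s + F N t s)).
  exact: almost_periodicD.
by apply/funext => t; apply/funext => s; rewrite big_ord_recr.
Qed.

Lemma almost_periodic_div f g (B c : R) : 0 < c -> 0 < B ->
  (forall t s, K s -> normc (f t s) <= B) ->
  (forall t s, K s -> normc (g t s) <= B) ->
  (forall t s, K s -> c <= normc (g t s)) ->
  almost_periodic f -> almost_periodic g ->
  almost_periodic (fun t s => f t s / g t s).
Proof.
move=> c0 B0 fB gB gc hf hg e e0; set d := e * c ^+ 2 / (2 * B).
have d0 : 0 < d by rewrite divr_gt0// mulr_gt0// exprn_gt0.
have [I [kf Hf]] := hf _ d0; have [J [kg Hg]] := hg _ d0.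
exists (I * J)%type, (fun t => (kf t, kg t)) => a b [ef eg] t s Ks.
have ga := gc (a + t) _ Ks; have gb := gc (b + t) _ Ks.
have ga0 : g (a + t) s != 0 by rewrite -normc_gt0 (lt_le_trans c0).
have gb0 : g (b + t) s != 0 by rewrite -normc_gt0 (lt_le_trans c0).
have -> : f (a + t) s / g (a + t) s - f (b + t) s / g (b + t) s =
  ((f (a + t) s - f (b + t) s) * g (b + t) s -
   f (b + t) s * (g (a + t) s - g (b + t) s)) / (g (a + t) s * g (b + t) s).
  by field; rewrite ga0 gb0.
rewrite Normc.normcM Normc.normcV Normc.normcM ler_pdivrMr; last first.
  by rewrite mulr_gt0// normc_gt0.
rewrite (le_trans (normcB_le _ _))// !Normc.normcM.
rewrite (@le_trans _ _ (d * B + B * d))//.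
  by rewrite lerD// ler_pM ?normc_ge0 ?Hf ?Hg ?fB ?gB.
have -> : d * B + B * d = e * c ^+ 2 by rewrite /d; field; rewrite gt_eqF.
rewrite ler_wpM2l ?(ltW e0)// expr2 ler_pM//; exact: ltW.
Qed.

End AlmostPeriodic.

Section Comparison.
Context {R : realType}.
Variables (K : set R[i]) (m : nat).
Implicit Types (Phi Psi : 'I_m -> R -> R[i] -> R[i]) (T e eta x : R).

Definition close_set Phi x T : set R := [set tau | 0 <= tau <= T /\
  forall j k s, K s -> normc (Phi j tau s - Phi k tau s) <= x].

Definition approximable (f : R -> R[i] -> R[i]) := forall del eta, 0 < del -> 0 < eta ->
  exists2 g, almost_periodic K g & exists T0, forall T, T0 <= T ->
    vol [set tau | 0 <= tau <= T /\
      exists2 s, K s & del < normc (f tau s - g tau s)] <= eta * T.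

Lemma subset_itv0 (P : R -> Prop) T :
  [set tau | 0 <= tau <= T /\ P tau] `<=` `[0, T].
Proof. by move=> x [] /=; rewrite in_itv. Qed.

(* The interval [0, T'] is cut in intervals of length [T], each of which is nearly a
   translate of an interval starting in a bounded range. *)
Lemma close_set_almost_periodic Psi x del : 0 < del ->
  (forall j, almost_periodic K (Psi j)) ->
  exists2 l : R, 0 < l & forall T T', 0 < T -> 0 <= T' ->
    vol (close_set Psi x T') <=
    (T' / T + 1) * (vol (close_set Psi (x + 2 * del) T) + 2 * l).
Proof.
move=> del0 hPsi.
have [I [kap hkap]] : exists (I : finType) (kap : R -> I), forall a b, kap a = kap b ->
    forall t j s, K s -> normc (Psi j (a + t) s - Psi j (b + t) s) <= del.
  have hP j := hPsi j _ del0.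
  have [J hJ] := choice hP; have [k hk] := fin_all_exists hJ.
  exists {dffun forall j, J j}, (fun t => [ffun j => k j t]) => a b eab t j s Ks.
  apply: hk => //; by have /ffunP/(_ j) := eab; rewrite !ffunE.
pose rep (i : I) : R := xget 0 [set b | kap b = i].
have repP a : kap (rep (kap a)) = kap a.
  by rewrite /rep; case: xgetP => [y -> //|/(_ a)]; case.
pose l := \sum_i `|rep i| + 1.
have l0 : 0 < l by rewrite ltr_wpDl// sumr_ge0.
have repl i : `|rep i| <= l.
  by rewrite /l (bigD1 i)//= -addrA lerDl addr_ge0// sumr_ge0.
exists l => // T T' T0 T'0.
pose n := (Num.truncn (T' / T)).+1.
pose Q tau := forall j k s, K s -> normc (Psi j tau s - Psi k tau s) <= x.
pose Q' tau := forall j k s, K s -> normc (Psi j tau s - Psi k tau s) <= x + 2 * del.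
pose F (i : nat) := [set tau | i%:R * T <= tau <= i.+1%:R * T /\ Q tau].
set V := vol (close_set Psi (x + 2 * del) T).
have V0 : 0 <= V by exact: vol_ge0.
have TT : 0 <= T' / T by rewrite divr_ge0// ltW.
rewrite (@le_trans _ _ (n%:R * (V + 2 * l)))//; last first.
  rewrite ler_wpM2r//; first by rewrite addr_ge0// mulr_ge0// ltW.
  by rewrite /n -natr1 lerD2r truncn_le.
apply: (@vol_cover_le _ _ F n 0 (n%:R * T)) => [tau [/andP[t0 tT'] Qt]|j jn tau [/andP[h1 h2] _]|j jn].
- have tT : 0 <= tau / T by rewrite divr_ge0// ltW.
  exists (Num.truncn (tau / T)).
    by rewrite ltnS le_truncn// ler_pM2r ?invr_gt0.
  split=> //; apply/andP; split; first by rewrite -ler_pdivlMr// truncn_le.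
  by rewrite -ler_pdivrMr// ltW// truncnS_gt.
- rewrite /= in_itv /=; apply/andP; split.
    by rewrite (le_trans _ h1)// mulr_ge0// ltW.
  by rewrite (le_trans h2)// ler_wpM2r ?(ltW T0)// ler_nat.
- pose b := rep (kap (j%:R * T)).
  have bl : - l <= b <= l by rewrite -ler_norml repl.
  pose W := [set tau | - l <= tau <= T + l /\ Q' tau].
  have FW : F j `<=` [set tau : R | W (tau + (b - j%:R * T))].
    move=> tau [/andP[h1 h2] Qt]; move: h2; rewrite -natr1 mulrDl mul1r => h2.
    have e1 : j%:R * T + (tau - j%:R * T) = tau by rewrite addrC subrK.
    have e2 : b + (tau - j%:R * T) = tau + (b - j%:R * T) by ring.
    split; first by apply/andP; split; move/andP: bl => [bl1 bl2]; lra.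
    move=> i k s Ks.
    have h i' := hkap _ _ (repP (j%:R * T)) (tau - j%:R * T) i' _ Ks.
    have hi := h i; have hk := h k; rewrite -/b e2 e1 in hi hk.
    rewrite (le_trans (normc_sub_trans (Psi i tau s) _ _))//.
    have h3 := normc_sub_trans (Psi k tau s) (Psi i tau s) (Psi k (tau + (b - j%:R * T)) s).
    have h4 := Qt i k s Ks; rewrite (normc_sub (Psi k tau s)) in h3.
    rewrite (le_trans (lerD hi h3))// (le_trans (lerD (lexx _) (lerD h4 hk)))//.
    lra.
  have Wl : W `<=` `[- l, T + l] by move=> tau [] /=; rewrite in_itv.
  rewrite (le_trans (vol_shift_le FW Wl))//.
  have Wsub : W `<=` `[- l, 0] `|` (close_set Psi (x + 2 * del) T `|` `[T, T + l]).
    move=> tau [/andP[h1 h2] Qt] /=; rewrite !in_itv /=.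
    have [t0|t0] := leP tau 0; first by left; rewrite h1.
    right; have [tT|tT] := leP tau T; last by right; rewrite (ltW tT).
    by left; split => //; rewrite (ltW t0).
  have s1 : `[- l, 0] `<=` `[- l, T + l].
    by move=> y /=; rewrite !in_itv /= => /andP[-> h]; rewrite (le_trans h)// addr_ge0// ltW.
  have s2 : close_set Psi (x + 2 * del) T `<=` `[- l, T + l].
    by move=> y [/andP[h1 h2] _] /=; rewrite in_itv /=; apply/andP; split; lra.
  have s3 : `[T, T + l] `<=` `[- l, T + l].
    by move=> y /=; rewrite !in_itv /= => /andP[h1 ->]; rewrite andbT; lra.
  have s23 : close_set Psi (x + 2 * del) T `|` `[T, T + l] `<=` `[- l, T + l].
    by move=> y [/s2|/s3].
  rewrite (le_trans (volU_le Wsub s1 s23))//.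
  rewrite (le_trans (lerD (lexx _) (volU_le (@subset_refl _ _) s2 s3)))//.
  rewrite !vol_itv; [|lra|lra].
  rewrite -/V; lra.
Qed.

Lemma close_set_compare Phi : (forall j, approximable (Phi j)) ->
  forall e e' eta, e < e' -> 0 < eta ->
    exists T0, forall T, T0 <= T -> exists T1, forall T', T1 <= T' ->
      T'^-1 * vol (close_set Phi e T') <= T^-1 * vol (close_set Phi e' T) + eta.
Proof.
move=> hPhi e e' eta ee' eta0.
pose del := (e' - e) / 6; have del0 : 0 < del by rewrite divr_gt0// subr_gt0.
pose eta1 := eta / 4 / m.+1%:R; have eta10 : 0 < eta1 by rewrite !divr_gt0.
have [Psi hPsi] := choice (fun j =>
  let: ex_intro2 g ag h := hPhi j del eta1 del0 eta10 in ex_intro _ g (conj ag h)).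
have [T0 hT0] := choice (fun j => proj2 (hPsi j)).
pose Ej j T := [set tau | 0 <= tau <= T /\
  exists2 s, K s & del < normc (Phi j tau s - Psi j tau s)].
have Ejsub j T : Ej j T `<=` `[0, T] by move=> tau [tT _]; rewrite /= in_itv.
pose E T := [set tau : R | exists2 j, (j < m)%N & exists2 i : 'I_m, val i = j & Ej i T tau].
pose Tm := \sum_j `|T0 j| + 1.
have Tm0 : 0 < Tm by rewrite ltr_wpDl// sumr_ge0.
have Tmj j : T0 j <= Tm.
  rewrite /Tm (bigD1 j)//= (le_trans (ler_norm _))// -addrA lerDl addr_ge0// sumr_ge0//.
have Esub T : E T `<=` `[0, T] by move=> tau [j _ [i _ /Ejsub]].
have volE T : Tm <= T -> vol (E T) <= eta / 4 * T.
  move=> TmT; have T00 : 0 < T := lt_le_trans Tm0 TmT.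
  rewrite (@le_trans _ _ (m%:R * (eta1 * T)))//; last first.
    rewrite mulrA ler_wpM2r ?(ltW T00)// /eta1 mulrCA ler_piMr//; first by rewrite divr_ge0// ltW.
    by rewrite ler_pdivrMr// mul1r ler_nat.
  apply: (@vol_cover_le _ _ (fun j => [set tau | exists2 i : 'I_m, val i = j & Ej i T tau]) m 0 T) => //.
    by move=> j jm tau [i _ /Ejsub].
  move=> j jm; rewrite (@le_trans _ _ (vol (Ej (Ordinal jm) T)))//.
    apply: vol_le (Ejsub _ _).
    by move=> tau [i ij]; congr (Ej _ T tau); apply/val_inj.
  by apply: (hT0 (Ordinal jm)); exact: le_trans TmT.
have good T tau j s : 0 <= tau <= T -> ~ E T tau -> K s ->
    normc (Phi j tau s - Psi j tau s) <= del.
  move=> t0T nE Ks; rewrite leNgt; apply/negP => h; apply: nE.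
  by exists (val j); [exact: ltn_ord|exists j => //; split => //; exists s].
have sub1 y T : close_set Phi y T `<=` close_set Psi (y + 2 * del) T `|` E T.
  move=> tau [tT Qt]; have [|nE] := pselect (E T tau); first by right.
  left; split => // j k s Ks.
  have h1 := good _ _ j s tT nE Ks; have h2 := good _ _ k s tT nE Ks.
  rewrite (le_trans (normc_sub_trans (Phi j tau s) _ _))// [X in X + _]normc_sub.
  have h3 := normc_sub_trans (Phi k tau s) (Phi j tau s) (Psi k tau s).
  have h4 := Qt j k s Ks; lra.
have sub2 y T : close_set Psi y T `<=` close_set Phi (y + 2 * del) T `|` E T.
  move=> tau [tT Qt]; have [|nE] := pselect (E T tau); first by right.
  left; split => // j k s Ks.
  have h1 := good _ _ j s tT nE Ks; have h2 := good _ _ k s tT nE Ks.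
  rewrite (le_trans (normc_sub_trans (Psi j tau s) _ _))//.
  have h3 := normc_sub_trans (Psi k tau s) (Psi j tau s) (Phi k tau s).
  rewrite (normc_sub (Psi k tau s)) in h3.
  have h4 := Qt j k s Ks; lra.
have [l l0 hl] := @close_set_almost_periodic Psi (e + 2 * del) del del0 (fun j => proj1 (hPsi j)).
exists (Num.max Tm (16 * l / eta)) => T; rewrite ge_max => /andP[TmT lT].
have Tpos : 0 < T := lt_le_trans Tm0 TmT.
exists (Num.max Tm (8 * (T + 2 * l) / eta)) => T'; rewrite ge_max => /andP[TmT' lT'].
have T'pos : 0 < T' := lt_le_trans Tm0 TmT'.
have h1 : vol (close_set Phi e T') <= vol (close_set Psi (e + 2 * del) T') + vol (E T').
  by apply: volU_le (sub1 _ _) _ (Esub _); exact: subset_itv0.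
have h2 := hl _ _ Tpos (ltW T'pos).
have h3 : vol (close_set Psi (e + 2 * del + 2 * del) T) <= vol (close_set Phi e' T) + vol (E T).
  have -> : e' = e + 2 * del + 2 * del + 2 * del by rewrite /del; field.
  by apply: volU_le (sub2 _ _) _ (Esub _); exact: subset_itv0.
have h4 := volE _ TmT; have h5 := volE _ TmT'.
have h6 : vol (close_set Psi (e + 2 * del + 2 * del) T) <= T.
  rewrite (le_trans (vol_le (@subset_itv0 _ _) (@subset_refl _ _)))// vol_itv ?subr0//.
  exact: ltW.
set A := vol (close_set Phi e T') in h1 *; set B := vol (close_set Phi e' T) in h3 *.
move: h1 h2 h3 h4 h5 h6; set V := vol (close_set Psi (_ + _ + _) T).
set V' := vol (close_set Psi _ T').
move=> h1 h2 h3 h4 h5 h6.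
have V0 : 0 <= V by exact: vol_ge0.
rewrite mulrC ler_pdivrMr//.
have hT : 2 * l <= eta / 8 * T by move: lT; rewrite ler_pdivrMr//; lra.
have hT' : T + 2 * l <= eta / 8 * T' by move: lT'; rewrite ler_pdivrMr//; lra.
have h7 : T' / T * (V + 2 * l) <= T' / T * (B + eta / 4 * T + eta / 8 * T).
  rewrite ler_wpM2l ?divr_ge0 ?(ltW Tpos) ?(ltW T'pos)//; lra.
have h8 : T' / T * (B + eta / 4 * T + eta / 8 * T) = T^-1 * B * T' + (eta / 4 + eta / 8) * T'.
  by field; rewrite gt_eqF.
have h9 : V' <= T^-1 * B * T' + (eta / 4 + eta / 8) * T' + eta / 8 * T'.
  rewrite (le_trans h2)// mulrDl mul1r -h8 lerD//; lra.
rewrite mulrDl; lra.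
Qed.

End Comparison.

Section ExceptionalCells.
Context {R : realType}.
Implicit Types (s w : R[i]) (T d h : R).

Lemma vol_large_dpoly_le (c : nat -> R[i]) (K : set R[i]) (I : finType)
    (kap : R[i] -> I) N Y d T h (B rho alpha del : R) :
  (forall n, normc (c n) <= B) -> (N <= Y)%N -> (0 < Y)%N -> d != 0 -> 0 < T -> 0 < h -> 0 < rho ->
  0 < del ->
  (forall s, K s -> alpha <= complex.Re s - rho <= 1) ->
  (forall s s', K s -> K s' -> kap s = kap s' -> normc (s - s') <= rho / 4) ->
  `|d| * h <= rho / 4 -> `|d| * h * ln Y%:R <= 1 ->
  vol [set tau | 0 <= tau <= T /\
    exists2 s, K s & del < normc (dpoly c N Y (s + (0 +i* (d * tau))))] <=
  #|I|%:R * (4 * B ^+ 2 / del ^+ 2) *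
  ((T + h) * \sum_(N <= n < Y) n.+1%:R `^ (- (2 * alpha)) +
   4 / (cos 1 * `|d|) * (Y%:R `^ (1 - alpha) * harmonic_sum Y) ^+ 2).
Proof.
move=> cB NY Y0 d0 T0 h0 rho0 del0 Kal Kkap dh dhY.
set A := [set tau | _ /\ _]; set S := \sum_(N <= n < Y) _.
set H := (_ * harmonic_sum Y) ^+ 2.
have cos0 := @cos1_gt0 R; have d0' : 0 < `|d| by rewrite normr_gt0.
have S0 : 0 <= S by rewrite sumr_ge0// => n _; exact: powR_ge0.
have H0 : 0 <= H by exact: sqr_ge0.
have B0 : 0 <= B := le_trans (normc_ge0 _) (cB 0%N).
have R0 : 0 <= #|I|%:R * (4 * B ^+ 2 / del ^+ 2) *
    ((T + h) * S + 4 / (cos 1 * `|d|) * H).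
  rewrite mulr_ge0// ?addr_ge0//.
    by rewrite mulr_ge0// divr_ge0 ?sqr_ge0// mulr_ge0// sqr_ge0.
    by rewrite mulr_ge0// ltW// addr_gt0.
  by rewrite mulr_ge0// divr_ge0// mulr_ge0// ltW.
have [[s0 Ks0]|K0] := pselect (exists s, K s); last first.
  rewrite (_ : A = set0) ?vol0//; apply/seteqP; split => // tau [_ [s Ks _]].
  by apply: K0; exists s.
pose sc i := xget s0 [set s | K s /\ kap s = i].
have Ksc i : K (sc i) by rewrite /sc; case: xgetP => // s _ [].
have kapsc s : K s -> kap (sc (kap s)) = kap s.
  by move=> Ks; rewrite /sc; case: xgetP => [x _ []//|/(_ s)]; case.
pose P s := dpoly c N Y s; pose theta := d * h.
pose pt i j w := sc i + (0 +i* (theta * j%:R)) + w.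
pose w i (j : nat) := xget 0 [set w | normc w <= rho / 2 /\ del < normc (P (pt i j w))].
have wr i j : normc (w i j) <= rho / 2.
  rewrite /w; case: xgetP => [x _ []//|_]; rewrite Normc.normc0 divr_ge0// ltW//.
pose v j := h / del ^+ 2 * \sum_i normc (P (pt i j (w i j))) ^+ 2.
have hd0 : 0 <= h / del ^+ 2 by rewrite divr_ge0 ?sqr_ge0// ltW.
have v0 j : 0 <= v j by rewrite mulr_ge0// sumr_ge0// => i _; exact: sqr_ge0.
pose J := (Num.truncn (T / h)).+1.
pose F (j : nat) := [set tau | A tau /\ j%:R * h <= tau <= j.+1%:R * h].
have Fcell j : F j `<=` `[j%:R * h, j.+1%:R * h] by move=> tau []; rewrite /= in_itv.
have Ascov : A `<=` [set tau | exists2 j, (j < J)%N & F j tau].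
  move=> tau Atau; have [/andP[t0 tT] _] := Atau.
  have tT0 : 0 <= tau / h by rewrite divr_ge0// ltW.
  exists (Num.truncn (tau / h)); first by rewrite ltnS le_truncn// ler_pM2r ?invr_gt0.
  split => //; apply/andP; split; first by rewrite -ler_pdivlMr// truncn_le.
  by rewrite -ler_pdivrMr// ltW// truncnS_gt.
have Fv j : (j < J)%N -> vol (F j) <= v j.
  move=> jJ; have [[tau Ft]|Fn] := pselect (exists tau, F j tau); last first.
    rewrite (_ : F j = set0) ?vol0//; apply/seteqP; split => // tau Ft.
    by apply: Fn; exists tau.
  have vcell : vol (F j) <= h.
    rewrite (le_trans (vol_le (@Fcell j) (@subset_refl _ _)))// vol_itv.
      by rewrite -natr1 mulrDl mul1r [_ + h]addrC addrK.
    by rewrite ler_wpM2r ?(ltW h0)// ler_nat.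
  rewrite (le_trans vcell)//.
  have [[_ [s Ks ls]] /andP[jt tj]] := Ft.
  pose i := kap s; pose w' := s - sc i + (0 +i* (d * (tau - j%:R * h))).
  have ptE : pt i j w' = s + (0 +i* (d * tau)).
    rewrite /pt /w' /theta; apply/eqP; rewrite eq_complex.
    by case: (sc i) => x1 x2; case: (s) => y1 y2 /=; apply/andP; split; apply/eqP; ring.
  have w'r : normc w' <= rho / 2.
    rewrite /w' (le_trans (normcD_le _ _))// (_ : rho / 2 = rho / 4 + rho / 4); last by field.
    rewrite lerD//; first by apply: Kkap => //; rewrite /i kapsc.
    rewrite (le_trans (normc_le_ReIm _))//= normr0 add0r normrM (le_trans _ dh)//.
    rewrite ler_wpM2l// ger0_norm ?subr_ge0// lerBlDl.
    by move: tj; rewrite -natr1 mulrDl mul1r.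
  have big : del < normc (P (pt i j (w i j))).
    rewrite /w; case: xgetP => [x _ []//|/(_ w')]; case; split => //.
    by rewrite ptE.
  rewrite /v (bigD1 i)//= mulrDr (@le_trans _ _ (h / del ^+ 2 * del ^+ 2))//.
    by rewrite divfK// expf_neq0// gt_eqF.
  rewrite -[leLHS]addr0 lerD//.
    by rewrite ler_wpM2l// lerXn2r ?nnegrE ?normc_ge0 ?(ltW del0) ?(ltW big).
  by rewrite mulr_ge0// sumr_ge0// => i' _; exact: sqr_ge0.
have Fab j : (j < J)%N -> F j `<=` `[0, T].
  by move=> _ tau [[t0T _] _]; rewrite /= in_itv.
rewrite (le_trans (vol_cover_sum_le Ascov Fab Fv))// -mulr_sumr exchange_big /=.
pose X := 4 * B ^+ 2 * (J%:R * S + 4 / (cos 1 * `|theta|) * H).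
have th0 : theta != 0 by rewrite mulf_neq0// gt_eqF.
have thE : `|theta| = `|d| * h by rewrite normrM (gtr0_norm h0).
rewrite (@le_trans _ _ (h / del ^+ 2 * \sum_(i in I) X))//.
  rewrite ler_wpM2l//; apply: ler_sum => i _.
  have /andP[al1 al2] := Kal _ (Ksc i).
  rewrite (le_trans (mean_square_disc J cB NY rho0 al2 th0 _ (wr i)))//; first by rewrite thE.
  rewrite /X ler_wpM2l ?mulr_ge0 ?sqr_ge0// lerD//.
    rewrite ler_wpM2l//; apply: ler_sum => n _.
    by rewrite ler_powR ?ler1n// lerN2 ler_wpM2l.
  rewrite ler_wpM2l ?divr_ge0 ?mulr_ge0 ?(ltW cos0)//.
  have hs0 : 0 <= harmonic_sum Y :> R by rewrite /harmonic_sum sumr_ge0// => k _; rewrite invr_ge0.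
  rewrite lerXn2r ?nnegrE ?mulr_ge0 ?powR_ge0// ler_wpM2r//.
  by rewrite ler_powR ?ler1n// lerD2l lerN2.
rewrite sumr_const -[_ *+ _]mulr_natl -/(#|I|).
have hJ : h * J%:R <= T + h.
  rewrite /J -natr1 mulrDr mulr1 lerD2r mulrC -ler_pdivlMr// truncn_le.
  by rewrite divr_ge0// ltW.
have -> : h / del ^+ 2 * (#|I|%:R * X) =
  #|I|%:R * (4 * B ^+ 2 / del ^+ 2) * (h * J%:R * S + 4 / (cos 1 * `|d|) * H).
  rewrite /X thE; field; rewrite (gt_eqF h0) (gt_eqF d0') (gt_eqF del0) (gt_eqF cos0)//.
rewrite ler_wpM2l//; first by rewrite mulr_ge0// divr_ge0 ?sqr_ge0// mulr_ge0// sqr_ge0.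
by rewrite lerD2r ler_wpM2r.
Qed.

End ExceptionalCells.

Section Approximation.
Context {R : realType}.
Implicit Types (s w : R[i]) (T d : R).

Lemma harmonic_sum_le (eps : R) Y : 0 < eps ->
  harmonic_sum Y <= (1 + eps^-1) * Y%:R `^ eps.
Proof.
move=> eps0; have p1 : 1 < 1 + eps by rewrite ltrDl.
rewrite (@le_trans _ _ ((\sum_(0 <= k < Y) k.+1%:R `^ (- (1 + eps))) * Y%:R `^ eps))//.
  rewrite big_mkord mulr_suml; apply: ler_sum => k _.
  have -> : k.+1%:R^-1 = k.+1%:R `^ (- (1 + eps)) * k.+1%:R `^ eps :> R.
    rewrite -powRD ?pnatr_eq0 ?implybT// opprD subrK powRN powRr1//.
  rewrite ler_wpM2l ?powR_ge0// ge0_ler_powR ?nnegrE ?(ltW eps0)//.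
  by rewrite ler_nat.
rewrite ler_wpM2r ?powR_ge0// (le_trans (pseries_le _ _ p1))// powR1 mulr1.
by rewrite addrAC subrr add0r.
Qed.

Lemma finite_net (K : set R[i]) (C0 e : R) : 0 < e ->
  (forall s, K s -> normc s <= C0) ->
  exists (I : finType) (kap : R[i] -> I),
    forall s s', K s -> K s' -> kap s = kap s' -> normc (s - s') <= e.
Proof.
move=> e0 KC; have e20 : 0 < e / 2 by rewrite divr_gt0.
have [I [kap hkap]] := @bounded_coloring R C0 _ e20.
exists (I * I)%type, (fun s => (kap (complex.Re s), kap (complex.Im s))).
move=> s s' Ks Ks' [hr hi]; rewrite (le_trans (normc_le_ReIm _))// !raddfB [e]splitr.
rewrite lerD// hkap//.
- exact: (le_trans (normc_Re_le _) (KC _ Ks)).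
- exact: (le_trans (normc_Re_le _) (KC _ Ks')).
- exact: (le_trans (normc_Im_le _) (KC _ Ks)).
- exact: (le_trans (normc_Im_le _) (KC _ Ks')).
Qed.

Variables (K : set R[i]) (C0 rho : R) (Q : nat) (c : nat -> R[i]) (d : R).
Hypothesis KC : forall s, K s -> normc s <= C0.
Hypothesis rho0 : 0 < rho.
Hypothesis rho4 : rho <= 4^-1.
Hypothesis Krho : forall s, K s -> 2^-1 + 2 * rho <= complex.Re s <= 1.
Hypothesis pc : periodic0 Q c.
Hypothesis d0 : d != 0.

(* The exponent is larger than 1, so that the remainder after [cutoff T] terms is
   small up to height [T], and small enough for the mean square of the terms before
   it to be governed by the diagonal. *)
Definition cutoff T := (Num.truncn (T `^ (1 + rho / 2))).+1.

Lemma cutoff_gt T : T `^ (1 + rho / 2) < (cutoff T)%:R.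
Proof. exact: truncnS_gt. Qed.

Lemma cutoff_ge T : 1 <= T -> T <= (cutoff T)%:R.
Proof.
move=> T1; rewrite (le_trans _ (ltW (cutoff_gt T)))//.
by rewrite le1r_powR// lerDl divr_ge0// ltW.
Qed.

Lemma cutoff_le T : 1 <= T -> (cutoff T)%:R <= 2 * T `^ (1 + rho / 2).
Proof.
move=> T1; rewrite /cutoff -natr1 mulr_natl mulr2n lerD ?truncn_le ?powR_ge0//.
by rewrite (le_trans T1)// le1r_powR// lerDl divr_ge0// ltW.
Qed.

Lemma dseries_tail_small (del : R) : 0 < del -> exists T0, forall T, T0 <= T ->
  forall tau s, 0 <= tau <= T -> K s ->
  normc (dseries c (s + (0 +i* (d * tau))) - dpoly c 0 (cutoff T) (s + (0 +i* (d * tau))))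
  <= del.
Proof.
move=> del0; pose k := (Num.truncn (2 / rho)).+1.
have krho : 1 <= rho / 2 * k%:R.
  have h : 2 / rho < k%:R := truncnS_gt _.
  by move: h; rewrite ltr_pdivrMr// => h; lra.
have [C C0' H] := dseries_tail_le pc k.
pose A1 := `|C0| + 1 + `|d|; have A10 : 0 < A1 by rewrite ltr_wpDr// ltr_wpDl.
pose D := C * (k.+1%:R + A1 ^+ k.+1) + 1.
have D0 : 0 < D.
  by rewrite /D ltr_wpDl// mulr_ge0// addr_ge0// exprn_ge0// ltW.
have r20 : 0 < rho / 2 by rewrite divr_gt0.
have p20 : (0 : R) < 2^-1 by rewrite invr_gt0.
have [|T1 T10 hT1] := powRN_small r20 (e := A1^-1); first by rewrite invr_gt0.
have [|T2 T20 hT2] := powRN_small p20 (e := del / D); first by rewrite divr_gt0.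
exists (Num.max 1 (Num.max T1 T2)) => T; rewrite !ge_max => /and3P[T_1 TT1 TT2] tau s.
move=> /andP[t0 tT] Ks; have T0 : 0 < T by rewrite (lt_le_trans ltr01).
set Y := cutoff T; set z := s + _; pose A := A1 * T.
have z2 : 2^-1 <= complex.Re z.
  have /andP[h _] := Krho Ks; rewrite /z raddfD /= addr0 (le_trans _ h)// lerDl.
  by rewrite mulr_ge0// ltW.
have zA : normc z + 1 <= A.
  have h1 : normc (0 +i* (d * tau)) <= `|d| * T.
    rewrite (le_trans (normc_le_ReIm _))//= normr0 add0r normrM ler_wpM2l//.
    by rewrite ger0_norm.
  have h2 : normc s <= `|C0| * T.
    rewrite (le_trans (KC Ks))// (le_trans (ler_norm _))// ler_peMr//.
  rewrite /A /A1 !mulrDl mul1r.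
  have := normcD_le s (0 +i* (d * tau)); rewrite -/z; lra.
rewrite (le_trans (H _ _ Y z2 zA))//.
have Y0 : (0 : R) < Y.+1%:R by [].
have YT : T `^ (1 + rho / 2) <= Y.+1%:R.
  by rewrite (le_trans (ltW (cutoff_gt T)))// ler_nat.
have TE : T `^ (1 + rho / 2) = T * T `^ (rho / 2).
  by rewrite powRD ?(gt_eqF T0) ?implybT// powRr1// ltW.
set q := A / Y.+1%:R.
have q0 : 0 <= q by rewrite /q divr_ge0// mulr_ge0// ltW.
have qle : q <= A1 * T `^ (- (rho / 2)).
  rewrite /q ler_pdivrMr// /A -mulrA ler_wpM2l ?(ltW A10)//.
  rewrite powRN mulrC ler_pdivlMr ?powR_gt0// -TE//.
have q1 : q <= 1.
  rewrite (le_trans qle)// (le_trans (ler_wpM2l (ltW A10) (hT1 _ TT1)))//.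
  by rewrite divff// gt_eqF.
have S1 : \sum_(j < k.+1) q ^+ j <= k.+1%:R.
  rewrite (@le_trans _ _ (\sum_(j < k.+1) 1))//; last by rewrite sumr_const card_ord.
  by apply: ler_sum => j _; rewrite exprn_ile1.
have S2 : A * q ^+ k <= A1 ^+ k.+1.
  rewrite (@le_trans _ _ (A1 * T * (A1 ^+ k * T^-1)))//.
    rewrite ler_wpM2l ?mulr_ge0 ?(ltW A10) ?(ltW T0)//.
    rewrite (@le_trans _ _ ((A1 * T `^ (- (rho / 2))) ^+ k))//.
      by rewrite lerXn2r ?nnegrE// mulr_ge0 ?powR_ge0 ?(ltW A10).
    rewrite exprMn ler_wpM2l ?exprn_ge0 ?(ltW A10)// -powR_mulrn ?powR_ge0// -powRrM.
    rewrite -[leRHS]powR_inv1 ?(ltW T0)// ler_powR// mulNr lerN2//.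
  rewrite exprS; apply/eqW; field; exact: lt0r_neq0.
rewrite -mulrA (@le_trans _ _ (C * ((del / D) * (k.+1%:R + A1 ^+ k.+1))))//.
  rewrite ler_wpM2l// ler_pM ?powR_ge0//.
  - by rewrite addr_ge0 ?mulr_ge0 ?exprn_ge0 ?sumr_ge0 ?(ltW A10) ?(ltW T0)// => i _; rewrite exprn_ge0.
  - rewrite (le_trans _ (hT2 _ TT2))// powRN_le ?(ltW p20)//.
    by rewrite (le_trans (cutoff_ge T_1))// ler_nat.
  - by rewrite lerD.
have -> : C * (del / D * (k.+1%:R + A1 ^+ k.+1)) = del / D * (D - 1) by rewrite /D; ring.
by rewrite mulrBr divfK ?gt_eqF// gerBl mulr1 divr_ge0// ltW.
Qed.

Lemma vol_large_middle_small (del eta : R) : 0 < del -> 0 < eta ->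
  exists N T0, forall T, T0 <= T -> (N <= cutoff T)%N /\
  vol [set tau | 0 <= tau <= T /\ exists2 s, K s &
    del < normc (dpoly c N (cutoff T) (s + (0 +i* (d * tau))))] <= eta * T.
Proof.
move=> del0 eta0; have [B B0 cB] := periodic0_bounded pc.
have rho40 : 0 < rho / 4 by rewrite divr_gt0.
have [I [kap hkap]] := finite_net rho40 KC.
have d0' : 0 < `|d| by rewrite normr_gt0.
have cos0 := @cos1_gt0 R.
pose C1 := #|I|%:R * (4 * B ^+ 2 / del ^+ 2) + 1.
have C10 : 0 < C1.
  by rewrite /C1 ltr_wpDl// mulr_ge0// divr_ge0 ?sqr_ge0// mulr_ge0// sqr_ge0.
pose C2 := 4 / (cos 1 * `|d|); have C20 : 0 < C2 by rewrite divr_gt0// mulr_gt0.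
pose C3 := 2 * (1 + (rho / 4)^-1) ^+ 2.
have C30 : 0 < C3 by rewrite mulr_gt0// exprn_gt0// addr_gt0// invr_gt0.
pose C4 := 1 + (2 * rho)^-1.
have C40 : 0 < C4 by rewrite addr_gt0// invr_gt0 mulr_gt0.
have rho20 : 0 < 2 * rho by rewrite mulr_gt0.
have [|T1 T10 hT1] := powRN_small rho20 (e := eta / (4 * C1 * C4)).
  by rewrite divr_gt0// mulr_gt0// mulr_gt0.
have [|T2 T20 hT2] := powRN_small rho0 (e := eta / (2 * C1 * C2 * C3)).
  by rewrite divr_gt0// mulr_gt0// mulr_gt0// mulr_gt0.
pose N := Num.truncn T1; pose h0 := rho / 4 / `|d|.
exists N, (Num.max (Num.max 1 T1) (Num.max T2 h0)) => T.
rewrite !ge_max => /andP[/andP[T_1 TT1] /andP[TT2 Th0]].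
have T0 : 0 < T by rewrite (lt_le_trans ltr01).
set Y := cutoff T; have YT : T <= Y%:R := cutoff_ge T_1.
have NY : (N <= Y)%N.
  rewrite -(ler_nat R) (le_trans _ YT)// (le_trans _ TT1)// truncn_le ltW//.
split => //; have lnY : 0 <= ln Y%:R :> R by rewrite ln_ge0// ler1n.
have lnY1 : 0 < 1 + ln Y%:R :> R by rewrite ltr_wpDr.
pose h := h0 / (1 + ln Y%:R).
have h00 : 0 < h0 by rewrite divr_gt0.
have hpos : 0 < h by rewrite divr_gt0.
have hh0 : h <= h0.
  by rewrite /h ler_pdivrMr// ler_peMr ?(ltW h00)// lerDl.
have dh0 : `|d| * h0 = rho / 4 by rewrite /h0 mulrC divfK// gt_eqF.
have dh : `|d| * h <= rho / 4 by rewrite -dh0 ler_wpM2l// ltW.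
have dhY : `|d| * h * ln Y%:R <= 1.
  rewrite /h mulrA dh0 -mulrA [X in _ * X]mulrC.
  rewrite (@le_trans _ _ (rho / 4 * 1))//.
    by rewrite ler_wpM2l ?(ltW rho40)// ler_pdivrMr// mul1r lerDr.
  by move: rho4; lra.
have Kal s : K s -> 2^-1 + rho <= complex.Re s - rho <= 1.
  by move=> /Krho /andP[h1 h2]; apply/andP; split; move: rho0; lra.
rewrite (le_trans (vol_large_dpoly_le cB NY _ d0 T0 hpos rho0 del0 Kal hkap dh dhY))//.
set S := \sum_(N <= n < Y) _; set H := (_ * harmonic_sum Y) ^+ 2.
have SN : S <= eta / (4 * C1).
  have p1 : 1 < 2 * (2^-1 + rho) by rewrite mulrDr divff// ltrDl.
  rewrite (le_trans (pseries_le _ _ p1))//.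
  have -> : 2 * (2^-1 + rho) - 1 = 2 * rho by field.
  have -> : 1 - 2 * (2^-1 + rho) = - (2 * rho) by field.
  rewrite -/C4 (@le_trans _ _ (C4 * (eta / (4 * C1 * C4))))//.
    by rewrite ler_wpM2l ?(ltW C40)// hT1// ltW// truncnS_gt.
  by apply/eqW; field; rewrite (gt_eqF C10) (gt_eqF C40).
have HT : H <= C3 * (T * T `^ (- rho)).
  have r40 : 0 < rho / 4 by [].
  pose mu := 1 - 3 / 2 * rho.
  have mu0 : 0 <= mu by rewrite /mu; move: rho4; lra.
  rewrite (@le_trans _ _ ((Y%:R `^ (1 - (2^-1 + rho)) * ((1 + (rho / 4)^-1) * Y%:R `^ (rho / 4))) ^+ 2))//.
    have hs0 : 0 <= harmonic_sum Y :> R.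
      by rewrite /harmonic_sum sumr_ge0// => i _; rewrite invr_ge0.
    have hsle := harmonic_sum_le Y r40.
    rewrite /H lerXn2r ?nnegrE ?mulr_ge0 ?powR_ge0 ?addr_ge0 ?invr_ge0 ?(ltW r40)//.
    by rewrite ler_wpM2l ?powR_ge0.
  have Y0 : Y%:R != 0 :> R by rewrite pnatr_eq0.
  have -> : (Y%:R `^ (1 - (2^-1 + rho)) * ((1 + (rho / 4)^-1) * Y%:R `^ (rho / 4))) ^+ 2 =
    (1 + (rho / 4)^-1) ^+ 2 * Y%:R `^ mu.
    have -> : Y%:R `^ mu = (Y%:R `^ (1 - (2^-1 + rho)) * Y%:R `^ (rho / 4)) ^+ 2 :> R.
      rewrite -powRD ?Y0 ?implybT// expr2 -powRD ?Y0 ?implybT//; congr (_ `^ _).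
      by rewrite /mu; field.
    by ring.
  rewrite /C3 -mulrA mulrCA ler_wpM2l ?sqr_ge0//.
  rewrite (@le_trans _ _ ((2 * T `^ (1 + rho / 2)) `^ mu))//.
    by rewrite ge0_ler_powR ?nnegrE ?mulr_ge0 ?powR_ge0// cutoff_le.
  rewrite powRM ?powR_ge0// -powRrM ler_pM ?powR_ge0//.
    rewrite -[leRHS]powRr1// ler_powR ?ler1n// /mu; move: rho0; lra.
  have -> : T * T `^ (- rho) = T `^ (1 - rho).
    by rewrite powRD ?(gt_eqF T0) ?implybT// powRr1// ltW.
  rewrite ler_powR// /mu.
  have : 0 <= rho * rho by rewrite mulr_ge0// ltW.
  by nra.
have S0 : 0 <= S by rewrite sumr_ge0// => n _; exact: powR_ge0.
have H0 : 0 <= H by exact: sqr_ge0.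
rewrite (@le_trans _ _ (C1 * ((T + T) * (eta / (4 * C1)) +
    C2 * (C3 * (T * (eta / (2 * C1 * C2 * C3)))))))//; last first.
  by apply/eqW; field; rewrite (gt_eqF C10) (gt_eqF C20) (gt_eqF C30).
apply: ler_pM.
- by rewrite mulr_ge0// divr_ge0 ?sqr_ge0// mulr_ge0// sqr_ge0.
- have TSh : 0 <= (T + h) * S by rewrite mulr_ge0// addr_ge0// ltW.
  by rewrite addr_ge0// mulr_ge0// ltW.
- by rewrite /C1 lerDl.
rewrite lerD//.
  by rewrite ler_pM ?addr_ge0 ?(ltW T0) ?(ltW hpos)// lerD2l (le_trans hh0).
rewrite -/C2 ler_wpM2l ?(ltW C20)// (le_trans HT)// ler_wpM2l ?(ltW C30)//.
by rewrite ler_wpM2l ?(ltW T0)// hT2.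
Qed.

End Approximation.

Section ApproximableQuotient.
Context {R : realType}.
Implicit Types (s w z : R[i]) (T d : R).

Definition twist_factor z : R[i] := 1 - 2 * cpown 2 (- z).

Lemma cpown_vertical n s (x : R) :
  cpown n (- (s + (0 +i* x))) = cpown n (- s) * cexp (0 +i* (- ln n%:R * x)).
Proof.
rewrite /cpown -cexpD; congr cexp; rewrite opprD mulrDl; congr (_ + _).
by apply/eqP; rewrite eq_complex /=; apply/andP; split; apply/eqP; ring.
Qed.

Lemma normc_cpown_le1 n s : (0 < n)%N -> 0 <= complex.Re s -> normc (cpown n (- s)) <= 1.
Proof.
move=> n0 s0; rewrite normc_cpown// raddfN /= powRN invf_le1 ?powR_gt0 ?ltr0n//.
by rewrite -[X in X <= _](powRr0 n%:R) ler_powR ?ler1n.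
Qed.

Lemma approximable_quotient (K : set R[i]) (C0 rho sigma : R) Q (c : nat -> R[i]) d :
  (forall s, K s -> normc s <= C0) -> 0 < rho -> rho <= 4^-1 ->
  (forall s, K s -> 2^-1 + 2 * rho <= complex.Re s <= sigma) -> sigma < 1 ->
  periodic0 Q c -> d != 0 ->
  approximable K (fun tau s => dseries c (s + (0 +i* (d * tau))) /
                               twist_factor (s + (0 +i* (d * tau)))).
Proof.
move=> KC rho0 rho4 Ksig sig1 pc d0 del eta del0 eta0.
have [B B0 cB] := periodic0_bounded pc.
have Krho s : K s -> 2^-1 + 2 * rho <= complex.Re s <= 1.
  by move=> /Ksig/andP[-> h]; rewrite (le_trans h)// ltW.
have K0 s : K s -> 0 <= complex.Re s.
  by move=> /Ksig/andP[h _]; move: rho0 h; lra.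
pose k0 : R := 2 `^ (1 - sigma) - 1.
have k00 : 0 < k0.
  by rewrite subr_gt0 -[X in X < _](powRr0 2) /powR gt_eqF// ltr_expR mul0r mulr_gt0 ?subr_gt0// ln_gt0// ltr1n.
have Re_v s (x : R) : complex.Re (s + (0 +i* x)) = complex.Re s by rewrite raddfD /= addr0.
have Gge t s : K s -> k0 <= normc (twist_factor (s + (0 +i* (d * t)))).
  by move=> /Ksig/andP[_ h]; apply: normc_twist_factor_ge; rewrite Re_v.
have dk0 : 0 < del * k0 / 2 by rewrite divr_gt0// mulr_gt0.
have [N [T1 hT1]] := vol_large_middle_small KC rho0 rho4 Krho pc d0 dk0 eta0.
have [T2 hT2] := dseries_tail_small d KC rho0 Krho pc dk0.
have cle1 n s (x : R) : (0 < n)%N -> K s -> normc (cpown n (- (s + (0 +i* x)))) <= 1.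
  by move=> n0 Ks; apply: normc_cpown_le1 => //; rewrite Re_v K0.
exists (fun tau s => dpoly c 0 N (s + (0 +i* (d * tau))) / twist_factor (s + (0 +i* (d * tau)))).
  apply: (@almost_periodic_div _ _ _ _ (N%:R * B + 3) k0) => //.
  - by rewrite ltr_wpDl// mulr_ge0.
  - move=> t s Ks; rewrite /dpoly (le_trans (normc_sum _ _ _))//.
    rewrite (@le_trans _ _ (\sum_(0 <= n < N) B))//.
      apply: ler_sum => n _; rewrite Normc.normcM -[leRHS]mulr1.
      by rewrite ler_pM ?normc_ge0 ?cle1.
    by rewrite sumr_const_nat subn0 mulr_natl lerDl.
  - move=> t s Ks; rewrite /twist_factor (le_trans (normcB_le _ _))//.
    rewrite Normc.normc1 Normc.normcM normc_nat.
    have := cle1 2%N s (d * t) isT Ks; have : 0 <= N%:R * B by rewrite mulr_ge0.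
    by move: (N%:R * B) (normc _) => x y; lra.
  - rewrite (_ : (fun _ _ => _) = (fun t s => \sum_(n < N)
      (c n * cpown n.+1 (- s)) * cexp (0 +i* (- ln n.+1%:R * d * t)))); last first.
      apply/funext => t; apply/funext => s; rewrite /dpoly big_mkord.
      by apply: eq_bigr => n _; rewrite cpown_vertical !mulrA.
    apply: (@almost_periodic_sum _ _ (fun n t s =>
      (c n * cpown n.+1 (- s)) * cexp (0 +i* (- ln n.+1%:R * d * t)))) => n.
    apply: almost_periodic_exp; exists (B + 1); first by rewrite ltr_wpDl.
    move=> s Ks; rewrite Normc.normcM (@le_trans _ _ (B * 1))//.
      by rewrite ler_pM ?normc_ge0// normc_cpown_le1// K0.
    by rewrite mulr1 lerDl.
  - rewrite (_ : (fun _ _ => _) = (fun t s => 1 +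
      (- 2 * cpown 2 (- s)) * cexp (0 +i* (- ln 2%:R * d * t)))); last first.
      apply/funext => t; apply/funext => s; rewrite /twist_factor cpown_vertical.
      by rewrite (mulrA (- ln 2%:R)) mulrA -mulNr -mulNr.
    apply: almost_periodicD; first exact: almost_periodic_cst.
    apply: almost_periodic_exp; exists 2 => // s Ks.
    rewrite Normc.normcM normc_opp normc_nat -[leRHS]mulr1 ler_wpM2l//.
    by rewrite normc_cpown_le1// K0.
exists (Num.max T1 T2) => T; rewrite ge_max => /andP[/hT1[NY hvol] /hT2 htail].
rewrite (le_trans _ hvol)//; apply: vol_le (@subset_itv0 _ _ _).
move=> tau [tT [s Ks ls]]; split => //; exists s => //.
have := htail _ _ tT Ks; set z := s + _ in ls *; set Y := cutoff _ _ in NY *.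
have Gz : k0 <= normc (twist_factor z) := Gge tau s Ks.
have Gz0 : 0 < normc (twist_factor z) := lt_le_trans k00 Gz.
have {}ls : del * k0 < normc (dseries c z - dpoly c 0 N z).
  move: ls; rewrite -mulrBl Normc.normcM Normc.normcV ltr_pdivlMr//; apply: le_lt_trans.
  by rewrite ler_wpM2l// ltW.
have := normc_sub_trans (dpoly c 0 Y z) (dseries c z) (dpoly c 0 N z).
have -> : dpoly c 0 Y z - dpoly c 0 N z = dpoly c N Y z.
  by rewrite (dpoly_cat c z (leq0n N) NY) addrAC subrr add0r.
lra.
Qed.

Lemma compact_strip (K : set (CC R)) : compact K ->
  K `<=` [set s | 2^-1 < complex.Re s < 1] ->
  exists rho sigma C0 : R, [/\ 0 < rho, rho <= 4^-1, sigma < 1,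
    forall s, K s -> 2^-1 + 2 * rho <= complex.Re s <= sigma &
    forall s, K s -> normc s <= C0].
Proof.
rewrite compact_cover => cK Ks.
pose U (n : nat) : set (CC R) := [set s | [/\ 2^-1 + n.+1%:R^-1 < complex.Re s,
  complex.Re s < 1 - n.+1%:R^-1 & normc s < n.+1%:R]].
have oU n : open (U n).
  rewrite openE => s [s1 s2 s3]; apply: (proj2 (nbhs_normP (s : CC R) (U n))).
  pose e := Num.min (Num.min (complex.Re s - (2^-1 + n.+1%:R^-1))
    (1 - n.+1%:R^-1 - complex.Re s)) (n.+1%:R - normc s).
  have e0 : 0 < e by rewrite !lt_min !subr_gt0 s1 s2.
  exists e%:C; first by rewrite /= ltcR.
  move=> z /=; rewrite normc_def.
  have -> : (Num.sqrt (complex.Re (s - z) ^+ 2 + complex.Im (s - z) ^+ 2))%:C =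
    (normc (s - z))%:C by case: (s - z).
  rewrite ltcR !lt_min => /andP[/andP[h1 h2] h3].
  have ReB : complex.Re (s - z) = complex.Re s - complex.Re z by rewrite raddfB.
  have := normc_Re_le (s - z); rewrite ReB ler_norml => /andP[h4 h5].
  have h6 := normc_le_add z s; rewrite normc_sub in h6.
  have aux1 (v rs rz a : R) : v < rs - a -> rs - rz <= v -> a < rz by lra.
  have aux2 (v rs rz b : R) : v < b - rs -> - v <= rs - rz -> rz < b by lra.
  have aux3 (v ns nz b : R) : v < b - ns -> nz <= v + ns -> nz < b by lra.
  by split; [exact: aux1 h1 h5|exact: aux2 h2 h4|exact: aux3 h3 h6].
have Kcov : K `<=` cover setT U.
  move=> s sK; have /andP[s1 s2] := Ks _ sK.
  pose e := Num.min (complex.Re s - 2^-1) (1 - complex.Re s).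
  have e0 : 0 < e by rewrite lt_min !subr_gt0 s1.
  pose n := Num.truncn (Num.max e^-1 (normc s)).
  have : Num.max e^-1 (normc s) < n.+1%:R by exact: truncnS_gt.
  rewrite gt_max => /andP[h1 h2]; exists n => //.
  have : n.+1%:R^-1 < e by rewrite invf_plt ?posrE.
  have aux1 (a b r : R) : r < b - a -> a + r < b by lra.
  have aux2 (a b r : R) : r < b - a -> a < b - r by lra.
  by rewrite lt_min => /andP[h3 h4]; split => //; [exact: aux1 h3|exact: aux2 h4].
have [D _ KD] := cK _ setT U (fun n _ => oU n) Kcov.
pose M := (\max_(n <- finmap.enum_fset D) n)%N.
pose r : R := M.+1%:R^-1; have r0 : 0 < r by rewrite invr_gt0.
have KU s : K s -> U M s.
  move=> /KD[n nD [h1 h2 h3]].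
  have nD' : (n : nat) \in finmap.enum_fset D by exact: nD.
  have nM : (n <= M)%N by exact: (@leq_bigmax_seq _ _ xpredT (fun n => n) n nD' isT).
  have rn : r <= n.+1%:R^-1 by rewrite lef_pV2 ?posrE// ler_nat.
  have aux1 (a b x y : R) : x <= y -> a + y < b -> a + x < b by lra.
  have aux2 (a b x y : R) : x <= y -> a < b - y -> a < b - x by lra.
  split; [exact: aux1 rn h1|exact: aux2 rn h2|].
  by rewrite (lt_le_trans h3)// ler_nat.
exists (Num.min 4^-1 (r / 2)), (1 - r), M.+1%:R; split.
- by rewrite lt_min invr_gt0 divr_gt0// ltr0n.
- by rewrite ge_min lexx.
- by rewrite gtrBl.
- move=> s /KU[h1 h2 _]; apply/andP; split; last exact: ltW.
  have h3 : Num.min 4^-1 (r / 2) <= r / 2 by rewrite ge_min lexx orbT.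
  have aux (x b y : R) : x <= y / 2 -> 2^-1 + y < b -> 2^-1 + 2 * x <= b by lra.
  exact: aux h3 h1.
- by move=> s /KU[_ _]; exact: ltW.
Qed.

End ApproximableQuotient.

Section DirichletLFunctions.
Context {R : realType}.
Implicit Types (s z : R[i]) (chi : int -> R[i]) (K : set R[i]) (d : R).

Lemma approximable_cst K (g : R[i] -> R[i]) : approximable K (fun=> g).
Proof.
move=> del eta del0 eta0; exists (fun=> g); first exact: almost_periodic_cst.
exists 0 => T T0; rewrite (_ : [set tau | _] = set0) ?vol0.
  by rewrite mulr_ge0// ltW.
apply/seteqP; split => // tau [_ [s _]].
by rewrite subrr Normc.normc0 ltNge (ltW del0).
Qed.

Lemma approximable_eq K (f g : R -> R[i] -> R[i]) :
  (forall tau s, K s -> f tau s = g tau s) -> approximable K g -> approximable K f.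
Proof.
move=> fg hg del eta del0 eta0; have [h aph [T0 hT0]] := hg _ _ del0 eta0.
exists h => //; exists T0 => T /hT0; apply: le_trans; apply: vol_le (@subset_itv0 _ _ _).
by move=> tau [tT [s Ks]]; rewrite fg// => l; split => //; exists s.
Qed.

Lemma dirichletL_quotient q chi : is_dirichlet_character q chi ->
  dirichletL chi = (fun=> 0) \/
  forall z, 2^-1 < complex.Re z -> complex.Re z < 1 ->
    (dirichletL chi z : R[i]) = dseries (twist chi) z / twist_factor z.
Proof.
move=> hchi; rewrite /dirichletL; case: xgetP => [L _ hL|_]; [right|by left].
move=> z z2 z1.
have z1' : z != 1 by apply/eqP => e; move: z1; rewrite e /= ltxx.
have F0 : twist_factor z != 0.
  rewrite -normc_gt0 (lt_le_trans _ (normc_twist_factor_ge (lexx _)))//.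
  rewrite subr_gt0 -[X in X < _](powRr0 2) /powR gt_eqF// ltr_expR mul0r.
  by rewrite mulr_gt0 ?subr_gt0// ln_gt0// ltr1n.
by rewrite -(dirichletL_twist hchi hL z2 z1') -/(twist_factor z) mulrC mulKf.
Qed.

Section CompactStrip.
Variables (K : set R[i]) (rho sigma C0 : R).
Hypotheses (rho0 : 0 < rho) (rho4 : rho <= 4^-1) (sig1 : sigma < 1).
Hypothesis Ksig : forall s, K s -> 2^-1 + 2 * rho <= complex.Re s <= sigma.
Hypothesis KC : forall s, K s -> normc s <= C0.

Let Re_vertical s (x : R) : complex.Re (s + (0 +i* x)) = complex.Re s.
Proof. by rewrite raddfD /= addr0. Qed.

Lemma dirichletL_quotient_on q chi : is_dirichlet_character q chi ->
  dirichletL chi = (fun=> 0) \/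
  forall s x, K s -> (dirichletL chi (s + (0 +i* x)) : R[i]) =
    dseries (twist chi) (s + (0 +i* x)) / twist_factor (s + (0 +i* x)).
Proof.
move=> /dirichletL_quotient[->|H]; [by left|right => s x /Ksig/andP[h1 h2]].
by apply: H; rewrite Re_vertical; move: rho0 sig1; lra.
Qed.

Lemma dirichletL_approximable q chi d : is_dirichlet_character q chi ->
  approximable K (fun tau s => (dirichletL chi (s + (0 +i* (d * tau))) : R[i])).
Proof.
move=> hchi; have [->|H] := dirichletL_quotient_on hchi; first exact: approximable_cst.
have [->|d0] := eqVneq d 0.
  by under eq_fun do under eq_fun do rewrite mul0r; exact: approximable_cst.
apply: approximable_eq (approximable_quotient KC rho0 rho4 Ksig sig1 (twist_periodic0 hchi) d0).
by move=> tau s Ks; exact: H.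
Qed.

Lemma dirichletL_bounded q chi (x : R) : is_dirichlet_character q chi ->
  exists B, forall s, K s -> normc (dirichletL chi (s + (0 +i* x)) : R[i]) <= B.
Proof.
move=> hchi; have [->|H] := dirichletL_quotient_on hchi.
  by exists 0 => s _; rewrite Normc.normc0.
have [C C00 hC] := dseries_tail_le (twist_periodic0 hchi) 0.
pose k0 : R := 2 `^ (1 - sigma) - 1.
have k00 : 0 < k0.
  rewrite subr_gt0 -[X in X < _](powRr0 2) /powR gt_eqF// ltr_expR mul0r.
  by rewrite mulr_gt0 ?subr_gt0// ln_gt0// ltr1n.
pose A := C0 + `|x| + 1.
exists (C * (1 + A) / k0) => s Ks; rewrite H// Normc.normcM Normc.normcV.
have /andP[h1 h2] := Ksig Ks.
have z2 : 2^-1 <= complex.Re (s + (0 +i* x)) by rewrite Re_vertical; move: rho0; lra.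
have zA : normc (s + (0 +i* x)) + 1 <= A.
  rewrite lerD2r (le_trans (normcD_le _ _))// lerD ?KC//.
  by rewrite (le_trans (normc_le_ReIm _))//= normr0 add0r.
have A0 : 0 <= A by rewrite (le_trans _ zA)// addr_ge0 ?normc_ge0.
have F0 : k0 <= normc (twist_factor (s + (0 +i* x))).
  by apply: normc_twist_factor_ge; rewrite Re_vertical.
have := hC _ A 0%N z2 zA.
rewrite {1}/dpoly big_geq// subr0 powR1 mulr1 big_ord_recl big_ord0 !expr0 addr0 mulr1 => h3.
rewrite ler_pM ?normc_ge0 ?invr_ge0 ?normc_ge0//.
by rewrite lef_pV2 ?posrE// (lt_le_trans k00).
Qed.

End CompactStrip.

Lemma bigmax_sup_lt_le (m : nat) K (f : 'I_m -> R[i] -> R[i]) (e : R) :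
  (forall j, exists B, forall s, K s -> normc (f j s) <= B) ->
  \big[Num.max/0]_(j < m) \big[Num.max/0]_(k < m)
    sup [set normc (f j s - f k s) | s in K] < e ->
  forall j k s, K s -> normc (f j s - f k s) <= e.
Proof.
move=> fB lte j k s Ks; rewrite (le_trans _ (ltW lte))//.
apply: le_trans; last exact: (le_bigmax _ _ j).
apply: le_trans; last exact: (le_bigmax _ _ k).
apply: sup_upper_bound; last by exists s.
split; first by exists (normc (f j s - f k s)), s.
have [B hB] := fB j; have [B' hB'] := fB k; exists (B + B') => _ [z Kz <-].
by rewrite (le_trans (normcB_le _ _))// lerD ?hB ?hB'.
Qed.

Lemma bigmax_sup_le (m : nat) K (f : 'I_m -> R[i] -> R[i]) (e : R) : 0 <= e ->
  (forall j k s, K s -> normc (f j s - f k s) <= e) ->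
  \big[Num.max/0]_(j < m) \big[Num.max/0]_(k < m)
    sup [set normc (f j s - f k s) | s in K] <= e.
Proof.
move=> e0 fe; apply: bigmax_le => // j _; apply: bigmax_le => // k _.
have [[s Ks]|K0] := pselect (exists s, K s).
  apply: ge_sup; first by exists (normc (f j s - f k s)), s.
  by move=> _ [z Kz <-]; exact: fe.
rewrite (_ : [set _ | _ in K] = set0) ?sup0//.
by apply/seteqP; split => // y [z Kz _]; apply: K0; exists z.
Qed.

End DirichletLFunctions.

Theorem theorem2 (R : realType) (m : nat) (hm : (1 <= m)%N)
    (d : 'I_m -> R) (q : 'I_m -> nat) (chi : 'I_m -> int -> R[i])
    (hchi : forall j, is_dirichlet_character (q j) (chi j))
    (K : set (CC R)) (hK : compact K)
    (hKstrip : K `<=` [set s | 2^-1 < complex.Re s < 1]) :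
  countable [set eps : R | 0 < eps /\
    ~ cvg ((fun T : R => T^-1 * fine (lebesgue_measure
        [set tau : R | 0 <= tau <= T /\
          \big[Num.max/0]_(j < m) \big[Num.max/0]_(k < m)
            sup [set Normc.normc (dirichletL (chi j) (s + (0 +i* (d j * tau)))
                            - dirichletL (chi k) (s + (0 +i* (d k * tau))))
                | s in K] < eps])) @ +oo)].
Proof.
have [rho [sigma [C0 [rho0 rho4 sig1 Ksig KC]]]] := compact_strip hK hKstrip.
pose Phi (j : 'I_m) (tau : R) (s : R[i]) : R[i] := dirichletL (chi j) (s + (0 +i* (d j * tau))).
pose D tau : R := \big[Num.max/0]_(j < m) \big[Num.max/0]_(k < m)
  sup [set normc (Phi j tau s - Phi k tau s) | s in (K : set R[i])].
pose F eps T : R := T^-1 * vol [set tau : R | 0 <= tau <= T /\ D tau < eps].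
apply: (@countable_not_cvg R F) => [e T T0|e e' eta e0 ee' eta0].
  rewrite /F mulr_ge0 ?vol_ge0 ?invr_ge0 ?(ltW T0)//= mulrC ler_pdivrMr// mul1r.
  rewrite (le_trans (vol_le (@subset_itv0 _ _ _) (@subset_refl _ _)))//.
  by rewrite vol_itv ?subr0// ltW.
pose e2 := (e + e') / 2; have ee2 : e < e2 by rewrite /e2; lra.
have e2e' : e2 < e' by rewrite /e2; lra.
have apr j : approximable K (Phi j).
  exact: (dirichletL_approximable rho0 rho4 sig1 Ksig KC (d j) (hchi j)).
have [T0 hT0] := close_set_compare apr ee2 eta0.
exists (Num.max 1 T0) => T; rewrite ge_max => /andP[T1 /hT0[T0' hT0']].
exists (Num.max 1 T0') => T'; rewrite ge_max => /andP[T1' /hT0'].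
have lo : vol [set tau : R | 0 <= tau <= T' /\ D tau < e] <= vol (close_set K Phi e T').
  apply: vol_le (@subset_itv0 _ _ _) => tau [tT De]; split => //.
  apply: bigmax_sup_lt_le De => j.
  exact: (dirichletL_bounded rho0 sig1 Ksig KC (d j * tau) (hchi j)).
have hi : vol (close_set K Phi e2 T) <= vol [set tau : R | 0 <= tau <= T /\ D tau < e'].
  apply: vol_le (@subset_itv0 _ _ _) => tau [tT De]; split => //.
  rewrite (le_lt_trans _ e2e')//; apply: bigmax_sup_le => //; rewrite /e2; lra.
move=> h; rewrite /F (@le_trans _ _ (T'^-1 * vol (close_set K Phi e T')))//.
  by rewrite ler_wpM2l// invr_ge0 (le_trans ler01).
rewrite (le_trans h)// lerD2r ler_wpM2l// invr_ge0 (le_trans ler01)//.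
Qed.
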